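(* Let $\mathcal{V}\hookrightarrow\mathcal{H}\hookrightarrow\mathcal{V}'$, $\tau>0$, the forms $(\mathfrak{a}(t))_{t\in[0,\tau]}$ on $\mathcal{V}$ and the associated operators $\mathcal{A}(t)\in\mathcal{L}(\mathcal{V},\mathcal{V}')$ and $A(t)$ on $\mathcal{H}$ be as in the context; in particular, the forms all have domain $\mathcal{V}$, are uniformly bounded and uniformly quasi-coercive. Suppose that there is a constant $M_0>0$ with $$\|\mathcal{A}(t)-\mathcal{A}(s)\|_{\mathcal{L}(\mathcal{V},\mathcal{H})}\le M_0\quad\text{for all } t,s\in[0,\tau],$$ and that $D(A(t_0)^{\frac12})=\mathcal{V}$ for some $t_0\in[0,\tau]$. Then for all $u_0\in\mathcal{V}$ the Cauchy problem $$u'(t)+A(t)u(t)=f(t)\ (t\in(0,\tau]),\qquad u(0)=u_0$$ has maximal $L^2$-regularity in $\mathcal{H}$. In addition, there exists a constant $C>0$ independent of $u_0$ and $f$ such that the solution $u$ satisfies $$\|A(\cdot)u(\cdot)\|_{L^2(0,\tau;\mathcal{H})}+\|u\|_{H^1(0,\tau;\mathcal{H})}\le C\left[\|u_0\|_{\mathcal{V}}+\|f\|_{L^2(0,\tau;\mathcal{H})}\right].$$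
   Context: Setting: $\mathcal{H}$ is a separable Hilbert space over $\mathbb{R}$ or $\mathbb{C}$ with inner product $(\cdot,\cdot)$ and norm $\|\cdot\|$; $\mathcal{V}$ is a separable Hilbert space densely and continuously embedded in $\mathcal{H}$; $\mathcal{V}'$ is the (anti-)dual of $\mathcal{V}$, $\mathcal{H}$ is identified with a dense subspace of $\mathcal{V}'$, and the duality satisfies $\langle\psi,v\rangle=(\psi,v)$ for $\psi\in\mathcal{H}$, $v\in\mathcal{V}$. For $t\in[0,\tau]$, $\mathfrak{a}(t,\cdot,\cdot):\mathcal{V}\times\mathcal{V}\to\mathbb{C}$ is a sesquilinear form with domain $\mathcal{V}$, and there are constants $M,\delta>0$, $\nu\in\mathbb{R}$ such that for all $t\in[0,\tau]$, $u,v\in\mathcal{V}$: $|\mathfrak{a}(t,u,v)|\le M\|u\|_{\mathcal{V}}\|v\|_{\mathcal{V}}$ (uniform boundedness) and $\mathrm{Re}\,\mathfrak{a}(t,u,u)+\nu\|u\|^2\ge\delta\|u\|_{\mathcal{V}}^2$ (uniform quasi-coercivity). $\mathcal{A}(t)\in\mathcal{L}(\mathcal{V},\mathcal{V}')$ is defined by $\langle\mathcal{A}(t)u,v\rangle=\mathfrak{a}(t,u,v)$, and $A(t)$ is the part of $\mathcal{A}(t)$ in $\mathcal{H}$: $D(A(t))=\{u\in\mathcal{V}:\mathcal{A}(t)u\in\mathcal{H}\}$, $A(t)u=\mathcal{A}(t)u$. The hypothesis on differences means $|\mathfrak{a}(t,u,v)-\mathfrak{a}(s,u,v)|\le M_0\|u\|_{\mathcal{V}}\|v\|$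 for all $u,v\in\mathcal{V}$, $t,s\in[0,\tau]$. Maximal $L^2$-regularity in $\mathcal{H}$ of the Cauchy problem: for every $f\in L^2(0,\tau;\mathcal{H})$ there exists a unique $u\in H^1(0,\tau;\mathcal{H})$ with $u(t)\in D(A(t))$ for a.e. $t\in[0,\tau]$ which is a solution of the problem in the $L^2$-sense.
   Formalization: The formal statement adds that t ↦ a(t,u,v) is Lebesgue measurable on [0,τ] for all u, v in V, without which the claim fails (H=V=ℂ with a bounded nonmeasurable coefficient); D(A(t_0)^{1/2}) is read as the domain of (A(t_0)+ν)^{1/2}. *)

(* Defs.v *)
From HB Require Import structures.
From mathcomp Require Import all_boot all_order all_algebra.
From mathcomp Require Import complex.
From mathcomp Require Import all_classical all_reals all_analysis.

Set Implicit Arguments.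
Unset Strict Implicit.
Unset Printing Implicit Defensive.

Import Order.TTheory GRing.Theory Num.Theory.
Import numFieldNormedType.Exports.

Local Open Scope classical_set_scope.
Local Open Scope ring_scope.

(* The scalar field is either R or R[i]. *)
Inductive scalar_kind := RealScalars | ComplexScalars.

Definition scalars (R : realType) (k : scalar_kind) : numFieldType :=
  match k with RealScalars => R | ComplexScalars => R[i] end.

Definition reK (R : realType) (k : scalar_kind) : scalars R k -> R :=
  match k return scalars R k -> R with
  | RealScalars => fun x => x
  | ComplexScalars => fun z => complex.Re z
  end.
Arguments reK {R k}.

Definition ofR (R : realType) (k : scalar_kind) : R -> scalars R k :=
  match k return R -> scalars R k with
  | RealScalars => fun x => x
  | ComplexScalars => fun x => Complex x 0
  end.
Arguments ofR {R k}.

Definition conjK (R : realType) (k : scalar_kind) : scalars R k -> scalars R k :=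
  match k return scalars R k -> scalars R k with
  | RealScalars => fun x => x
  | ComplexScalars => fun z => conjc z
  end.
Arguments conjK {R k}.

(* In the library the norm of a normed module over K takes its values in K;
   rnorm is the same norm, as an element of R. *)
Definition rnorm (R : realType) (k : scalar_kind)
  (E : normedZmodType (scalars R k)) (x : E) : R := reK `|x|.

(* A Hilbert space is a completeNormedModType whose norm comes from an inner
   product (linear in its first argument). *)
Definition inner_product_of_norm (R : realType) (k : scalar_kind)
    (E : normedModType (scalars R k)) (ip : {dot E for @conjK R k}) : Prop :=
  forall x : E, ip x x = `|x| ^+ 2.

Definition separable (T : topologicalType) : Prop :=
  exists e : nat -> T, dense (range e).

Section VectorValued.
Variables (R : realType) (k : scalar_kind).
Local Notation K := (scalars R k).
Local Notation mu := (@lebesgue_measure R).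

Section Bochner.
Variables (E : normedModType K) (D : set R).
Implicit Types f s : R -> E.

Definition simple s : Prop :=
  finite_set (s @` D) /\
  forall y : E, measurable (D `&` s @^-1` [set y] : set (measurableTypeR R)).

Definition integrable_simple s : Prop :=
  simple s /\ forall y : E, y != 0 -> (mu (D `&` s @^-1` [set y]) < +oo)%E.

Definition simple_integral s : E :=
  \sum_(y \in s @` D) ofR (fine (mu (D `&` s @^-1` [set y]))) *: y.

Definition strongly_measurable f : Prop :=
  exists s : nat -> R -> E, (forall n, simple (s n)) /\
    {ae mu, forall t, D t -> s n t @[n --> \oo] --> f t}.

(* f is Bochner integrable over D, with integral x. *)
Definition bochner_integral f (x : E) : Prop :=
  exists s : nat -> R -> E,
    [/\ forall n, integrable_simple (s n),
        {ae mu, forall t, D t -> s n t @[n --> \oo] --> f t},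
        (\int[mu]_(t in D) (rnorm (s n t - f t))%:E)%E @[n --> \oo] --> 0%E &
        simple_integral (s n) @[n --> \oo] --> x].

Definition in_L2 f : Prop :=
  strongly_measurable f /\
  (\int[mu]_(t in D) (rnorm (f t) ^+ 2)%:E < +oo)%E.

Definition L2norm f : R := Num.sqrt (\int[mu]_(t in D) (rnorm (f t) ^+ 2)).

End Bochner.

Section Sobolev.
Variables (E : normedModType K) (tau : R).
Implicit Types u g : R -> E.

(* C^1 functions with compact support in ]0, tau[. *)
Definition test_function (phi : R -> R) : Prop :=
  [/\ forall t, derivable phi t 1,
      continuous (derive1 phi) &
      exists a b : R, [/\ 0 < a, b < tau &
        forall t, ~ (a <= t <= b) -> phi t = 0]].

(* int_0^tau phi' u dt = - int_0^tau phi g dt for every test function phi. *)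
Definition weak_derivative u g : Prop :=
  forall phi, test_function phi -> exists x : E,
    bochner_integral `]0, tau[ (fun t => ofR (derive1 phi t) *: u t) x /\
    bochner_integral `]0, tau[ (fun t => ofR (phi t) *: g t) (- x).

(* u belongs to H^1(0, tau; E) and its weak derivative is g. *)
Definition in_H1 u g : Prop :=
  [/\ in_L2 `]0, tau[ u, in_L2 `]0, tau[ g & weak_derivative u g].

Definition H1norm u g : R :=
  Num.sqrt (L2norm `]0, tau[ u ^+ 2 + L2norm `]0, tau[ g ^+ 2).

(* The value at 0 of an H^1 function is that of its continuous
   representative. *)
Definition initial_value u (x : E) : Prop :=
  exists w : R -> E,
    [/\ {within `[0, tau], continuous w},
        {ae mu, forall t, 0 < t < tau -> u t = w t} & w 0 = x].

End Sobolev.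

Section Operators.
Variable E : normedModType K.

(* Unbounded operators are given by their graph: A x y means that x belongs
   to D(A) and A x = y. *)
Definition operator := E -> E -> Prop.
Implicit Type A : operator.

Definition op_dom A : set E := [set x | exists y, A x y].

(* A + c *)
Definition op_shift A (c : R) : operator := fun x y => A x (y - ofR c *: x).

(* For A positive with 0 in its resolvent set:
   A^{-1/2} x = 1/pi int_0^oo l^{-1/2} (l + A)^{-1} x dl
   (r l is (l + A)^{-1} x), and A^{1/2} is the inverse of A^{-1/2}. *)
Definition op_invsqrt A : operator := fun x z =>
  exists r : R -> E,
    (forall l : R, 0 < l -> op_shift A l (r l) x) /\
    bochner_integral `]0, +oo[
      (fun l => ofR ((pi * Num.sqrt l)^-1) *: r l) z.

Definition op_sqrt A : operator := fun z x => op_invsqrt A x z.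

End Operators.

Section CauchyProblem.
Variables (E : normedModType K) (tau : R) (A : R -> operator E).

(* u solves u' + A(t) u = f, u(0) = x, where du is the derivative of u and
   Au t is A(t) u(t). *)
Definition L2_solution_with (f : R -> E) (x : E) (u du Au : R -> E) : Prop :=
  [/\ in_H1 tau u du,
      {ae mu, forall t, 0 < t < tau -> A t (u t) (Au t)},
      {ae mu, forall t, 0 < t < tau -> du t + Au t = f t} &
      initial_value tau u x].

Definition L2_solution (f : R -> E) (x : E) (u : R -> E) : Prop :=
  exists du Au : R -> E, L2_solution_with f x u du Au.

Definition maximal_L2_regularity (x : E) : Prop :=
  forall f : R -> E, in_L2 `]0, tau[ f ->
    (exists u, L2_solution f x u) /\
    (forall u v, L2_solution f x u -> L2_solution f x v ->
       {ae mu, forall t, 0 < t < tau -> u t = v t}).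

End CauchyProblem.

End VectorValued.

(* The part in H of the operator V -> V' associated with the form a: the
   embedding j : V -> H sees V as a subspace of H, and y in H is identified
   with the functional v |-> (y, v) of V'. *)
Definition part_in_H (R : realType) (k : scalar_kind)
    (H V : normedModType (scalars R k)) (ip : {dot H for @conjK R k})
    (j : V -> H) (a : V -> V -> scalars R k) : operator H :=
  fun x y => exists2 u : V, j u = x & forall v : V, a u v = ip y (j v).

(* Main.v *)
(* Only the real parts of the inner products and of the forms matter: H and V
   become real Hilbert spaces.  Let S be the operator of the form a(t0) + nu and
   T = S^(-1/2), written as a resolvent integral.  Uniform boundedness and
   D(S^(1/2)) = V make T an isomorphism from H onto V, and the bound on differences
   gives A(t) = S + B(t) with B(t) : V -> H uniformly bounded.  For u' + S u = f the
   unknown is h = S u in L^2(H).  Testing with the approximations n (n + S)^-1 gives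
   |S^(1/2) u(t)|^2 + c int |S u|^2 <= |S^(1/2) u(0)|^2 + C int |f|^2, so the data f
   admitting a solution form a closed subspace of L^2(H); a datum orthogonal to it
   vanishes, hence it is everything.  The perturbation B(t) is added by Picard
   iteration, and weak derivatives are identified with primitives by the
   du Bois-Reymond lemma. *)
Require Import Defs.
From HB Require Import structures.
From mathcomp Require Import all_boot all_order all_algebra.
From mathcomp Require Import complex.
From mathcomp Require Import all_classical all_reals all_analysis.
From mathcomp Require Import measurable_realfun.
From mathcomp Require Import ring lra.

Set Implicit Arguments.
Unset Strict Implicit.
Unset Printing Implicit Defensive.

Import Order.TTheory GRing.Theory Num.Theory.
Import numFieldNormedType.Exports.

Local Open Scope classical_set_scope.
Local Open Scope ring_scope.

(** * Real Hilbert spaces and coercive forms *)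

(** The form is not symmetric, so S need not be self-adjoint, and V = D(S^(1/2)) is a genuine
    hypothesis on which everything turns. Read through T, the form becomes sigma(x, y) = s(T x, T
    y), bounded and coercive on H; for self-adjoint S it would be the inner product. Along u' + S u
    = f the derivative of |S^(1/2) u|^2 is formally 2 sigma(f, S u) - 2 sigma(S u, S u), and
    coercivity of sigma is what puts |S u|^2 on the left of the energy estimate. The boundedness of
    T between H and V is not given and comes from uniform boundedness. The perturbation B(t) is of
    the order of S^(1/2) and not small. It is harmless because the energy estimate also bounds
    |S^(1/2) u(t)| at almost every t by the data up to time t: this Volterra structure makes an
    exponential weight contract, whatever tau and the bound on B are. Integrals and measurability
    are handled weakly, against each vector y, where limits and bounded operators pass easily;
    separability gives back the strong notions of the statement. Uniqueness is read off the
    estimate, which is therefore proved for every solution and not only for the constructed one. *)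

Definition sqnorm_cauchy (R : realType) (E : lmodType R) (q : E -> E -> R)
    (s : nat -> E) :=
  forall e, 0 < e -> exists N, forall m n, (N <= m)%N -> (N <= n)%N ->
    q (s m - s n) (s m - s n) <= e.

(** Completeness is expressed by the inner product alone, so that the real space underlying a
    Hilbert space over R or C fits without a second topology. *)
Record hilb (R : realType) := Hilb {
  hsort :> lmodType R;
  dot : hsort -> hsort -> R;
  dotC : forall x y, dot x y = dot y x;
  dotDl : forall x y z, dot (x + y) z = dot x z + dot y z;
  dotZl : forall a x y, dot (a *: x) y = a * dot x y;
  dot_ge0 : forall x, 0 <= dot x x;
  dot_eq0 : forall x, dot x x = 0 -> x = 0;
  dot_complete : forall s, sqnorm_cauchy dot s ->
    exists x, dot (s n - x) (s n - x) @[n --> \oo] --> (0 : R) }.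

(** * Minimizing sequences of quadratic functionals on a subspace *)

Section Minimization.
Variables (R : realType) (W : lmodType R) (P : set W) (q : W -> W -> R)
  (l : W -> R) (C : R).
Hypotheses (P0 : P 0) (PD : forall v w, P v -> P w -> P (v + w))
  (PZ : forall a v, P v -> P (a *: v))
  (qC : forall v w, P v -> P w -> q v w = q w v)
  (qD : forall u v w, P u -> P v -> P w -> q (u + v) w = q u w + q v w)
  (qZ : forall a v w, P v -> P w -> q (a *: v) w = a * q v w)
  (q_ge0 : forall v, P v -> 0 <= q v v)
  (lD : forall v w, P v -> P w -> l (v + w) = l v + l w)
  (lZ : forall a v, P v -> l (a *: v) = a * l v)
  (l_le : forall v, P v -> l v ^+ 2 <= C * q v v).

(* The minimizing sequences of q v v - 2 l v are Cauchy for q. *)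
Lemma quadratic_minimization : exists v : nat -> W,
  [/\ forall n, P (v n), sqnorm_cauchy q v &
      forall w, P w -> q (v n) w @[n --> \oo] --> l w].
Proof.
pose J v := q v v - 2 * l v.
(* If J v < - c with c = |C|, then (q v v + c)^2 < 4 (l v)^2 <= 4 c q v v, against (q v v - c)^2 >=
   0. *)
have C_ge0 v : P v -> - `|C| <= J v.
  move=> Pv; have := l_le Pv; have := q_ge0 Pv; rewrite /J => q0 lle.
  have := ler_norm C; have := normr_ge0 C.
  set c := `|C|; move=> c0 Cc.
  have H1 : l v ^+ 2 <= c * q v v by apply: (le_trans lle); rewrite ler_wpM2r.
  have [qc|qc] := leP (2 * l v) (q v v + c); first lra.
  have H3 : (q v v + c)^+2 < (2 * l v)^+2 by rewrite ltrXn2r//; lra.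
  have H4 : 4 * (c * q v v) <= (q v v + c)^+2.
    have := sqr_ge0 (q v v - c); rewrite !expr2; lra.
  exfalso; rewrite exprMn in H3; lra.
pose S := [set J v | v in P].
have infS : has_inf S.
  split; first by exists (J 0), 0.
  by exists (- `|C|) => _ [v Pv <-]; exact: C_ge0.
have /choice[v vP] : forall n : nat, exists v, P v /\ J v < inf S + n.+1%:R^-1.
  move=> n; have n0 : 0 < n.+1%:R^-1 :> R by rewrite invr_gt0.
  by have [_ [v Pv <-] Jv] := inf_adherent n0 infS; exists v.
have infle w : P w -> inf S <= J w.
  by move=> Pw; apply: ge_inf; [by case: infS|exists w].
have vd n := (vP n).2; have Pv n := (vP n).1.
have PN w : P w -> P (- w) by rewrite -scaleN1r; exact: PZ.
have qDr a b c : P a -> P b -> P c -> q c (a + b) = q c a + q c b.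
  by move=> Pa Pb Pc; rewrite qC ?qD// 1?(qC Pa)// 1?(qC Pb)//; exact: PD.
have qZr a b c : P b -> P c -> q c (a *: b) = a * q c b.
  by move=> Pb Pc; rewrite qC ?qZ// 1?(qC Pb)//; exact: PZ.
have JDZ x w t : P x -> P w ->
    J (x + t *: w) = J x + 2 * t * (q x w - l w) + t ^+ 2 * q w w.
  move=> Px Pw; have Ptw := PZ t Pw.
  rewrite /J qD ?qDr ?qZ ?qZr ?qDr ?qZr ?lD ?lZ// 1?(qC Pw Px); last exact: PD.
  by rewrite -/(J x) /J; ring.
exists v; split=> //.
  move=> e e0; exists (Num.truncn (4 / e)).+1 => m n Nm Nn.
  have inv k : ((Num.truncn (4 / e)).+1 <= k)%N -> k.+1%:R^-1 <= e / 4 :> R.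
    move=> Nk; rewrite -[e / 4]invrK lef_pV2 ?posrE ?invr_gt0 ?divr_gt0//.
    rewrite invf_div (le_trans (ltW (truncnS_gt _)))//.
    by rewrite ler_nat (leq_trans Nk).
  (* At the midpoint of v m and v n, J is the mean of its two values minus q (v m - v n) (v m - v n)
     / 4. Hence that form is at most 2 (1/m.+1 + 1/n.+1), which is at most e when both inverses are
     below e / 4. *)
  have := infle _ (PD (Pv m) (PZ 2^-1 (PD (Pv n) (PN _ (Pv m))))).
  rewrite JDZ//; last by apply: PD => //; exact: PN.
  have -> : q (v m) (v n - v m) = q (v m) (v n) - q (v m) (v m).
    by rewrite qDr//; [rewrite -scaleN1r qZr// mulN1r|exact: PN].
  have -> : l (v n - v m) = l (v n) - l (v m).
    by rewrite lD//; [rewrite -scaleN1r lZ// mulN1r|exact: PN].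
  have qB a b : P a -> P b -> q (a - b) (a - b) = q a a - 2 * q a b + q b b.
    move=> Pa Pb; have PNb := PZ (-1) Pb; rewrite -scaleN1r.
    rewrite (qD Pa PNb (PD Pa PNb)) (qDr _ _ _ Pa PNb Pa) (qDr _ _ _ Pa PNb PNb).
    by rewrite !qZ// !qZr// (qC Pb Pa); ring.
  rewrite !qB// (qC (Pv n) (Pv m)).
  have := vd n; have := vd m; have := inv _ Nm; have := inv _ Nn.
  rewrite /J expr2; move: (m.+1%:R^-1 : R) (n.+1%:R^-1 : R) => im iN.
  move: (q _ _) (q _ _) (q _ _) (l _) (l _) (inf S) => A B D a b i.
  move=> H1 H2 H3 H4 H5; lra.
move=> w Pw; apply/cvgrPdist_le => e e0.
(* The step - d / Q along w nearly minimizes J; the added 1 keeps the denominator positive where q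
   degenerates. *)
pose Q := q w w + 1.
have Q0 : 0 < Q by rewrite /Q ltr_wpDl// q_ge0.
near=> n.
have nn : n.+1%:R^-1 <= e ^+ 2 / Q.
  rewrite -[e ^+ 2 / Q]invrK lef_pV2 ?posrE ?invr_gt0 ?divr_gt0 ?exprn_gt0//.
  rewrite invf_div (@le_trans _ _ n%:R)//; last by rewrite ler_nat.
  by near: n; exact: nbhs_infty_ger.
set d := q (v n) w - l w; rewrite distrC -/d.
have := infle _ (PD (Pv n) (PZ (- d / Q) Pw)); rewrite JDZ// -/d.
have := vd n; move=> Jn.
have -> : J (v n) + 2 * (- d / Q) * d + (- d / Q) ^+ 2 * q w w =
   J (v n) - (d ^+ 2 / Q) * (1 + Q ^-1).
  have qwE : q w w = Q - 1 by rewrite /Q addrK.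
  by rewrite qwE; field; rewrite gt_eqF.
move=> H.
have dQ : d ^+ 2 / Q <= e ^+ 2 / Q.
  apply: le_trans nn.
  have H0 : 0 <= d ^+ 2 / Q by rewrite divr_ge0 ?sqr_ge0// ltW.
  have : 0 <= (d ^+ 2 / Q) * Q^-1 by rewrite mulr_ge0// invr_ge0 ltW.
  rewrite mulrDr mulr1 in H; move: H0 H Jn.
  move: (d ^+ 2 / Q / Q) (d ^+ 2 / Q) (n.+1%:R^-1 : R) (J _) (inf S).
  by move=> p1 p2 p3 p4 p5 H1 H2 H3 H4; lra.
rewrite ler_pM2r ?invr_gt0// in dQ.
rewrite -(ler_pXn2r (n:=2)) ?nnegrE ?normr_ge0 ?(ltW e0) ?real_normK ?num_real //.
Unshelve. all: by end_near. Qed.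

End Minimization.

Section Hilbert.
Variables (R : realType) (E : hilb R).
Implicit Types (x y z : E) (s : nat -> E).

Lemma dotDr x y z : dot z (x + y) = dot z x + dot z y.
Proof. by rewrite dotC dotDl !(dotC z). Qed.

Lemma dotZr a x y : dot y (a *: x) = a * dot y x.
Proof. by rewrite dotC dotZl (dotC y). Qed.

Lemma dotNl x y : dot (- x) y = - dot x y.
Proof. by rewrite -scaleN1r dotZl mulN1r. Qed.

Lemma dotNr x y : dot x (- y) = - dot x y.
Proof. by rewrite dotC dotNl dotC. Qed.

Lemma dotBl x y z : dot (x - y) z = dot x z - dot y z.
Proof. by rewrite dotDl dotNl. Qed.

Lemma dotBr x y z : dot z (x - y) = dot z x - dot z y.
Proof. by rewrite dotDr dotNr. Qed.

Lemma dot0l x : dot 0 x = 0.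
Proof. by rewrite -(scale0r 0) dotZl mul0r. Qed.

Lemma dot0r x : dot x 0 = 0.
Proof. by rewrite dotC dot0l. Qed.

Definition hn x : R := Num.sqrt (dot x x).

Lemma hn_ge0 x : 0 <= hn x.
Proof. exact: sqrtr_ge0. Qed.

Lemma sqr_hn x : hn x ^+ 2 = dot x x.
Proof. by rewrite sqr_sqrtr// dot_ge0. Qed.

Lemma hnZ a x : hn (a *: x) = `|a| * hn x.
Proof.
by rewrite /hn dotZl dotZr mulrA -expr2 sqrtrM ?sqr_ge0// sqrtr_sqr.
Qed.

Lemma hnN x : hn (- x) = hn x.
Proof. by rewrite -scaleN1r hnZ normrN1 mul1r. Qed.

Lemma hnB x y : hn (x - y) = hn (y - x).
Proof. by rewrite -hnN opprB. Qed.

Lemma hn0 : hn 0 = 0.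
Proof. by rewrite /hn dot0l sqrtr0. Qed.

Lemma hn_eq0 x : hn x = 0 -> x = 0.
Proof.
by move=> x0; apply: dot_eq0; rewrite -sqr_hn x0 expr0n.
Qed.

Lemma dot_le_hn x y : dot x y <= hn x * hn y.
Proof.
have [y0|y0] := eqVneq (hn y) 0.
  by rewrite (hn_eq0 y0) dot0r hn0 mulr0.
have [x0|x0] := eqVneq (hn x) 0.
  by rewrite (hn_eq0 x0) dot0l hn0 mul0r.
have := dot_ge0 (hn y *: x - hn x *: y).
rewrite dotBl !dotBr !dotZl !dotZr (dotC y x) -!sqr_hn.
set a := hn x; set b := hn y; set c := dot x y => H.
have ab : 0 < a * b by rewrite mulr_gt0// lt_def ?x0 ?y0 hn_ge0.
rewrite -(ler_pM2l ab).
by move: H; rewrite !expr2; lra.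
Qed.

Lemma normr_dot_le x y : `|dot x y| <= hn x * hn y.
Proof.
by rewrite ler_norml dot_le_hn andbT lerNl -dotNl (le_trans (dot_le_hn _ _))// hnN.
Qed.

Lemma hnD x y : hn (x + y) <= hn x + hn y.
Proof.
rewrite -(ler_pXn2r (n:=2)) ?nnegrE ?addr_ge0 ?hn_ge0//.
rewrite sqrrD !sqr_hn dotDl !dotDr (dotC y x).
have := dot_le_hn x y; rewrite mulr2n => ?; lra.
Qed.

Lemma hn_sub x y : hn (x - y) <= hn x + hn y.
Proof. by rewrite (le_trans (hnD _ _))// hnN. Qed.

Lemma hn_triangle z x y : hn (x - y) <= hn (x - z) + hn (z - y).
Proof.
have -> : x - y = (x - z) + (z - y) by rewrite addrA subrK.
exact: hnD.
Qed.

Lemma dot_ext x y : (forall z, dot x z = dot y z) -> x = y.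
Proof.
by move=> xy; apply/eqP; rewrite -subr_eq0; apply/eqP/dot_eq0; rewrite dotBl xy subrr.
Qed.

Lemma hn_le_dual x C : 0 <= C -> (forall y, dot x y <= C * hn y) -> hn x <= C.
Proof.
move=> C0 /(_ x); rewrite -sqr_hn.
have [->|x0] := eqVneq (hn x) 0; first by [].
by rewrite expr2 ler_pM2r// lt_def x0 hn_ge0.
Qed.

Definition hcvg s x := hn (s n - x) @[n --> \oo] --> (0 : R).

Lemma hcvgP s x : hcvg s x <->
  forall e, 0 < e -> exists N, forall n, (N <= n)%N -> hn (s n - x) <= e.
Proof.
split=> [/cvgrPdist_le H e e0|H].
  have [N _ HN] := H _ e0; exists N => n Nn; have := HN n Nn.
  by rewrite sub0r normrN ger0_norm// hn_ge0.
apply/cvgrPdist_le => e e0; have [N HN] := H _ e0; exists N => // n Nn.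
by rewrite sub0r normrN ger0_norm ?hn_ge0//; exact: HN.
Qed.

Lemma hcvg_uniq s x y : hcvg s x -> hcvg s y -> x = y.
Proof.
move=> /hcvgP sx /hcvgP sy; apply/eqP; rewrite -subr_eq0; apply/eqP/hn_eq0/eqP.
rewrite eq_le hn_ge0 andbT; apply/ler_addgt0Pr => e e0; rewrite add0r.
have e2 : 0 < e / 2 by rewrite divr_gt0.
have [N1 H1] := sx _ e2; have [N2 H2] := sy _ e2.
have := H1 _ (leq_maxl N1 N2); have := H2 _ (leq_maxr N1 N2).
have := hn_triangle (s (maxn N1 N2)) x y; rewrite (hnB x (s _)).
by move=> ? ? ?; lra.
Qed.

Lemma hcvg_dot s x y : hcvg s x -> dot (s n) y @[n --> \oo] --> dot x y.
Proof.
move=> sx; apply/cvgrPdist_le => e e0.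
have y0 : 0 < hn y + 1 by rewrite ltr_wpDl// hn_ge0.
have [N HN] := (hcvgP _ _).1 sx _ (divr_gt0 e0 y0).
exists N => // n /= /HN; rewrite ler_pdivlMr// => Hn.
rewrite -dotBl (le_trans (normr_dot_le _ _))// hnB (le_trans _ Hn)//.
by rewrite ler_wpM2l ?hn_ge0// lerDl.
Qed.

Lemma hcvg_le s x C : hcvg s x -> (forall n, hn (s n) <= C) -> hn x <= C.
Proof.
move=> /hcvgP sx sC; apply/ler_addgt0Pr => e e0; have [N HN] := sx _ e0.
have := HN N (leqnn N); have := sC N; have := hnD (s N) (x - s N).
by rewrite [X in hn X <= _]addrC subrK (hnB x); lra.
Qed.

Lemma hcauchyP s : (forall e, 0 < e -> exists N, forall m n, (N <= m)%N ->
    (N <= n)%N -> hn (s m - s n) <= e) -> exists x, hcvg s x.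
Proof.
move=> H; have [|x sx] := @dot_complete _ E s.
  move=> e e0; have [|N HN] := H (Num.sqrt e); first by rewrite sqrtr_gt0.
  by exists N => m n Nm Nn; have := HN m n Nm Nn; rewrite /hn ler_sqrt ?(ltW e0).
exists x; rewrite /hcvg -[0]sqrtr0.
exact: (@cvg_comp _ _ _ _ (fun x : R => Num.sqrt x) _ _ _ sx (@sqrt_continuous _ 0)).
Qed.

(** Besides the limit, the total displacement is recorded: after a shift of the index it bounds any
    tail. *)
Lemma hcauchy_geo s D : (forall n, hn (s n.+1 - s n) <= D * 2^-1 ^+ n) ->
  exists x, hcvg s x /\ hn (x - s 0%N) <= 2 * D.
Proof.
move=> H.
have H2 n p : hn (s (n + p)%N - s n) <= 2 * D * 2^-1 ^+ n * (1 - 2^-1 ^+ p).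
  elim: p => [|p IH]; first by rewrite addn0 !subrr hn0 mulr0.
  rewrite addnS (le_trans (hn_triangle (s (n + p)%N) _ _))//.
  rewrite (le_trans (lerD (H _) IH))// exprD exprS.
  set a := 2^-1 ^+ n; set b := 2^-1 ^+ p.
  by rewrite le_eqVlt; apply/orP; left; apply/eqP; field.
have D0 : 0 <= D by have := le_trans (hn_ge0 _) (H 0%N); rewrite expr0 mulr1.
have H3 n p : hn (s (n + p)%N - s n) <= 2 * D * 2^-1 ^+ n.
  apply: (le_trans (H2 _ _)); apply: ler_piMr.
    by rewrite !mulr_ge0// exprn_ge0// invr_ge0.
  by rewrite gerBl exprn_ge0// invr_ge0.
have cv : (2 * D * 2^-1 ^+ n) @[n --> \oo] --> (0 : R).
  rewrite -[X in _ --> X](mulr0 (2 * D)); apply: cvgMr.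
  by apply: cvg_expr; rewrite ger0_norm ?invr_ge0// invf_lt1// ltr1n.
have [|x sx] := @hcauchyP s.
  move=> e e0; have e2 : 0 < e / 2 by rewrite divr_gt0.
  move/cvgrPdist_le : cv => /(_ _ e2)[N _ HN]; exists N => m n Nm Nn.
  have := HN N (leqnn N); rewrite sub0r normrN ger0_norm; last first.
    by rewrite !mulr_ge0// exprn_ge0// invr_ge0.
  move=> He; have := H3 N (m - N)%N; have := H3 N (n - N)%N; rewrite !subnKC//.
  by have := hn_triangle (s N) (s m) (s n); rewrite (hnB (s N)); lra.
exists x; split => //.
have := @hcvg_le (fun n => s n - s 0%N) (x - s 0%N) (2 * D); apply.
  by rewrite /hcvg; under eq_fun do rewrite opprB addrA subrK.
by move=> n; have := H3 0%N n; rewrite add0n expr0 mulr1.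
Qed.

End Hilbert.

Definition real_linear (R : realType) (E F : lmodType R) (f : E -> F) :=
  (forall x y, f (x + y) = f x + f y) /\ (forall a x, f (a *: x) = a *: f x).

Section RealLinear.
Variables (R : realType) (E F : lmodType R) (f : E -> F).
Hypothesis fl : real_linear f.
Lemma rl0 : f 0 = 0. Proof. by rewrite -(scale0r 0) fl.2 scale0r. Qed.
Lemma rlN x : f (- x) = - f x. Proof. by rewrite -scaleN1r fl.2 scaleN1r. Qed.
Lemma rlB x y : f (x - y) = f x - f y. Proof. by rewrite fl.1 rlN. Qed.
End RealLinear.

Lemma cvg_uniqR (R : realType) (u : nat -> R) (a b : R) :
  u @ \oo --> a -> u @ \oo --> b -> a = b.
Proof.
by move=> /(cvg_lim (@Rhausdorff R)) <- /(cvg_lim (@Rhausdorff R)) <-.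
Qed.

Section Riesz.
Variables (R : realType) (W : lmodType R) (E : hilb R) (g : W -> E)
    (l : W -> R) (C : R).
Hypotheses (gl : real_linear g) (C0 : 0 <= C)
  (lD : forall v w, l (v + w) = l v + l w) (lZ : forall a v, l (a *: v) = a * l v)
  (lC : forall v, l v <= C * hn (g v)).

(** Since [l] is controlled by [hn (g v)], it factors through the closure of the range of [g]: the
    minimizing sequence lives in [W], which need not be complete, and only its image converges. With
    [g] the embedding of V, functionals on V bounded in the norm of H become elements of H. *)
Lemma riesz_dense : exists2 y : E, forall v, l v = dot (g v) y & hn y <= C.
Proof.
have lN v : l (- v) = - l v by rewrite -scaleN1r lZ mulN1r.
have lC2 v : l v ^+ 2 <= C ^+ 2 * dot (g v) (g v).
  rewrite -sqr_hn -exprMn -real_normK ?num_real//.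
  rewrite ler_pXn2r ?nnegrE ?mulr_ge0 ?hn_ge0//.
  by rewrite ler_norml lC andbT lerNl -lN (le_trans (lC _))// (rlN gl) hnN.
have [v [_ cv lv]] : exists v : nat -> W,
  [/\ forall n, [set: W] (v n), sqnorm_cauchy (fun v w => dot (g v) (g w)) v &
      forall w, [set: W] w -> dot (g (v n)) (g w) @[n --> \oo] --> l w].
  apply: (quadratic_minimization (C := C ^+ 2)) => //.
  - by move=> *; exact: dotC.
  - by move=> *; rewrite gl.1 dotDl.
  - by move=> *; rewrite gl.2 dotZl.
  - by move=> *; exact: dot_ge0.
have [y vy] : exists y, hcvg (fun n => g (v n)) y.
  apply: hcauchyP => e e0; have e2 : 0 < e ^+ 2 by rewrite exprn_gt0.
  have [N HN] := cv _ e2; exists N => m n Nm Nn; have := HN m n Nm Nn.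
  by rewrite -sqr_hn ler_pXn2r ?nnegrE ?hn_ge0 ?(ltW e0)// (rlB gl).
have ly w : l w = dot (g w) y.
  have H := lv w Logic.I; rewrite dotC.
  have H2 : dot (g (v n)) (g w) @[n --> \oo] --> dot y (g w) by exact: hcvg_dot.
  exact: cvg_uniqR H H2.
exists y => //.
have [y0|y0] := eqVneq (hn y) 0; first by rewrite y0.
have yp : 0 < hn y by rewrite lt_def y0 hn_ge0.
rewrite -(ler_pM2r yp) -expr2 sqr_hn.
(* [y] is only a limit of vectors g (v n), so the bound on [l] reaches it with an error, at most (C
   + |y|) times the distance from [y] to g (v N). *)
apply/ler_addgt0Pr => e e0.
have e1 : 0 < e / (hn y + C + 1).
  by rewrite divr_gt0// ltr_wpDl// addr_ge0// hn_ge0.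
have [N HN] := (hcvgP _ _).1 vy _ e1.
have {}HN := HN N (leqnn N).
have -> : dot y y = dot (g (v N)) y - dot (g (v N) - y) y by rewrite dotBl; lra.
have Hp : 0 < hn y + C + 1 by rewrite ltr_wpDl// addr_ge0// hn_ge0.
rewrite -ly; have H1 := lC (v N).
have H2 : hn (g (v N)) <= hn y + hn (g (v N) - y).
  by have := hnD y (g (v N) - y); rewrite [X in hn X <= _]addrC subrK.
have H3 := normr_dot_le (g (v N) - y) y; have H4 := ler_norm (- dot (g (v N) - y) y).
rewrite normrN in H4.
move: HN; rewrite ler_pdivlMr//; move: H1 H2 H3 H4.
have := hn_ge0 (g (v N) - y).
move: (hn (g (v N) - y)) (hn (g (v N))) (l _) (dot (g (v N) - y) y) => a b c d.
move=> a0 H1 H2 H3 H4 H5.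
have H6 : C * b <= C * hn y + C * a by rewrite -mulrDr ler_wpM2l.
have : 0 <= a by []. nra.
Qed.

End Riesz.

Lemma riesz (R : realType) (E : hilb R) (l : E -> R) (C : R) : 0 <= C ->
  (forall v w, l (v + w) = l v + l w) -> (forall a v, l (a *: v) = a * l v) ->
  (forall v, l v <= C * hn v) ->
  exists2 y : E, forall v, l v = dot v y & hn y <= C.
Proof. by move=> C0 lD lZ lC; exact: (@riesz_dense _ _ _ id). Qed.

Section BoundedOperator.
Variables (R : realType) (E F : hilb R).

Definition bounded_by (f : E -> F) C := forall x, hn (f x) <= C * hn x.

(** The adjoint is what carries weak measurability and weak integrals through bounded operators. *)
Lemma adjoint_exists (f : E -> F) C : real_linear f -> 0 <= C -> bounded_by f C ->
  exists fa : F -> E, forall x y, dot (f x) y = dot x (fa y).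
Proof.
move=> fl C0 fC.
have /choice[fa fP] : forall y, exists z, forall x, dot (f x) y = dot x z.
  move=> y; have [||||z Hz _] := @riesz R E (fun x => dot (f x) y) (C * hn y).
  - by rewrite mulr_ge0// hn_ge0.
  - by move=> v w; rewrite fl.1 dotDl.
  - by move=> a v; rewrite fl.2 dotZl.
  - move=> v; rewrite (le_trans (dot_le_hn _ _))// mulrAC ler_wpM2r ?hn_ge0//.
  by exists z.
by exists fa.
Qed.

Lemma bounded_cvg (f : E -> F) C s x : real_linear f -> bounded_by f C ->
  hcvg s x -> hcvg (fun n => f (s n)) (f x).
Proof.
move=> fl fC sx; apply/hcvgP => e e0.
have C1 : 0 < `|C| + 1 by rewrite ltr_wpDl.
have [N HN] := (hcvgP _ _).1 sx _ (divr_gt0 e0 C1).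
exists N => n /HN; rewrite ler_pdivlMr// => H; rewrite -(rlB fl).
rewrite (le_trans (fC _))// (le_trans _ H)// mulrC ler_wpM2l ?hn_ge0//.
by rewrite (le_trans (ler_norm _))// lerDl.
Qed.

End BoundedOperator.

Section LaxMilgram.
Variables (R : realType) (E : hilb R) (s : E -> E -> R) (M delta : R).
Hypotheses (sDl : forall u v w, s (u + v) w = s u w + s v w)
  (sZl : forall a u w, s (a *: u) w = a * s u w)
  (sDr : forall u v w, s w (u + v) = s w u + s w v)
  (sZr : forall a u w, s w (a *: u) = a * s w u)
  (M0 : 0 <= M) (sM : forall u v, s u v <= M * hn u * hn v)
  (delta0 : 0 < delta) (sc : forall u, delta * hn u ^+ 2 <= s u u).

(* Least squares: the range of the operator of s is closed by coercivity, and
   its orthogonal complement is trivial for the same reason. *)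
Lemma lax_milgram (l : E -> R) (C : R) : 0 <= C ->
  (forall v w, l (v + w) = l v + l w) -> (forall a v, l (a *: v) = a * l v) ->
  (forall v, l v <= C * hn v) -> exists u, forall v, s u v = l v.
Proof.
move=> C0 lD lZ lC; have [b lb _] := riesz C0 lD lZ lC.
have /choice[G GP] : forall u, exists z, (forall v, s u v = dot v z) /\ hn z <= M * hn u.
  move=> u; have [||||z Hz zM] := @riesz R E (s u) (M * hn u).
  - by rewrite mulr_ge0// hn_ge0.
  - by move=> v w; exact: sDr.
  - by move=> a v; exact: sZr.
  - by move=> v; exact: sM.
  by exists z.
have Gl : real_linear G.
  split=> [x y|a x]; apply: dot_ext => z; rewrite dotC -(GP _).1.
    by rewrite sDl !(GP _).1 -dotDr dotC.
  by rewrite sZl (GP _).1 -dotZr dotC.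
have GM : bounded_by G M by move=> x; exact: (GP x).2.
have Gc u : delta * hn u <= hn (G u).
  have [->|u0] := eqVneq (hn u) 0; first by rewrite mulr0 hn_ge0.
  have up : 0 < hn u by rewrite lt_def u0 hn_ge0.
  rewrite -(ler_pM2r up) -mulrA -expr2 (le_trans (sc _))// (GP u).1.
  by rewrite mulrC dot_le_hn.
have [v [_ cv lv]] : exists v : nat -> E,
  [/\ forall n, [set: E] (v n), sqnorm_cauchy (fun v w => dot (G v) (G w)) v &
      forall w, [set: E] w -> dot (G (v n)) (G w) @[n --> \oo] --> dot b (G w)].
  apply: (quadratic_minimization (C := hn b ^+ 2)) => //.
  - by move=> *; exact: dotC.
  - by move=> *; rewrite Gl.1 dotDl.
  - by move=> *; rewrite Gl.2 dotZl.
  - by move=> *; exact: dot_ge0.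
  - by move=> *; rewrite Gl.1 dotDr.
  - by move=> *; rewrite Gl.2 dotZr.
  - move=> u _; rewrite -sqr_hn -exprMn -real_normK ?num_real//.
    by rewrite ler_pXn2r ?nnegrE ?mulr_ge0 ?hn_ge0// normr_dot_le.
have [u vu] : exists u, hcvg v u.
  apply: hcauchyP => e e0; have e2 : 0 < (delta * e) ^+ 2 by rewrite exprn_gt0 ?mulr_gt0.
  have [N HN] := cv _ e2; exists N => m n Nm Nn; have := HN m n Nm Nn.
  have de : 0 <= delta * e by rewrite mulr_ge0 ?ltW.
  rewrite -sqr_hn ler_pXn2r ?nnegrE ?hn_ge0// => H.
  by rewrite -(ler_pM2l delta0) (le_trans (Gc _)).
have Gu w : dot (G u - b) (G w) = 0.
  apply/eqP; rewrite dotBl subr_eq0; apply/eqP.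
  have H2 : dot (G (v n)) (G w) @[n --> \oo] --> dot (G u) (G w).
    exact: hcvg_dot (bounded_cvg Gl GM vu).
  exact: cvg_uniqR H2 (lv w Logic.I).
have /eqP : G u - b = 0.
  apply: hn_eq0; have := sc (G u - b); rewrite (GP _).1 Gu => H.
  apply/eqP; rewrite -sqrf_eq0 eq_le sqr_ge0 andbT.
  by rewrite -(ler_pM2l delta0) mulr0.
by rewrite subr_eq0 => /eqP Gub; exists u => w; rewrite (GP u).1 Gub lb.
Qed.

End LaxMilgram.

Section UniformBoundedness.
Variables (R : realType) (E : hilb R) (p : nat -> E -> R) (c : nat -> R).
Hypotheses (pD : forall n x y, p n (x + y) <= p n x + p n y)
  (pZ : forall n a x, p n (a *: x) = `|a| * p n x)
  (pc : forall n x, p n x <= c n * hn x)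
  (pb : forall x, exists B, forall n, p n x <= B).

(* Gliding hump (Sokal): max (p (x + y)) (p (x - y)) >= p y. *)
Lemma uniform_boundedness : exists2 C, 0 <= C & forall n x, p n x <= C * hn x.
Proof.
apply: contrapT => nC.
have p0 n : p n 0 = 0 by rewrite -(scale0r 0) pZ normr0 mul0r.
have pN n x : p n (- x) = p n x by rewrite -scaleN1r pZ normrN1 mul1r.
have p_ge0 n x : 0 <= p n x.
  by have := pD n x (- x); rewrite subrr p0 pN; lra.
(* [N k] is the supremum of the seminorm [p (nk k)] over the unit ball, chosen beyond 4^k k, and
   [xi k] attains it up to a quarter. *)
have /choice[nk /choice[xi /choice[N nP]]] : forall k : nat, exists n xi N,
    [/\ hn xi <= 1, 3 / 4 * N <= p n xi, 4 ^+ k * k%:R <= N &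
        forall x, p n x <= N * hn x].
  move=> k; set B := 4 ^+ k * k%:R : R.
  have B0 : 0 <= B by rewrite mulr_ge0// exprn_ge0.
  have [n [x xB]] : exists n x, B * hn x < p n x.
    apply: contrapT => H; apply: nC; exists B => // n x.
    by rewrite leNgt; apply/negP => H2; apply: H; exists n, x.
  pose S := [set p n x | x in [set x | hn x <= 1]].
  have supS : has_sup S.
    split; first by exists (p n 0), 0 => //=; rewrite hn0.
    exists `|c n| => _ [y /= y1 <-]; rewrite (le_trans (pc _ _))//.
    rewrite (@le_trans _ _ (`|c n| * hn y))//.
      by rewrite ler_wpM2r ?hn_ge0// ler_norm.
    by rewrite ler_piMr.
  have hx : 0 < hn x.
    rewrite lt_def hn_ge0 andbT; apply/eqP => hx0.
    by move: xB; rewrite (hn_eq0 hx0) p0 hn0 mulr0 ltxx.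
  have pS y : p n y <= sup S * hn y.
    have [y0|y0] := eqVneq (hn y) 0; first by rewrite (hn_eq0 y0) p0 hn0 mulr0.
    have yp : 0 < hn y by rewrite lt_def y0 hn_ge0.
    rewrite -ler_pdivrMr//; apply: ub_le_sup; first by case: supS.
    exists ((hn y)^-1 *: y) => /=.
      by rewrite hnZ ger0_norm ?invr_ge0 ?hn_ge0// mulVf.
    by rewrite pZ ger0_norm ?invr_ge0 ?hn_ge0// mulrC.
  have BS : B < sup S.
    by rewrite -(ltr_pM2r hx) (lt_le_trans xB)// pS.
  have S0 : 0 < sup S / 4 by rewrite divr_gt0// (le_lt_trans B0).
  have [_ [y /= y1 <-] Hy] := sup_adherent S0 supS.
  exists n, y, (sup S); split=> //; [lra|exact: ltW].
(* The hump 4^-k xi k is added or subtracted, whichever leaves the seminorm of the sum at least that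
   of the hump. *)
pose step k x := let y := 4^-1 ^+ k *: xi k in
  if p (nk k) y <= p (nk k) (x + y) then x + y else x - y.
pose fix X k := if k is k'.+1 then step k' (X k') else 0.
have q4 k : 0 < 4^-1 ^+ k :> R by rewrite exprn_gt0// invr_gt0.
have stepP k : hn (X k.+1 - X k) <= 4^-1 ^+ k /\
    4^-1 ^+ k * (3 / 4 * N k) <= p (nk k) (X k.+1).
  have [x1 xN _ _] := nP k.
  set y := 4^-1 ^+ k *: xi k.
  have hy : hn y <= 4^-1 ^+ k 
    by rewrite hnZ (ger0_norm (ltW (q4 k))) ler_piMr// ltW.
  have py : 4^-1 ^+ k * (3 / 4 * N k) <= p (nk k) y.
    by rewrite pZ (ger0_norm (ltW (q4 k))) ler_pM2l.
  rewrite /= /step -/y; case: ifPn => [H|H]; split.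
  - by rewrite addrAC subrr add0r.
  - exact: le_trans H.
  - by rewrite addrAC subrr add0r hnN.
  - move: H; rewrite -ltNge => H; rewrite (le_trans py)//.
    have := pD (nk k) (X k + y) (- (X k - y)).
    have -> : X k + y - (X k - y) = 2 *: y.
      by rewrite opprB addrC addrA subrK scaler_nat mulr2n.
    by rewrite pN pZ ger0_norm//; lra.
have [k0|x [Xx _]] := @hcauchy_geo R E X 1.
  rewrite mul1r (le_trans (stepP k0).1)// lerXn2r ?nnegrE ?invr_ge0//.
  by rewrite lef_pV2 ?posrE// ler_nat.
(* The steps after the k-th move the limit by at most 4^-k / 2, so its seminorm keeps at least (3/4
   - 1/2) 4^-k N k >= k / 4, which is unbounded. *)
have Xd k : hn (x - X k.+1) <= 4^-1 ^+ k / 2.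
  have [i|z [Xz]] := @hcauchy_geo R E (fun i => X (i + k.+1)%N) (4^-1 ^+ k.+1).
    rewrite addSn (le_trans (stepP _).1)// exprD mulrC ler_pM2l//.
    rewrite lerXn2r ?nnegrE ?invr_ge0// lef_pV2 ?posrE// ler_nat//.
  rewrite add0n; have -> : x = z.
    apply: hcvg_uniq Xz; move/hcvgP : Xx => Xx; apply/hcvgP => e /Xx[m Hm].
    by exists m => n mn; apply: Hm; rewrite (leq_trans mn)// leq_addr.
  by rewrite exprS; move: (4^-1 ^+ k) => a ?; lra.
have [B HB] := pb x.
have [m Hm] : exists m : nat, 4 * B < m%:R.
  by exists (Num.truncn (4 * B)).+1; exact: truncnS_gt.
have [_ _ Nm pm] := nP m; have [_ H1] := stepP m.
have H2 := pD (nk m) x (X m.+1 - x); rewrite addrC subrK in H2.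
have H3 := pm (X m.+1 - x); rewrite hnB in H3.
have N0 : 0 <= N m by rewrite (le_trans _ Nm)// mulr_ge0// exprn_ge0.
have H4 : N m * hn (x - X m.+1) <= N m * (4^-1 ^+ m / 2) by rewrite ler_wpM2l.
have H5 : m%:R <= 4^-1 ^+ m * N m.
  by rewrite mulrC exprVn ler_pdivlMr ?exprn_gt0// mulrC.
have H6 := HB (nk m).
have {}H1 : 3 / 4 * (4^-1 ^+ m * N m) <= p (nk m) (X m.+1) by rewrite mulrCA.
have {}H4 : N m * hn (x - X m.+1) <= (4^-1 ^+ m * N m) / 2.
  by rewrite (le_trans H4)// mulrA (mulrC (N m)).
move: H1 H2 H3 H4 H5 H6 Hm.
move: (4^-1 ^+ m * N m) (N m * _) (p (nk m) (X m.+1)) (p (nk m) (X m.+1 - x)).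
by move: (p (nk m) x) (m%:R : R) => *; lra.
Qed.

End UniformBoundedness.

(** * Weak integrals *)

Definition rintegrable d (T : measurableType d) (R : realType)
  (mu : {measure set T -> \bar R}) (D : set T) (f : T -> R) :=
  mu.-integrable D (EFin \o f).

Section RealIntegrable.
Context d (T : measurableType d) (R : realType).
Variable mu : {measure set T -> \bar R}.
Variables (D : set T) (mD : measurable D).
Implicit Types f g : T -> R.
Local Notation RI := (rintegrable mu D).

Lemma RI_meas f : RI f -> measurable_fun D f.
Proof. by move=> /(measurable_int mu) /measurable_EFinP. Qed.

Lemma RI_le f g : measurable_fun D f -> RI g ->
  (forall t, D t -> `|f t| <= g t) -> RI f.
Proof.
move=> mf ig fg; apply: (le_integrable mD _ _ ig).
  exact/measurable_EFinP.
by move=> t Dt; rewrite /= lee_fin (le_trans (fg t Dt))// ler_norm.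
Qed.

Lemma RI_add f g : RI f -> RI g -> RI (fun t => f t + g t).
Proof. by move=> fi gi; exact: (integrableD mD fi gi). Qed.

Lemma RI_sub f g : RI f -> RI g -> RI (fun t => f t - g t).
Proof. by move=> fi gi; exact: (integrableB mD fi gi). Qed.

Lemma RI_scale k f : RI f -> RI (fun t => k * f t).
Proof. by move=> fi; exact: (integrableZl mD k fi). Qed.

Lemma RI_norm f : RI f -> RI (fun t => `|f t|).
Proof. by move=> fi; exact: (integrable_norm fi). Qed.

Lemma RI_bounded k f : (mu D < +oo)%E -> measurable_fun D f ->
  (forall t, D t -> `|f t| <= k) -> RI f.
Proof.
move=> Dfin mf fk; apply: measurable_bounded_integrable => //.
exists k; split; first exact: num_real.
by move=> x kx t Dt; rewrite /= (le_trans (fk t Dt))// ltW.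
Qed.

Lemma RI_cst k : (mu D < +oo)%E -> RI (fun=> k).
Proof.
by move=> Dfin; apply: (@RI_bounded `|k|) => //; exact: measurable_cst.
Qed.

Lemma RI_subset (E : set T) f : measurable E -> E `<=` D -> RI f ->
  rintegrable mu E f.
Proof. by move=> mE ED fi; exact: (integrableS mD mE ED fi). Qed.

Lemma RI_dominated (h : nat -> T -> R) f g :
  (forall n, measurable_fun D (h n)) -> RI g ->
  (forall t, D t -> h n t @[n --> \oo] --> f t) ->
  (forall n t, D t -> `|h n t| <= g t) ->
  RI f /\ \int[mu]_(t in D) h n t @[n --> \oo] --> \int[mu]_(t in D) f t.
Proof.
move=> mh ig hf hg.
have mf : measurable_fun D f by exact: measurable_fun_cvg hf.
have fg t : D t -> `|f t| <= g t.
  move=> Dt; have : `|h n t| @[n --> \oo] --> `|f t| by apply: cvg_norm; exact: hf.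
  by move=> /cvgr_to_le; apply; near=> n; exact: hg.
have fi : RI f by exact: RI_le fg.
have hi n : RI (h n) by apply: (RI_le (mh n) ig) => t; exact: hg.
split=> //.
have [|||||_ _ H] := @dominated_convergence _ T R mu D mD
  (fun n t => (h n t)%:E) (fun t => (f t)%:E) (fun t => (g t)%:E).
- by move=> n; exact/measurable_EFinP.
- exact/measurable_EFinP.
- by apply: aeW => t Dt; apply: cvg_EFin; [exact: nearW|exact: hf].
- exact: ig.
- by apply: aeW => t n Dt; rewrite /= lee_fin hg.
have /fine_cvgP[] : (fun n => \int[mu]_(t in D) (h n t)%:E)%E @ \oo -->
    (\int[mu]_(t in D) f t)%:E.
  by rewrite /Rintegral fineK//; exact: integrable_fin_num.
by [].
Unshelve. all: by end_near. Qed.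

End RealIntegrable.

(** Weak measurability is stable under limits and bounded operators by definition; for separable [E]
    it also makes norms and scalar products of functions measurable. *)
Definition wmeas d (T : measurableType d) (R : realType) (E : hilb R) (D : set T)
  (f : T -> E) := forall y, measurable_fun D (fun t => dot (f t) y).

Definition hseparable (R : realType) (E : hilb R) :=
  exists e : nat -> E, forall x eps, 0 < eps -> exists i, hn (x - e i) <= eps.

Section WeakIntegral.
Context d (T : measurableType d) (R : realType) (E : hilb R).
Variable mu : {measure set T -> \bar R}.
Variables (D : set T) (mD : measurable D).
Implicit Types f g : T -> E.

(** The Pettis integral. For functions with integrable norm in a separable space it agrees with the
    Bochner integral, see [bochner_weak] and [weak_bochner]. *)
Definition weak_integral f (x : E) :=
  forall y, dot x y = \int[mu]_(t in D) dot (f t) y.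

Lemma weak_integral_uniq f x y : weak_integral f x -> weak_integral f y -> x = y.
Proof. by move=> fx fy; apply: dot_ext => z; rewrite fx fy. Qed.

Lemma wmeas_dot_RI f (G : T -> R) y : wmeas D f -> rintegrable mu D G ->
  (forall t, D t -> hn (f t) <= G t) -> rintegrable mu D (fun t => dot (f t) y).
Proof.
move=> mf iG fG; apply: (RI_le mD (mf y) (RI_scale mD (hn y) iG)) => t Dt.
rewrite (le_trans (normr_dot_le _ _))// mulrC ler_wpM2l ?hn_ge0//; exact: fG.
Qed.

(** Riesz representation of the functional y |-> int (f, y), whose norm is at most int G. *)
Lemma weak_integral_exists f (G : T -> R) : wmeas D f -> rintegrable mu D G ->
  (forall t, D t -> hn (f t) <= G t) ->
  exists2 x, weak_integral f x & hn x <= \int[mu]_(t in D) G t.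
Proof.
move=> mf iG fG.
have di y := wmeas_dot_RI y mf iG fG.
have [||||x Hx xG] := @riesz R E (fun y => \int[mu]_(t in D) dot (f t) y)
  (\int[mu]_(t in D) G t).
- by apply: Rintegral_ge0 => t Dt; rewrite (le_trans (hn_ge0 _) (fG t Dt)).
- move=> v w; rewrite -(RintegralD mD (di v) (di w)); apply: eq_Rintegral => t _; exact: dotDr.
- move=> a v; rewrite -(RintegralZl a mD (di v)); apply: eq_Rintegral => t _; exact: dotZr.
- move=> v; rewrite mulrC -RintegralZl//.
  apply: (le_Rintegral mD (di v) (RI_scale mD (hn v) iG)).
  move=> t Dt; rewrite (le_trans (dot_le_hn _ _))// mulrC ler_wpM2l ?hn_ge0//.
  exact: fG.
by exists x => // y; rewrite dotC -Hx.
Qed.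

Lemma weak_integral_map (F : hilb R) (A : E -> F) C f x :
  real_linear A -> 0 <= C -> bounded_by A C -> weak_integral f x ->
  forall y, dot (A x) y = \int[mu]_(t in D) dot (A (f t)) y.
Proof.
move=> Al C0 AC fx y; have [B AB] := adjoint_exists Al C0 AC.
by rewrite AB fx; apply: eq_Rintegral => t _; rewrite AB.
Qed.

Lemma wmeas_map (F : hilb R) (A : E -> F) C f :
  real_linear A -> 0 <= C -> bounded_by A C -> wmeas D f ->
  wmeas D (fun t => A (f t)).
Proof.
move=> Al C0 AC mf y; have [B AB] := adjoint_exists Al C0 AC.
by under eq_fun do rewrite AB; exact: mf.
Qed.

Lemma wmeas_add f g : wmeas D f -> wmeas D g -> wmeas D (fun t => f t + g t).
Proof.
move=> mf mg y; under eq_fun do rewrite dotDl.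
exact: measurable_funD.
Qed.

Lemma wmeas_scale (a : T -> R) f : measurable_fun D a -> wmeas D f ->
  wmeas D (fun t => a t *: f t).
Proof.
move=> ma mf y; under eq_fun do rewrite dotZl.
exact: measurable_funM.
Qed.

Lemma wmeas_cst (x : E) : wmeas D (fun _ : T => x).
Proof. by move=> y; exact: measurable_cst. Qed.

Lemma wmeas_opp f : wmeas D f -> wmeas D (fun t => - f t).
Proof.
move=> mf y; under eq_fun do rewrite dotNl.
exact: measurable_funN.
Qed.

Lemma wmeas_sub f g : wmeas D f -> wmeas D g -> wmeas D (fun t => f t - g t).
Proof. by move=> mf mg; apply: wmeas_add => //; exact: wmeas_opp. Qed.

Lemma wmeas_cvg (h : nat -> T -> E) f : (forall n, wmeas D (h n)) ->
  (forall t, D t -> hcvg (h ^~ t) (f t)) -> wmeas D f.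
Proof.
move=> mh hf y; apply: (@measurable_fun_cvg _ _ _ D (fun n t => dot (h n t) y)).
  by move=> n; exact: mh.
by move=> t Dt; exact: (hcvg_dot (hf t Dt)).
Qed.

Lemma wmeas_indic (N : set T) f : measurable N -> wmeas D f ->
  wmeas D (fun t => \1_N t *: f t).
Proof.
move=> mN; apply: wmeas_scale.
by apply: measurable_funTS; exact: measurable_indic.
Qed.

Hypothesis hsep : hseparable E.

(* |x|^2 = sup_i (2 (x, e_i) - |e_i|^2) over a dense sequence e. *)
Lemma wmeas_sqr_hn f : wmeas D f -> measurable_fun D (fun t => hn (f t) ^+ 2).
Proof.
move=> mf; have [e eP] := hsep.
pose h (n : nat) t := 2 * dot (f t) (e n) - hn (e n) ^+ 2.
have hle n t : h n t <= hn (f t) ^+ 2.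
  have := dot_ge0 (f t - e n); rewrite dotBl !dotBr -!sqr_hn (dotC (e n)) /h; lra.
have ub t : has_ubound (range (h ^~ t)).
  by exists (hn (f t) ^+ 2) => _ [n _ <-]; exact: hle.
rewrite (_ : (fun _ => _) = fun t => sups (h ^~ t) 0%N).
  apply: measurable_fun_sups => // m.
  by apply: measurable_funB => //; exact: measurable_funM.
apply/funext => t; apply/eqP; rewrite eq_le; apply/andP; split; last first.
  apply: ge_sup; first by exists (h 0%N t), 0%N.
  by move=> _ [n _ <-]; exact: hle.
apply/ler_addgt0Pr => eps eps0.
have e1 : 0 < Num.sqrt eps by rewrite sqrtr_gt0.
have [i Hi] := eP (f t) _ e1.
have : h i t <= sups (h ^~ t) 0 by apply: ub_le_sup; [exact/has_ubound_sdrop|exists i].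
suff : hn (f t) ^+ 2 <= h i t + eps by lra.
have : hn (f t - e i) ^+ 2 <= eps.
  by rewrite -[leRHS](sqr_sqrtr (ltW eps0)) lerXn2r ?nnegrE ?hn_ge0// ltW.
rewrite sqr_hn dotBl !dotBr -!sqr_hn (dotC (e i)) /h; lra.
Qed.

Lemma wmeas_hn f : wmeas D f -> measurable_fun D (fun t => hn (f t)).
Proof.
move=> mf; rewrite (_ : (fun _ => _) = Num.sqrt \o (fun t => hn (f t) ^+ 2)).
  apply: (@measurable_comp _ _ _ _ _ _ setT) => //.
    by apply: continuous_measurable_fun; exact: sqrt_continuous.
  exact: wmeas_sqr_hn.
by apply/funext => t /=; rewrite sqrtr_sqr ger0_norm// hn_ge0.
Qed.

Lemma wmeas_dot f g : wmeas D f -> wmeas D g ->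
  measurable_fun D (fun t => dot (f t) (g t)).
Proof.
move=> mf mg.
rewrite (_ : (fun _ => _) = fun t => 4^-1 * (hn (f t + g t) ^+ 2 - hn (f t - g t) ^+ 2)).
  apply: measurable_funM; first exact: measurable_cst.
  apply: measurable_funB; apply: wmeas_sqr_hn.
    exact: wmeas_add.
  exact: wmeas_sub.
apply/funext => t; rewrite !sqr_hn !dotDl !dotDr !dotNl !dotNr (dotC (g t)).
by field.
Qed.

End WeakIntegral.

(** Telescoping over a partition of mesh at most r gives |Phi t - Phi 0| <= eps (G t - G 0) for
    every eps. This stands in for [derivative zero] when [Phi] is not differentiable in the
    classical sense: its increments only have to be negligible against those of [G]. *)
Lemma const_of_osc (R : realType) (Phi G : R -> R) (tau : R) :
  (forall eps, 0 < eps -> exists2 r, 0 < r & forall a b, 0 <= a -> a <= b ->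
     b <= tau -> b - a <= r -> `|Phi b - Phi a| <= eps * (G b - G a)) ->
  forall t, 0 <= t -> t <= tau -> Phi t = Phi 0.
Proof.
move=> H t t0 tt; apply/eqP; rewrite -subr_eq0 -normr_le0.
have key eps : 0 < eps -> `|Phi t - Phi 0| <= eps * (G t - G 0).
  move=> eps0; have [r r0 Hr] := H _ eps0.
  pose n := (Num.truncn (t / r)).+1.
  have n0 : 0 < n%:R :> R by rewrite ltr0n.
  have tn : t / n%:R <= r.
    by rewrite ler_pdivrMr// mulrC -ler_pdivrMr// ltW// truncnS_gt.
  have tn0 : 0 <= t / n%:R by rewrite divr_ge0// ltW.
  have ind (i : nat) : (i <= n)%N ->
      `|Phi (i%:R * (t / n%:R)) - Phi 0| <= eps * (G (i%:R * (t / n%:R)) - G 0).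
    elim: i => [|i IH] ilt; first by rewrite mul0r !subrr normr0 mulr0.
    have {}IH := IH (ltnW ilt).
    set b := i.+1%:R * _; set a := i%:R * _ in IH.
    have ba : b - a = t / n%:R by rewrite /b /a -natr1 mulrDl mul1r addrAC subrr add0r.
    have := Hr a b (mulr_ge0 (ler0n _ _) tn0).
    have -> : a <= b by rewrite -subr_ge0 ba.
    have -> : b <= tau.
      rewrite (le_trans _ tt)// /b mulrCA ler_piMr// ler_pdivrMr// mul1r ler_nat//.
    rewrite ba => /(_ isT isT tn) H1.
    have -> : Phi b - Phi 0 = (Phi b - Phi a) + (Phi a - Phi 0) by rewrite addrA subrK.
    by rewrite (le_trans (ler_normD _ _))//; lra.
  by have := ind n (leqnn _); rewrite mulrCA divff ?mulr1// gt_eqF.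
have Gp : 0 <= G t - G 0.
  by have := key 1 ltr01; rewrite mul1r; exact: le_trans.
apply/ler_addgt0Pr => e e0; rewrite add0r.
have e1 : 0 < e / (G t - G 0 + 1) by rewrite divr_gt0// ltr_wpDl.
apply: (le_trans (key _ e1)); rewrite mulrAC ler_pdivrMr ?ltr_wpDl//.
by rewrite ler_pM2l// lerDl.
Qed.

(** * Square roots by resolvent integrals *)

Section HalfLine.
Variable R : realType.
Local Notation mu := (@lebesgue_measure R).
Local Notation halfline := (`]0, +oo[%classic : set R).
Implicit Types F f : R -> R.

Lemma FTC_segment F f (a b : R) : a < b ->
  (forall x : R, a <= x <= b -> is_derive x 1 F (f x)) ->
  (forall x : R, a <= x <= b -> {for x, continuous f}) ->
  (\int[mu]_(x in `[a, b]) (f x)%:E)%E = (F b - F a)%:E.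
Proof.
move=> ab dF cf; rewrite (@continuous_FTC2 R f F a b)//.
- by apply: continuous_in_subspaceT => x; rewrite inE/= in_itv/= => /cf.
- have cF x : a <= x <= b -> {for x, continuous F}.
    by move=> /dF H; apply/differentiable_continuous/derivable1_diffP; exact: ex_derive.
  split.
  + by move=> x; rewrite in_itv/= => /andP[ax xb]; apply: ex_derive; apply: dF; rewrite !ltW.
  + by apply: cvg_at_right_filter; apply: cF; rewrite lexx ltW.
  + by apply: cvg_at_left_filter; apply: cF; rewrite lexx ltW.
- move=> x; rewrite in_itv/= => /andP[ax xb]; rewrite derive1E.
  by have /@derive_val : is_derive x 1 F (f x) by apply: dF; rewrite !ltW.
Qed.

(** Segments exhausting the half line; n.+2 instead of n.+1 keeps the first one nondegenerate. *)
Let I (n : nat) : set R := `[n.+2%:R^-1, n.+2%:R]%classic.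

Let I_cover t : halfline t -> \forall n \near \oo, I n t.
Proof.
rewrite /= in_itv/= andbT => t0; near=> n.
rewrite /I /= in_itv/=; apply/andP; split.
  rewrite -[leRHS]invrK lef_pV2 ?posrE ?invr_gt0//.
  rewrite (@le_trans _ _ n%:R)//; last by rewrite ler_nat -addn2 leq_addr.
  by near: n; exact: nbhs_infty_ger.
rewrite (@le_trans _ _ n%:R)//; last by rewrite ler_nat -addn2 leq_addr.
by near: n; exact: nbhs_infty_ger.
Unshelve. all: by end_near. Qed.

Let I_half n : I n `<=` halfline.
Proof.
by move=> t; rewrite /I /= !in_itv/= andbT => /andP[+ _]; apply: lt_le_trans.
Qed.

Let mI n : measurable (I n : set (measurableTypeR R)).
Proof. exact: measurable_itv. Qed.

Let FTC_I F f n : (forall x : R, 0 < x -> is_derive x 1 F (f x)) ->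
  (forall x : R, 0 < x -> {for x, continuous f}) ->
  (\int[mu]_(x in I n) (f x)%:E)%E = (F n.+2%:R - F n.+2%:R^-1)%:E.
Proof.
move=> dF cf; apply: FTC_segment.
- by rewrite (@lt_trans _ _ 1)// ?invf_lt1// ltr1n.
- by move=> x /andP[nx _]; apply: dF; rewrite (lt_le_trans _ nx)// invr_gt0.
- by move=> x /andP[nx _]; apply: cf; rewrite (lt_le_trans _ nx)// invr_gt0.
Qed.

Lemma halfline_measurable f : (forall x : R, 0 < x -> {for x, continuous f}) ->
  measurable_fun (halfline : set (measurableTypeR R)) f.
Proof.
move=> cf; apply: open_continuous_measurable_fun; first exact: interval_open.
by move=> x; rewrite inE/= in_itv/= andbT => /cf.
Qed.

Lemma FTC_halfline F f A B : (forall x : R, 0 < x -> is_derive x 1 F (f x)) ->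
  (forall x : R, 0 < x -> {for x, continuous f}) ->
  rintegrable mu halfline f ->
  F n.+2%:R^-1 @[n --> \oo] --> A -> F n.+2%:R @[n --> \oo] --> B ->
  \int[mu]_(x in halfline) f x = B - A.
Proof.
move=> dF cf fi FA FB.
have H1 : \int[mu]_(x in I n) f x @[n --> \oo] --> B - A.
  have -> : (fun n => \int[mu]_(x in I n) f x) = fun n => F n.+2%:R - F n.+2%:R^-1.
    by apply/funext => n; rewrite /Rintegral (FTC_I n dF cf).
  exact: cvgB.
have [] := @RI_dominated _ _ R mu halfline (measurable_itv _)
  (fun n => f \_ (I n)) f (fun t => `|f t|).
- move=> n; apply: (measurable_funS (E := setT)) => //.
  apply/(measurable_restrictT f (mI n)).
  by apply: measurable_funS (halfline_measurable cf).
- exact: RI_norm.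
- move=> t /I_cover tI; apply: cvg_near_cst; apply: filterS tI => n tn.
  by rewrite patchE mem_set.
- by move=> n t _; rewrite patchE; case: ifP; rewrite // normr0.
move=> _ H2; apply: (cvg_uniqR (u := fun n => \int[mu]_(x in I n) f x)) => //.
have -> : (fun n => \int[mu]_(x in I n) f x) =
   (fun n => \int[mu]_(x in halfline) (f \_ (I n)) x).
  apply/funext => n; rewrite -Rintegral_mkcondr setIidr//; exact: I_half.
exact: H2.
Qed.

(** For a nonnegative integrand, monotone convergence along the segments [I n] yields the
    integrability that [FTC_halfline] presupposes. *)
Lemma FTC_halfline_ge0 F f (A B : R) : (forall x : R, 0 < x -> is_derive x 1 F (f x)) ->
  (forall x : R, 0 < x -> {for x, continuous f}) -> (forall x : R, 0 < x -> 0 <= f x) ->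
  F n.+2%:R^-1 @[n --> \oo] --> A -> F n.+2%:R @[n --> \oo] --> B ->
  rintegrable mu halfline f.
Proof.
move=> dF cf f0 FA FB; have mf := halfline_measurable cf.
apply/integrableP; split; first exact/measurable_EFinP.
have -> : (\int[mu]_(x in halfline) `|(EFin \o f) x| =
    \int[mu]_(x in halfline) (f x)%:E)%E.
  apply: eq_integral => x; rewrite inE/= in_itv/= andbT => x0.
  by rewrite ger0_norm// f0.
have HI : halfline = \bigcup_n I n.
  apply/seteqP; split => t; last by move=> [n _]; exact: I_half.
  by move=> /I_cover[N _ /(_ N)]; rewrite /= => /(_ (leqnn _)) H; exists N.
have /(cvg_lim (@ereal_hausdorff R)) <- : (\int[mu]_(x in I n) (f x)%:E)%E @[n --> \oo]
    --> (\int[mu]_(x in halfline) (f x)%:E)%E.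
  rewrite HI; apply: ge0_nondecreasing_set_cvg_integral => //.
  - apply/nondecreasing_seqP => n; apply/subsetPset => t.
    rewrite /I /= !in_itv/= => /andP[h1 h2]; apply/andP; split.
      by rewrite (le_trans _ h1)// lef_pV2 ?posrE// ler_nat.
    by rewrite (le_trans h2)// ler_nat.
  - move=> i; apply: (measurable_funS (measurable_itv _) (@I_half i)).
    exact/measurable_EFinP.
  - by move=> i t /I_half; rewrite /= in_itv/= andbT lee_fin => /f0.
under eq_fun do rewrite (FTC_I _ dF cf).
rewrite (cvg_lim (@ereal_hausdorff R) (cvg_EFin _ (cvgB FB FA))) ?ltry//.
exact: nearW.
Qed.

Definition sqrt_weight (l : R) : R := (pi * Num.sqrt l)^-1.
Local Notation w := sqrt_weight.

Lemma sqrt_weight_ge0 l : 0 <= w l.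
Proof. by rewrite invr_ge0 mulr_ge0 ?sqrtr_ge0// pi_ge0. Qed.

Lemma sqrt_weight_continuous l : 0 < l -> {for l, continuous w}.
Proof.
move=> l0; apply: cvgV; first by rewrite gt_eqF// mulr_gt0 ?pi_gt0 ?sqrtr_gt0.
by apply: cvgM; [exact: cvg_cst|exact: sqrt_continuous].
Qed.

(** The primitive in l of w l / (l + h), obtained from l = h tan^2 theta; it increases from 0 to 1 /
    sqrt h, which is the scalar case of the formula for the inverse square root. *)
Let atan_prim (h l : R) := 2 / (pi * Num.sqrt h) * atan (Num.sqrt l / Num.sqrt h).

Let atan_prim_derive (h l : R) : 0 < h -> 0 < l ->
  is_derive l 1 (atan_prim h) (w l / (l + h)).
Proof.
move=> h0 l0.
have sh : 0 < Num.sqrt h by rewrite sqrtr_gt0.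
have sl : 0 < Num.sqrt l by rewrite sqrtr_gt0.
have d1 : is_derive l 1 (fun l : R => Num.sqrt l / Num.sqrt h)
    ((Num.sqrt h)^-1 * (2 * Num.sqrt l)^-1).
  have -> : (fun l : R => Num.sqrt l / Num.sqrt h) =
     (Num.sqrt h)^-1 \*: (Num.sqrt : R -> R).
    by apply/funext => x /=; rewrite mulrC.
  have ds := is_derive1_sqrt l0.
  exact: is_deriveZ.
have d2 := @is_derive1_comp R atan (fun l : R => Num.sqrt l / Num.sqrt h) l _ _
  (is_derive1_atan (Num.sqrt l / Num.sqrt h)) d1.
have d3 := is_deriveZ (2 / (pi * Num.sqrt h)) d2.
apply: (is_derive_eq d3); rewrite /GRing.scale/= /w exprMn exprVn.
have -> : l + h = Num.sqrt l ^+ 2 + Num.sqrt h ^+ 2 by rewrite !sqr_sqrtr ?ltW.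
have p0 : pi != 0 :> R by rewrite gt_eqF// pi_gt0.
have l1 : Num.sqrt l != 0 by rewrite gt_eqF.
have h1 : Num.sqrt h != 0 by rewrite gt_eqF.
have s1 : Num.sqrt l ^+ 2 + Num.sqrt h ^+ 2 != 0.
  by rewrite gt_eqF// addr_gt0// exprn_gt0.
move: (Num.sqrt l) (Num.sqrt h) (pi : R) p0 l1 h1 s1 => a b p p0 l1 h1 s1.
field.
by rewrite s1 l1 p0 h1.
Qed.

Let resolvent_weight_continuous (h l : R) : 0 < h -> 0 < l ->
  {for l, continuous (fun l => w l / (l + h))}.
Proof.
move=> h0 l0; apply: cvgM; first exact: sqrt_weight_continuous.
apply: cvgV; first by rewrite gt_eqF// addr_gt0.
by apply: cvgD; [exact: cvg_id|exact: cvg_cst].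
Qed.

Let cvg_invn : (n.+2%:R^-1 : R) @[n --> \oo] --> (0 : R).
Proof.
apply/cvgrPdist_le => e e0; near=> n.
rewrite sub0r normrN ger0_norm// -[leRHS]invrK lef_pV2 ?posrE ?invr_gt0//.
rewrite (@le_trans _ _ n%:R)//; last by rewrite ler_nat -addn2 leq_addr.
by near: n; exact: nbhs_infty_ger.
Unshelve. all: by end_near.
Qed.

Lemma cvg_sqrt_invn : Num.sqrt (n.+2%:R^-1 : R) @[n --> \oo] --> (0 : R).
Proof.
rewrite -[X in _ --> X]sqrtr0.
exact: (cvg_comp _ _ cvg_invn (@sqrt_continuous R 0)).
Qed.

Let atan_prim0 (h : R) : 0 < h -> atan_prim h n.+2%:R^-1 @[n --> \oo] --> (0 : R).
Proof.
move=> h0; rewrite -[X in _ --> X](mulr0 (2 / (pi * Num.sqrt h))).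
apply: cvgMr; rewrite -[X in _ --> X]atan0 -[X in _ --> atan X](mul0r (Num.sqrt h)^-1).
have : Num.sqrt (n.+2%:R^-1 : R) / Num.sqrt h @[n --> \oo] --> 0 / Num.sqrt h.
  exact: cvgMl cvg_sqrt_invn.
move=> H; exact: (cvg_comp _ _ H (@continuous_atan R _)).
Qed.

Let cvgy_sqrt : Num.sqrt (n.+2%:R : R) @[n --> \oo] --> +oo.
Proof.
apply/cvgryPge => A; near=> n.
rewrite (@le_trans _ _ `|A|)// ?ler_norm// -sqrtr_sqr ler_sqrt//.
rewrite (@le_trans _ _ n%:R)//; last by rewrite ler_nat -addn2 leq_addr.
by near: n; exact: nbhs_infty_ger.
Unshelve. all: by end_near. Qed.

Let atan_primy (h : R) : 0 < h ->
  atan_prim h n.+2%:R @[n --> \oo] --> (Num.sqrt h)^-1.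
Proof.
move=> h0; have sh : 0 < Num.sqrt h by rewrite sqrtr_gt0.
have -> : (Num.sqrt h)^-1 = 2 / (pi * Num.sqrt h) * (pi / 2).
  have p0 : pi != 0 :> R by rewrite gt_eqF// pi_gt0.
  have h1 : Num.sqrt h != 0 by rewrite gt_eqF.
  move: (pi : R) (Num.sqrt h) p0 h1 => p b p0 h1.
  by field; rewrite ?p0 ?h1.
apply: cvgMr; apply: (cvg_comp _ _ _ (@cvgy_atan R)).
apply/cvgryPge => A; near=> n; rewrite ler_pdivlMr//.
by near: n; move/cvgryPge : cvgy_sqrt; exact.
Unshelve. all: by end_near. Qed.

Lemma resolvent_weight_integrable (h : R) : 0 < h ->
  rintegrable mu halfline (fun l => w l / (l + h)).
Proof.
move=> h0; apply: (@FTC_halfline_ge0 (atan_prim h) (fun l => w l / (l + h)) 0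
  (Num.sqrt h)^-1 (fun x => atan_prim_derive h0)
  (fun x => resolvent_weight_continuous h0) _ (atan_prim0 h0) (atan_primy h0)).
by move=> x x0; rewrite mulr_ge0 ?sqrt_weight_ge0// invr_ge0 addr_ge0// ltW.
Qed.

Lemma resolvent_weight_integral (h : R) : 0 < h ->
  \int[mu]_(l in halfline) (w l / (l + h)) = (Num.sqrt h)^-1.
Proof.
move=> h0.
have := @FTC_halfline (atan_prim h) (fun l => w l / (l + h)) 0
  (Num.sqrt h)^-1 (fun x => atan_prim_derive h0)
  (fun x => resolvent_weight_continuous h0) (resolvent_weight_integrable h0)
  (atan_prim0 h0) (atan_primy h0).
by rewrite subr0.
Qed.

End HalfLine.

Lemma is_derive_quadratic (R : realType) (phi : R -> R) (l d C r : R) :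
  0 < r -> (forall e, `|e| < r -> `|phi (l + e) - phi l - e * d| <= C * e ^+ 2) ->
  is_derive l 1 phi d.
Proof.
move=> r0 H.
have C0 : 0 <= C.
  have r2 : 0 < r / 2 by rewrite divr_gt0.
  have : `|r / 2| < r by rewrite gtr0_norm// ltr_pdivrMr// ltr_pMr// ltr1n.
  by move=> /H /(le_trans (normr_ge0 _)); rewrite pmulr_lge0// exprn_gt0.
have cv : h^-1 *: (phi (h *: (1 : R) + l) - phi l) @[h --> 0^'] --> d.
  apply/cvgrPdist_le => e e0; near=> h.
  have h0 : h != 0 by near: h; exact: nbhs_dnbhs_neq.
  have hr : `|h| < r by near: h; apply: dnbhs0_lt.
  have -> : h *: (1 : R) + l = l + h by rewrite /GRing.scale/= mulr1 addrC.
  have -> : d - h^-1 *: (phi (l + h) - phi l) =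
     - (h^-1 * (phi (l + h) - phi l - h * d)).
    by rewrite /GRing.scale/=; field.
  rewrite normrN normrM normfV ler_pdivrMl ?normr_gt0//.
  rewrite (le_trans (H _ hr))// -[h ^+ 2]real_normK ?num_real// expr2 mulrA mulrC.
  rewrite ler_wpM2l//.
  have Ch : `|h| <= e / (C + 1).
    by near: h; apply: dnbhs0_le; rewrite divr_gt0// ltr_wpDl.
  rewrite (le_trans (ler_wpM2l C0 Ch))// mulrA ler_pdivrMr ?ltr_wpDl// mulrC.
  by rewrite (ler_wpM2l (ltW e0))// lerDl.
by split; [apply/cvg_ex; exists d|exact/cvg_lim].
Unshelve. all: by end_near. Qed.

(** * The inverse square root attached to a resolvent family *)

Section SquareRoot.
Variables (R : realType) (E : hilb R) (rho : R -> E -> E) (c0 : R).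
Local Notation mu := (@lebesgue_measure R).
Local Notation halfline := (`]0, +oo[%classic : set (measurableTypeR R)).
Local Notation w := (@sqrt_weight R).
Hypotheses (c0_ge0 : 0 <= c0)
  (rho_lin : forall l : R, 0 <= l -> real_linear (rho l))
  (rho_le : forall (l : R) x, 0 < l -> hn (rho l x) <= l^-1 * hn x)
  (rho_le0 : forall (l : R) x, 0 <= l -> hn (rho l x) <= c0 * hn x)
  (rho_res : forall (l m : R) x, 0 <= l -> 0 <= m ->
     rho l x - rho m x = (m - l) *: rho l (rho m x)).

Let mD : measurable halfline. Proof. exact: measurable_itv. Qed.
(** B / (l + 1) dominates the resolvent on the whole half line: it combines the bound c0 near 0 with
    1 / l at infinity. *)
Let B := c0 + 1.
Let B0 : 0 < B. Proof. by rewrite ltr_wpDl. Qed.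
Let B_ge0 : 0 <= B. Proof. exact: ltW. Qed.

Let rho_leB (l : R) x : 0 <= l -> hn (rho l x) <= B / (l + 1) * hn x.
Proof.
move=> l0; have l1 : 0 < l + 1 by rewrite ltr_wpDl.
rewrite mulrAC ler_pdivlMr// mulrDr mulr1 /B mulrDl mul1r addrC lerD ?rho_le0//.
have [->|ln0] := eqVneq l 0; first by rewrite mulr0 hn_ge0.
have lp : 0 < l by rewrite lt_def ln0.
by rewrite -ler_pdivlMr// mulrC rho_le.
Qed.

Let rhoC (l m : R) x : 0 <= l -> 0 <= m -> rho l (rho m x) = rho m (rho l x).
Proof.
move=> l0 m0; have [->//|lm] := eqVneq l m.
have := rho_res x l0 m0; have := rho_res x m0 l0.
move=> /(congr1 -%R); rewrite opprB => -> /esym.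
rewrite -scaleNr opprB => /scalerI; apply.
by rewrite subr_eq0 eq_sym.
Qed.

Let rho_lip (l m : R) x : 0 <= l -> 0 <= m ->
  hn (rho l x - rho m x) <= `|l - m| * (c0 ^+ 2 * hn x).
Proof.
move=> l0 m0; rewrite rho_res// hnZ distrC ler_wpM2l// expr2 -mulrA.
by rewrite (le_trans (rho_le0 _ _))// ler_wpM2l// rho_le0.
Qed.

(** The resolvent at l + a and its square, tested against y; the resolvent identity makes - psi the
    derivative of phi. *)
Let phi a x y l := dot (rho (l + a) x) y.
Let psi a x y l := dot (rho (l + a) (rho (l + a) x)) y.

Let phi_derive (a : R) x y (l : R) : 0 <= a -> 0 < l ->
  is_derive l 1 (phi a x y) (- psi a x y l).
Proof.
move=> a0 l0; apply: (@is_derive_quadratic _ _ _ _ (c0 ^+ 2 * (c0 * hn x) * hn y) l) => //.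
move=> e el.
have le0 : 0 <= l + e by move: el; rewrite ltr_norml; lra.
have lea : 0 <= l + e + a by rewrite addr_ge0.
have la : 0 <= l + a by rewrite addr_ge0// ltW.
have -> : phi a x y (l + e) - phi a x y l - e * - psi a x y l =
    - e * dot (rho (l + e + a) (rho (l + a) x) - rho (l + a) (rho (l + a) x)) y.
  rewrite /phi -dotBl rho_res//.
  have -> : l + a - (l + e + a) = - e by ring.
  rewrite dotZl dotBl /psi; ring.
rewrite normrM normrN (le_trans (ler_wpM2l (normr_ge0 _) (normr_dot_le _ _)))//.
have -> : c0 ^+ 2 * (c0 * hn x) * hn y * e ^+ 2 =
    `|e| * (`|e| * (c0 ^+ 2 * (c0 * hn x)) * hn y).
  by rewrite -[e ^+ 2]real_normK ?num_real//; ring.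
rewrite ler_wpM2l// ler_wpM2r ?hn_ge0// (le_trans (rho_lip _ _ _))//.
have -> : l + e + a - (l + a) = e by ring.
by rewrite ler_wpM2l// ler_wpM2l ?sqr_ge0// rho_le0.
Qed.

Let phi_continuous (a : R) x y (l : R) : 0 <= a -> 0 < l -> {for l, continuous (phi a x y)}.
Proof.
move=> a0 l0; apply/differentiable_continuous/derivable1_diffP.
exact: (@ex_derive _ _ _ _ _ _ _ (phi_derive x y a0 l0)).
Qed.

Let lip_continuous (f : R -> R) (l C : R) : 0 < l ->
  (forall m, 0 < m -> `|f m - f l| <= `|m - l| * C) -> {for l, continuous f}.
Proof.
move=> l0 H; apply/cvgrPdist_le => e e0; near=> m.
have m0 : 0 < m by near: m; exact: lt_nbhsr.
rewrite distrC (le_trans (H _ m0))//.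
have C1 : 0 < `|C| + 1 by rewrite ltr_wpDl.
rewrite (@le_trans _ _ (`|m - l| * (`|C| + 1)))//.
  by rewrite ler_wpM2l// (le_trans (ler_norm _))// lerDl.
rewrite -ler_pdivlMr// distrC.
by near: m; apply: cvgr_dist_le => //; rewrite divr_gt0.
Unshelve. all: by end_near. Qed.

Let psi_continuous (a b : R) x y (l : R) : 0 <= a -> 0 <= b -> 0 < l ->
  {for l, continuous (fun l : R => dot (rho (l + a) (rho (l + b) x)) y)}.
Proof.
move=> a0 b0 l0.
apply: (@lip_continuous _ _ ((c0 ^+ 2 * (c0 * hn x) + c0 * (c0 ^+ 2 * hn x)) * hn y)) => // m m0.
have [la lb] : 0 <= l + a /\ 0 <= l + b by rewrite !addr_ge0// ltW.
have [ma mb] : 0 <= m + a /\ 0 <= m + b by rewrite !addr_ge0// ltW.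
rewrite -dotBl (le_trans (normr_dot_le _ _))// [leRHS]mulrA ler_wpM2r ?hn_ge0//.
rewrite (le_trans (hn_triangle (rho (l + a) (rho (m + b) x)) _ _))//.
rewrite mulrDr lerD//.
  rewrite (le_trans (rho_lip _ _ _))//.
  have -> : m + a - (l + a) = m - l by ring.
  by rewrite ler_wpM2l// ler_wpM2l ?sqr_ge0// rho_le0.
rewrite -(rlB (rho_lin la)) (le_trans (rho_le0 _ _))// mulrCA ler_wpM2l//.
rewrite (le_trans (rho_lip _ _ _))//.
by have -> : m + b - (l + b) = m - l by ring.
Qed.

(** Common dominating function of the resolvent integrals. Its integral is exactly [C], because w l
    / (l + 1) has integral 1. *)
Let G C l : R := C * (w l / (l + 1)).
Let G_RI C : rintegrable mu halfline (G C).
Proof. by apply: RI_scale => //; exact: resolvent_weight_integrable. Qed.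
Let G_int C : \int[mu]_(l in halfline) G C l = C.
Proof.
rewrite RintegralZl//; last exact: resolvent_weight_integrable.
by rewrite resolvent_weight_integral// sqrtr1 invr1 mulr1.
Qed.

Let gt0_half (l : R) : halfline l -> 0 < l.
Proof. by rewrite /= in_itv/= andbT. Qed.

Let half_ge0 (a l : R) : 0 <= a -> halfline l -> 0 <= l + a.
Proof. by move=> a0 /gt0_half l0; rewrite addr_ge0// ltW. Qed.

Let inv_half (l : R) : halfline l -> 0 <= (l + 1)^-1.
Proof. by move=> l0; rewrite invr_ge0 half_ge0. Qed.

Let mrho (a : R) x : 0 <= a -> wmeas halfline (fun l => w l *: rho (l + a) x).
Proof.
move=> a0; apply: wmeas_scale => //.
  by apply: halfline_measurable => l; exact: sqrt_weight_continuous.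
by move=> y; apply: halfline_measurable => l; exact: phi_continuous.
Qed.

Let mrho2 (a b : R) x : 0 <= a -> 0 <= b ->
  wmeas halfline (fun l => w l *: rho (l + a) (rho (l + b) x)).
Proof.
move=> a0 b0; apply: wmeas_scale => //.
  by apply: halfline_measurable => l; exact: sqrt_weight_continuous.
by move=> y; apply: halfline_measurable => l; exact: psi_continuous.
Qed.

Let rhoG (a : R) x C l : 0 <= a -> halfline l -> hn (rho (l + a) x) <= C / (l + 1) ->
  hn (w l *: rho (l + a) x) <= G C l.
Proof.
move=> a0 l0 H; rewrite hnZ ger0_norm ?sqrt_weight_ge0// /G mulrCA.
by rewrite ler_wpM2l ?sqrt_weight_ge0.
Qed.

Let rhoB (a : R) x l : 0 <= a -> halfline l -> hn (rho (l + a) x) <= (B * hn x) / (l + 1).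
Proof.
move=> a0 l0; apply: (le_trans (rho_leB _ (half_ge0 a0 l0))).
rewrite mulrAC; apply: ler_wpM2l; first by rewrite mulr_ge0 ?hn_ge0.
rewrite lef_pV2 ?posrE; first by rewrite lerD2r lerDl.
  by rewrite ltr_wpDl// half_ge0.
by rewrite ltr_wpDl// ltW// gt0_half.
Qed.

Lemma weak_integral_le (f : R -> E) (g : R -> R) x : wmeas halfline f ->
  rintegrable mu halfline g -> (forall t, halfline t -> hn (f t) <= g t) ->
  weak_integral mu halfline f x -> hn x <= \int[mu]_(t in halfline) g t.
Proof.
move=> mf ig fg fx; have [z fz zg] := weak_integral_exists mD mf ig fg.
by rewrite (weak_integral_uniq fx fz).
Qed.

Lemma sqrt_integral_exists (a : R) x : 0 <= a -> exists z,
  weak_integral mu halfline (fun l => w l *: rho (l + a) x) z.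
Proof.
move=> a0; have [|||z Hz _] := @weak_integral_exists _ _ R E mu _ mD
  (fun l => w l *: rho (l + a) x) (G (B * hn x)).
- exact: mrho.
- exact: G_RI.
- by move=> l l0; apply: rhoG => //; exact: rhoB.
by exists z.
Qed.

Let X_exists (a b : R) x : 0 <= a -> 0 <= b -> exists z,
  weak_integral mu halfline (fun l => w l *: rho (l + a) (rho (l + b) x)) z.
Proof.
move=> a0 b0; have [|||z Hz _] := @weak_integral_exists _ _ R E mu _ mD
  (fun l => w l *: rho (l + a) (rho (l + b) x)) (G (B * (c0 * hn x))).
- exact: mrho2.
- exact: G_RI.
- move=> l l0; apply: rhoG => //; rewrite (le_trans (rhoB _ _ _))//.
  by rewrite (ler_wpM2r (inv_half l0))// (ler_wpM2l B_ge0)// rho_le0// half_ge0.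
by exists z.
Qed.

(** [T a] is (a + S)^(-1/2). The shift a is kept as a parameter because the identity for the square
    is proved by varying it. *)
Let TS : {T : R -> E -> E | forall a x, 0 <= a ->
  weak_integral mu halfline (fun l => w l *: rho (l + a) x) (T a x)}.
Proof.
apply: cid; pose P a x z := weak_integral mu halfline (fun l => w l *: rho (l + a) x) z.
exists (fun a x => xget 0 [set z | P a x z]) => a x a0.
have [z Hz] := sqrt_integral_exists x a0.
exact: (xgetPex 0 (ex_intro (P a x) z Hz)).
Qed.
Let T := sval TS.
Let TP : forall (a : R) x, 0 <= a ->
  weak_integral mu halfline (fun l => w l *: rho (l + a) x) (T a x).
Proof. exact: (svalP TS). Qed.

(** [X a b] is the difference quotient of [T], up to sign: T a - T b = (b - a) X a b. Thus [X a a]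
    is formally minus the derivative of [T] at a. *)
Let XS : {X : R -> R -> E -> E | forall a b x, 0 <= a -> 0 <= b ->
  weak_integral mu halfline (fun l => w l *: rho (l + a) (rho (l + b) x)) (X a b x)}.
Proof.
apply: cid.
pose P a b x z := weak_integral mu halfline (fun l => w l *: rho (l + a) (rho (l + b) x)) z.
exists (fun a b x => xget 0 [set z | P a b x z]) => a b x a0 b0.
have [z Hz] := X_exists x a0 b0.
exact: (xgetPex 0 (ex_intro (P a b x) z Hz)).
Qed.
Let X := sval XS.
Let XP : forall (a b : R) x, 0 <= a -> 0 <= b ->
  weak_integral mu halfline (fun l => w l *: rho (l + a) (rho (l + b) x)) (X a b x).
Proof. exact: (svalP XS). Qed.

Let dRI (a : R) x y : 0 <= a -> rintegrable mu halfline (fun l => dot (w l *: rho (l + a) x) y).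
Proof.
move=> a0; apply: (wmeas_dot_RI mD y (mrho x a0) (G_RI (B * hn x))) => l l0.
by apply: rhoG => //; exact: rhoB.
Qed.

Let dRI2 (a b : R) x y : 0 <= a -> 0 <= b ->
  rintegrable mu halfline (fun l => dot (w l *: rho (l + a) (rho (l + b) x)) y).
Proof.
move=> a0 b0; apply: (wmeas_dot_RI mD y (mrho2 x a0 b0) (G_RI (B * (c0 * hn x)))) => l l0.
apply: rhoG => //; rewrite (le_trans (rhoB _ _ _))//.
by rewrite (ler_wpM2r (inv_half l0))// (ler_wpM2l B_ge0)// rho_le0// half_ge0.
Qed.

Let T_lin (a : R) : 0 <= a -> real_linear (T a).
Proof.
move=> a0; split=> [x y|k x]; apply: dot_ext => z.
  rewrite dotDl !(TP _ a0 z) -(RintegralD mD (dRI x z a0) (dRI y z a0)).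
  apply: eq_Rintegral => l; rewrite inE => l0.
  by rewrite (rho_lin (half_ge0 a0 l0)).1 scalerDr dotDl.
rewrite dotZl !(TP _ a0 z) -(RintegralZl k mD (dRI x z a0)).
apply: eq_Rintegral => l; rewrite inE => l0.
by rewrite (rho_lin (half_ge0 a0 l0)).2 scalerA mulrC -scalerA dotZl.
Qed.

Let T_le (a : R) : 0 <= a -> bounded_by (T a) B.
Proof.
move=> a0 x; rewrite -[leRHS]G_int.
apply: (weak_integral_le (mrho x a0) (G_RI _) _ (TP x a0)) => l l0.
by apply: rhoG => //; exact: rhoB.
Qed.

Let T_le2 (a : R) x : 0 < a -> hn (T a x) <= (Num.sqrt a)^-1 * hn x.
Proof.
move=> a0; have ia := resolvent_weight_integrable a0.
rewrite -resolvent_weight_integral// mulrC -RintegralZl//.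
apply: (weak_integral_le (mrho x (ltW a0)) (RI_scale mD _ ia) _ (TP x (ltW a0))).
move=> l /gt0_half l0; rewrite hnZ ger0_norm ?sqrt_weight_ge0// mulrCA.
by rewrite ler_wpM2l ?sqrt_weight_ge0// mulrC rho_le// addr_gt0.
Qed.

Let T_map (a : R) (A : E -> E) C x : 0 <= a -> real_linear A -> 0 <= C -> bounded_by A C ->
  (forall (l : R) x, 0 <= l -> A (rho l x) = rho l (A x)) -> A (T a x) = T a (A x).
Proof.
move=> a0 Al C0 AC Ar; apply: dot_ext => y.
rewrite (weak_integral_map Al C0 AC (TP x a0)) (TP (A x) a0).
apply: eq_Rintegral => l; rewrite inE => /gt0_half l0.
by rewrite Al.2 Ar// addr_ge0// ltW.
Qed.

Let T_rho (a m : R) x : 0 <= a -> 0 <= m -> rho m (T a x) = T a (rho m x).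
Proof.
move=> a0 m0; apply: (@T_map _ _ c0) => //; first exact: rho_lin.
  by move=> z; exact: rho_le0.
by move=> l z l0; exact: rhoC.
Qed.

Let TC (a b : R) x : 0 <= a -> 0 <= b -> T a (T b x) = T b (T a x).
Proof.
move=> a0 b0; apply: (@T_map _ _ B) => //; first exact: T_lin.
- exact: T_le.
- by move=> l z l0; rewrite T_rho.
Qed.

Let T_sub (a b : R) x : 0 <= a -> 0 <= b -> T a x - T b x = (b - a) *: X a b x.
Proof.
move=> a0 b0; apply: dot_ext => y.
rewrite dotBl dotZl (TP x a0) (TP x b0) (XP x a0 b0).
rewrite -(RintegralB mD (dRI x y a0) (dRI x y b0)) -(RintegralZl _ mD (dRI2 x y a0 b0)).
apply: eq_Rintegral => l; rewrite inE => /gt0_half l0.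
have [la lb] : 0 <= l + a /\ 0 <= l + b by rewrite !addr_ge0// ltW.
rewrite -dotBl -scalerBr rho_res//.
have -> : l + b - (l + a) = b - a by ring.
by rewrite !dotZl; ring.
Qed.

Let X_le (a b : R) x : 0 <= a -> 0 <= b -> hn (X a b x) <= B * (c0 * hn x).
Proof.
move=> a0 b0; rewrite -[leRHS]G_int.
apply: (weak_integral_le (mrho2 x a0 b0) (G_RI _) _ (XP x a0 b0)) => l l0.
apply: rhoG => //; rewrite (le_trans (rhoB _ _ _))//.
by rewrite (ler_wpM2r (inv_half l0))// (ler_wpM2l B_ge0)// rho_le0// half_ge0.
Qed.

Let X_lip (a b : R) x : 0 <= a -> 0 <= b ->
  hn (X a b x - X a a x) <= `|b - a| * (B * (c0 ^+ 2 * hn x)).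
Proof.
move=> a0 b0; rewrite -[leRHS]G_int.
apply: (@weak_integral_le
  (fun l => w l *: rho (l + a) (rho (l + b) x) - w l *: rho (l + a) (rho (l + a) x))).
- by apply: wmeas_sub => //; exact: mrho2.
- exact: G_RI.
- move=> l l0; have lp := gt0_half l0.
  have [la lb] : 0 <= l + a /\ 0 <= l + b by rewrite !addr_ge0// ltW.
  rewrite -scalerBr -(rlB (rho_lin la)); apply: rhoG => //.
  rewrite (le_trans (rhoB _ _ _))// (ler_wpM2r (inv_half l0))//.
  rewrite mulrCA (ler_wpM2l B_ge0)// (le_trans (rho_lip _ _ _))//.
  by have -> : l + b - (l + a) = b - a by ring.
- move=> y; rewrite dotBl (XP x a0 b0) (XP x a0 a0).
  rewrite -(RintegralB mD (dRI2 x y a0 b0) (dRI2 x y a0 a0)).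
  by apply: eq_Rintegral => l _; rewrite dotBl.
Qed.

(** With z = S^-1 xi, the vector xi + a z is (a + S) z. *)
Let rho_zeta (a : R) xi : 0 <= a -> rho a (xi + a *: rho 0 xi) = rho 0 xi.
Proof.
move=> a0; rewrite (rho_lin a0).1 (rho_lin a0).2 (rhoC _ a0 (lexx _)).
have := rho_res xi (lexx 0) a0; rewrite subr0 => <-.
by rewrite addrC subrK.
Qed.

(* The integrand is the derivative of 2/pi sqrt l rho (l + a) z. *)
Let T_X (a : R) xi : 0 <= a ->
  T a (rho 0 xi) = 2 *: X a a (xi + a *: rho 0 xi).
Proof.
move=> a0; set z := rho 0 xi; set zeta := xi + _.
have rz l : 0 <= l -> rho (l + a) zeta = z - l *: rho (l + a) z.
  move=> l0; have la : 0 <= l + a by rewrite addr_ge0.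
  have := rho_res zeta la a0; rewrite /zeta rho_zeta// -/z -/zeta.
  have -> : a - (l + a) = - l by ring.
  by move=> H; rewrite -[LHS](subrK z) H scaleNr addrC.
apply/eqP; rewrite -subr_eq0; apply/eqP; apply: dot_ext => y; rewrite dot0l.
rewrite dotBl dotZl (TP z a0) (XP zeta a0 a0).
rewrite -(RintegralZl 2 mD (dRI2 zeta y a0 a0)).
rewrite -(RintegralB mD (dRI z y a0) (RI_scale mD 2 (dRI2 zeta y a0 a0))).
pose f l := - (w l * (phi a z y l - 2 * (l * psi a z y l))).
pose F l := - (2 / pi * (Num.sqrt l * phi a z y l)).
have fE l : 0 < l -> dot (w l *: rho (l + a) z) y -
    2 * dot (w l *: rho (l + a) (rho (l + a) zeta)) y = f l.
  move=> l0; have la : 0 <= l + a by rewrite addr_ge0// ltW.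
  rewrite rz ?ltW// (rlB (rho_lin la)) (rho_lin la).2 !dotZl dotBl dotZl.
  by rewrite /f /phi /psi; ring.
have fi : rintegrable mu halfline f.
  apply: eq_integrable (RI_sub mD (dRI z y a0) (RI_scale mD 2 (dRI2 zeta y a0 a0))) => //.
  by move=> l; rewrite inE => /gt0_half l0; rewrite /= fE.
have -> : \int[mu]_(x in halfline) (dot (w x *: rho (x + a) z) y -
    2 * dot (w x *: rho (x + a) (rho (x + a) zeta)) y) =
   \int[mu]_(x in halfline) f x.
  by apply: eq_Rintegral => l; rewrite inE => /gt0_half l0; rewrite fE.
have dF (l : R) : 0 < l -> is_derive l 1 F (f l).
  move=> l0; have sl : 0 < Num.sqrt l by rewrite sqrtr_gt0.
  have d1 := is_deriveM (is_derive1_sqrt l0) (phi_derive z y a0 l0).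
  have d2 := is_deriveN (is_deriveZ (2 / pi) d1).
  apply: (is_derive_eq d2); rewrite /GRing.scale/= /f /sqrt_weight.
  have p0 : pi != 0 :> R by rewrite gt_eqF// pi_gt0.
  have l1 : Num.sqrt l != 0 by rewrite gt_eqF.
  rewrite -[X in X * psi _ _ _ _](sqr_sqrtr (ltW l0)).
  move: (Num.sqrt l) (pi : R) (phi _ _ _ _) (psi _ _ _ _) p0 l1 => s p u v p0 s0.
  by field; rewrite ?p0 ?s0.
have cf (l : R) : 0 < l -> {for l, continuous f}.
  move=> l0; apply: cvgN; apply: cvgM; first exact: sqrt_weight_continuous.
  apply: cvgB; first exact: phi_continuous.
  apply: cvgM; first exact: cvg_cst.
  apply: cvgM; first exact: cvg_id.
  exact: psi_continuous.
(* Boundary terms of [F]: sqrt l / (l + 1) is at most sqrt l near 0 and at most 1 / sqrt l at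
   infinity. At l = 1/n.+2 and at l = n.+2 both bounds equal sqrt (1/n.+2). *)
have Fle (l s : R) : 0 < l -> Num.sqrt l * (B / (l + 1)) <= B * s ->
    `|F l| <= s * (2 / pi * B * hn z * hn y).
  move=> l0 H; have p0 : 0 < pi :> R by exact: pi_gt0.
  rewrite /F normrN !normrM (ger0_norm (sqrtr_ge0 _)).
  have pi0 : 0 <= pi^-1 :> R by rewrite invr_ge0 ltW.
  rewrite (@ger0_norm _ 2)// (ger0_norm pi0).
  have -> : s * (2 / pi * B * hn z * hn y) = 2 / pi * ((B * s) * (hn z * hn y)) by ring.
  rewrite (ler_wpM2l (divr_ge0 (ler0n _ 2) (ltW p0)))//.
  rewrite (@le_trans _ _ (Num.sqrt l * (B / (l + 1) * hn z * hn y)))//.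
    rewrite ler_wpM2l ?sqrtr_ge0// (le_trans (normr_dot_le _ _))// ler_wpM2r ?hn_ge0//.
    by rewrite mulrAC; apply: rhoB => //; rewrite /= in_itv/= l0.
  have -> : Num.sqrt l * (B / (l + 1) * hn z * hn y) =
      Num.sqrt l * (B / (l + 1)) * (hn z * hn y) by rewrite -!mulrA.
  by apply: ler_wpM2r; rewrite // mulr_ge0 ?hn_ge0.
have cv0 (C : R) : Num.sqrt (n.+2%:R^-1 : R) * C @[n --> \oo] --> (0 : R).
  by rewrite -[X in _ --> X](mul0r C); apply: cvgMl; exact: cvg_sqrt_invn.
have sq (u : nat -> R) : (forall n, `|u n| <= Num.sqrt (n.+2%:R^-1 : R) * (2 / pi * B * hn z * hn y)) ->
    u n @[n --> \oo] --> (0 : R).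
  move=> H; apply/norm_cvg0P; apply: squeeze_cvgr (cvg_cst 0) (cv0 (2 / pi * B * hn z * hn y)).
  by apply: nearW => n; rewrite normr_ge0 H.
rewrite (@FTC_halfline R F f 0 0 dF cf fi) ?subrr//.
  apply: sq => n; apply: Fle; rewrite ?invr_gt0// mulrCA (ler_wpM2l B_ge0)//.
  by rewrite ler_piMr ?sqrtr_ge0// invf_le1 ?lerDr ?invr_ge0//.
apply: sq => n; apply: Fle => //; rewrite mulrCA (ler_wpM2l B_ge0)//.
rewrite ler_pdivrMr ?ltr_wpDl// sqrtrV// mulrC ler_pdivlMr ?sqrtr_gt0//.
by rewrite -expr2 sqr_sqrtr// lerDl.
Qed.

(* W h = T_h^2 (h + S) z is constant, where z = S^-1 xi. *)
Let W xi h := T h (T h (xi + h *: rho 0 xi)).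

Let X_lin (a b : R) : 0 <= a -> 0 <= b -> real_linear (X a b).
Proof.
move=> a0 b0; split=> [x y|k x]; apply: dot_ext => z.
  rewrite dotDl !(XP _ a0 b0 z) -(RintegralD mD (dRI2 x z a0 b0) (dRI2 y z a0 b0)).
  apply: eq_Rintegral => l; rewrite inE => l0.
  by rewrite (rho_lin (half_ge0 b0 l0)).1 (rho_lin (half_ge0 a0 l0)).1 scalerDr dotDl.
rewrite dotZl !(XP _ a0 b0 z) -(RintegralZl k mD (dRI2 x z a0 b0)).
apply: eq_Rintegral => l; rewrite inE => l0.
rewrite (rho_lin (half_ge0 b0 l0)).2 (rho_lin (half_ge0 a0 l0)).2.
by rewrite scalerA mulrC -scalerA dotZl.
Qed.

Let T_XC (a b : R) x : 0 <= a -> 0 <= b -> T b (X a a x) = X a a (T b x).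
Proof.
move=> a0 b0; apply: dot_ext => y.
rewrite (weak_integral_map (T_lin b0) B_ge0 (T_le b0) (XP x a0 a0)) (XP (T b x) a0 a0).
apply: eq_Rintegral => l; rewrite inE => l0; have la := half_ge0 a0 l0.
by rewrite (T_lin b0).2 -!T_rho.
Qed.

Let TT_sub (a b : R) x : 0 <= a -> 0 <= b ->
  T b (T b x) - T a (T a x) = - ((b - a) *: X a b (T b x + T a x)).
Proof.
move=> a0 b0; rewrite -T_sub// opprB (T_lin b0).1 (T_lin a0).1 (TC x b0 a0).
by rewrite opprD addrA addrK.
Qed.

(** With z = S^-1 xi and zeta = (a + S) z, the part of the increment of first order in b - a is a
    multiple of T_a T_a z - 2 T_a X_aa zeta, which vanishes by [T_X]. What remains is of second
    order; [h] serves to bound zeta uniformly. *)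
Let W_osc xi (a b h : R) : 0 <= a -> a <= b -> b <= h ->
  hn (W xi b - W xi a) <= (b - a) ^+ 2 *
   (B * c0 * (2 * B * hn (rho 0 xi)) +
    (B * c0 ^+ 2 * (2 * B) + B * c0 * (B * c0)) * (hn xi + h * hn (rho 0 xi))).
Proof.
move=> a0 ab bh; have b0 := le_trans a0 ab.
set z := rho 0 xi; set zeta := xi + a *: z.
have hz : hn zeta <= hn xi + h * hn z.
  rewrite (le_trans (hnD _ _))// lerD2l hnZ ger0_norm// ler_wpM2r ?hn_ge0//.
  exact: le_trans bh.
have ba : 0 <= b - a by rewrite subr_ge0.
have T2 x : hn (T b x + T a x) <= 2 * B * hn x.
  by rewrite (le_trans (hnD _ _))// mulrDl mul1r mulrDl lerD// T_le.
set S := T b zeta + T a zeta; set D := T b zeta - T a zeta.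
have Wb : W xi b = T b (T b zeta) + (b - a) *: T b (T b z).
  rewrite /W -/z; have -> : xi + b *: z = zeta + (b - a) *: z.
    by rewrite /zeta -addrA -scalerDl addrCA subrr addr0.
  by rewrite !(T_lin b0).1 !(T_lin b0).2.
have e1 : T b (T b zeta) - W xi a = - ((b - a) *: X a b S) by exact: TT_sub.
have e2 : T b (T b z) = - ((b - a) *: X a b (T b z + T a z)) + T a (T a z).
  by rewrite -TT_sub// subrK.
have e3 : T a (T a z) = X a a S - X a a D.
  rewrite -(rlB (X_lin a0 a0)); have -> : S - D = 2 *: T a zeta.
    by rewrite /S /D opprB addrC addrA subrK scaler_nat mulr2n.
  by rewrite (X_lin a0 a0).2 -T_XC// /z T_X// (T_lin a0).2.
have -> : W xi b - W xi a = (b - a) *: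
    (- ((b - a) *: X a b (T b z + T a z)) - (X a b S - X a a S) - X a a D).
  rewrite Wb addrAC e1 -scalerN -scalerDr e2 e3; congr (_ *: _).
  by rewrite opprB addrCA -addrA; congr (_ + _); rewrite addrA (addrC (- _)).
have h1 : hn (X a b (T b z + T a z)) <= B * c0 * (2 * B * hn z).
  rewrite (le_trans (X_le _ a0 b0))// -mulrA (ler_wpM2l B_ge0)// (ler_wpM2l c0_ge0)//.
have h2 : hn (X a b S - X a a S) <= (b - a) * (B * c0 ^+ 2 * (2 * B) * hn zeta).
  rewrite (le_trans (X_lip _ a0 b0))// ger0_norm//; apply: (ler_wpM2l ba).
  apply: (le_trans (ler_wpM2l B_ge0 (ler_wpM2l (sqr_ge0 c0) (T2 zeta)))).
  by rewrite le_eqVlt; apply/orP; left; apply/eqP; ring.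
have h3 : hn (X a a D) <= (b - a) * (B * c0 * (B * c0) * hn zeta).
  rewrite (le_trans (X_le _ a0 a0))// /D hnB T_sub// hnZ ger0_norm//.
  have H := ler_wpM2l B_ge0 (ler_wpM2l c0_ge0 (ler_wpM2l ba (X_le zeta a0 b0))).
  apply: (le_trans H).
  by rewrite le_eqVlt; apply/orP; left; apply/eqP; ring.
rewrite hnZ ger0_norm// expr2 -mulrA; apply: (ler_wpM2l ba).
apply: (le_trans (hn_sub _ _)); apply: (le_trans (lerD (hn_sub _ _) (lexx _))).
rewrite hnN hnZ ger0_norm// mulrDr -addrA; apply: lerD; first exact: (ler_wpM2l ba).
apply: (le_trans (lerD h2 h3)); rewrite -mulrDr -mulrDl.
apply: (ler_wpM2l ba); apply: ler_wpM2l => //.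
by rewrite addr_ge0// !mulr_ge0// exprn_ge0.
Qed.

Let W_const xi (h : R) : 0 <= h -> W xi h = W xi 0.
Proof.
move=> h0; apply: dot_ext => y.
apply: (@const_of_osc R (fun t => dot (W xi t) y) id h) => // eps eps0.
set L := (B * c0 * (2 * B * hn (rho 0 xi)) +
    (B * c0 ^+ 2 * (2 * B) + B * c0 * (B * c0)) * (hn xi + h * hn (rho 0 xi))).
have L0 : 0 <= L.
  by rewrite /L !(addr_ge0, mulr_ge0, hn_ge0, exprn_ge0).
have Ly : 0 < L * hn y + 1 by rewrite ltr_wpDl// mulr_ge0// hn_ge0.
exists (eps / (L * hn y + 1)); first by rewrite divr_gt0.
move=> a b a0 ab bh bae; rewrite -dotBl (le_trans (normr_dot_le _ _))//.
apply: (le_trans (ler_wpM2r (hn_ge0 _) (W_osc xi a0 ab bh))); rewrite -/L.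
have ba : 0 <= b - a by rewrite subr_ge0.
rewrite expr2 -!mulrA [leRHS]mulrC; apply: (ler_wpM2l ba).
move: bae; rewrite ler_pdivlMr//; apply: le_trans.
by apply: (ler_wpM2l ba); rewrite lerDl.
Qed.

(** For large h the operator (h + S)^(-1/2) acts almost as 1 / sqrt h: replacing rho (l + h) z by z
    / (l + h) costs rho (l + h) xi / (l + h), and integration gives the order h^(-3/2). *)
Let T_near z xi (h : R) : 0 < h -> z = rho 0 xi ->
  hn ((Num.sqrt h)^-1 *: z - T h z) <= h^-1 * (Num.sqrt h)^-1 * hn xi.
Proof.
move=> h0 zE; have hg := ltW h0; have ia := resolvent_weight_integrable h0.
rewrite -mulrA [leRHS]mulrA [leRHS]mulrAC -resolvent_weight_integral// -RintegralZl//.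
have mf : wmeas halfline (fun l => (w l / (l + h)) *: z).
  by apply: wmeas_scale; [exact: RI_meas ia|exact: wmeas_cst].
apply: (@weak_integral_le (fun l => (w l / (l + h)) *: z - w l *: rho (l + h) z)).
- by apply: wmeas_sub => //; exact: mrho.
- exact: RI_scale.
- move=> l l0; have lp := gt0_half l0; have lh : 0 < l + h by rewrite addr_gt0.
  have -> : (w l / (l + h)) *: z - w l *: rho (l + h) z =
      (w l / (l + h)) *: rho (l + h) xi.
    have := rho_zeta xi (ltW lh); rewrite -zE.
    rewrite (rho_lin (ltW lh)).1 (rho_lin (ltW lh)).2 => zE2.
    by rewrite -{1}zE2 scalerDr scalerA divfK ?gt_eqF// addrK.
  rewrite hnZ ger0_norm ?divr_ge0 ?sqrt_weight_ge0 ?(ltW lh)// mulrC.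
  apply: ler_wpM2r; first by rewrite divr_ge0 ?sqrt_weight_ge0 ?(ltW lh).
  rewrite (le_trans (rho_le _ lh))//; apply: ler_wpM2r; first exact: hn_ge0.
  by rewrite lef_pV2 ?posrE// lerDr ltW.
- move=> y; rewrite dotBl dotZl (TP z hg).
  rewrite mulrC -RintegralZl// -(RintegralB mD (RI_scale mD _ ia) (dRI z y hg)).
  by apply: eq_Rintegral => l _; rewrite dotBl !dotZl [dot z y * _]mulrC.
Qed.

(** Letting h tend to infinity identifies the constant value of [W] as S^-1 xi, while at h = 0 it is
    T_0 T_0 xi. The factor 3 counts three terms, each at most |xi| / h. *)
Let W_near xi (h : R) : 0 < h -> hn (W xi h - rho 0 xi) <= 3 * (h^-1 * hn xi).
Proof.
move=> h0; have hg := ltW h0; have sh : 0 < Num.sqrt h by rewrite sqrtr_gt0.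
have s2 : Num.sqrt h ^+ 2 = h by rewrite sqr_sqrtr.
set z := rho 0 xi; set e := (Num.sqrt h)^-1 *: z - T h z.
have he := T_near h0 (erefl z); rewrite -/e in he.
have Tz : T h z = (Num.sqrt h)^-1 *: z - e by rewrite /e opprB addrC subrK.
clearbody e.
have s0 : Num.sqrt h != 0 by rewrite gt_eqF.
have hs1 : h *: ((Num.sqrt h)^-1 *: ((Num.sqrt h)^-1 *: z)) = z.
  rewrite !scalerA -[RHS]scale1r; congr (_ *: _).
  by move: (Num.sqrt h) s0 s2 => s s0 <-; field.
have hs2 : h *: ((Num.sqrt h)^-1 *: e) = Num.sqrt h *: e.
  rewrite scalerA; congr (_ *: _).
  by move: (Num.sqrt h) s0 s2 => s s0 <-; field.
have -> : W xi h - z = T h (T h xi) - Num.sqrt h *: e - h *: T h e.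
  rewrite /W -/z !(T_lin hg).1 !(T_lin hg).2 Tz (rlB (T_lin hg)) (T_lin hg).2 Tz.
  rewrite !scalerBr hs1 hs2.
  rewrite -!addrA; congr (_ + _).
  by rewrite [X in z + X]addrA addrCA subrr addr0.
apply: (le_trans (hn_sub _ _)); apply: (le_trans (lerD (hn_sub _ _) (lexx _))).
have h1 : hn (T h (T h xi)) <= h^-1 * hn xi.
  have -> : h^-1 = (Num.sqrt h)^-1 * (Num.sqrt h)^-1 by rewrite -invfM -expr2 s2.
  rewrite (le_trans (T_le2 _ h0))// -mulrA.
  by apply: ler_wpM2l; [rewrite invr_ge0 ltW|exact: T_le2].
have h2 : hn (Num.sqrt h *: e) <= h^-1 * hn xi.
  rewrite hnZ ger0_norm ?(ltW sh)//.
  apply: (le_trans (ler_wpM2l (ltW sh) he)).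
  by rewrite mulrA mulrCA divff ?gt_eqF// mulr1.
have h3 : hn (h *: T h e) <= h^-1 * hn xi.
  rewrite hnZ ger0_norm//; apply: le_trans h2; rewrite hnZ ger0_norm ?(ltW sh)//.
  apply: (le_trans (ler_wpM2l hg (T_le2 _ h0))); rewrite mulrA.
  by rewrite -{1}s2 expr2 mulfK ?gt_eqF.
by set p := h^-1 * hn xi in h1 h2 h3 *; lra.
Qed.

Lemma sqrt_resolvent : exists T : E -> E,
  [/\ forall x, weak_integral mu halfline (fun l => w l *: rho l x) (T x),
      real_linear T, bounded_by T (c0 + 1), forall x, T (T x) = rho 0 x &
      forall l x, 0 <= l -> rho l (T x) = T (rho l x)].
Proof.
exists (T 0); split.
- move=> x; have <- : (fun l : R => w l *: rho (l + 0) x) = (fun l => w l *: rho l x).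
    by apply/funext => l; rewrite addr0.
  exact: TP.
- exact: T_lin.
- exact: T_le.
- move=> xi; have -> : T 0 (T 0 xi) = W xi 0 by rewrite /W scale0r addr0.
  apply/eqP; rewrite -subr_eq0; apply/eqP/hn_eq0/eqP; rewrite eq_le hn_ge0 andbT.
  apply/ler_addgt0Pr => e e0; rewrite add0r.
  have x0 : 0 < 3 * hn xi + 1 by rewrite ltr_wpDl// mulr_ge0// hn_ge0.
  have h0 : 0 < (3 * hn xi + 1) / e by rewrite divr_gt0.
  rewrite -(W_const xi (ltW h0)) (le_trans (W_near xi h0))// invf_div.
  rewrite mulrCA -mulrA ler_piMr ?(ltW e0)// mulrC ler_pdivrMr// mul1r.
  by rewrite lerDl.
- by move=> l x l0; exact: T_rho.
Qed.

(** Integrability of the norm is what allows the weak integral defining the inverse square root to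
    be read as a Bochner integral. *)
Lemma sqrt_resolvent_RI x : hseparable E -> wmeas halfline (fun l => w l *: rho l x) /\
  rintegrable mu halfline (fun l => hn (w l *: rho l x)).
Proof.
move=> hsep; have m : wmeas halfline (fun l => w l *: rho l x).
  have <- : (fun l : R => w l *: rho (l + 0) x) = (fun l => w l *: rho l x).
    by apply/funext => l; rewrite addr0.
  exact: mrho.
split=> //; apply: (RI_le mD (wmeas_hn hsep m) (G_RI (B * hn x))) => l Dl.
have l0 := gt0_half Dl; rewrite ger0_norm ?hn_ge0// hnZ ger0_norm ?sqrt_weight_ge0//.
have -> : G (B * hn x) l = w l * (B / (l + 1) * hn x) by rewrite /G; ring.
by apply: ler_wpM2l; [exact: sqrt_weight_ge0|apply: rho_leB; exact: ltW].
Qed.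

End SquareRoot.

(** * Functions of time *)

Section TimeIntegral.
Variables (R : realType) (E : hilb R) (tau : R).
Local Notation mu := (@lebesgue_measure R).
Local Notation I t := (`]0, t]%classic : set (measurableTypeR R)).
Local Notation J a b := (`]a, b]%classic : set (measurableTypeR R)).
Local Notation D := (`]0, tau]%classic : set (measurableTypeR R)).
Local Notation RI := (rintegrable mu).
Hypothesis (tau_gt0 : 0 < tau) (hsep : hseparable E).
Implicit Types (f g h p q u v : R -> E).

Lemma mitv (i : interval R) : measurable ([set` i] : set (measurableTypeR R)).
Proof. exact: measurable_itv. Qed.
Local Hint Extern 0 (measurable _) => (exact: mitv) : core.

Lemma mu_itv_fin (a b : R) : (mu (J a b) < +oo)%E.
Proof. by rewrite lebesgue_measure_itv/=; case: ifP => // _; rewrite -EFinB ltry. Qed.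

Lemma subJ (a b : R) : 0 <= a -> b <= tau -> J a b `<=` D.
Proof.
move=> a0 bt t; rewrite /= !in_itv/= => /andP[at_ tb].
by rewrite (le_lt_trans a0)// (le_trans tb).
Qed.

Lemma RIJ (a b : R) (f : R -> R) : 0 <= a -> b <= tau -> RI D f -> RI (J a b) f.
Proof. by move=> a0 bt fi; apply: RI_subset fi => //; exact: subJ. Qed.

Lemma itv_splitR (a b : R) (f : R -> R) : 0 <= a -> a <= b -> b <= tau -> RI D f ->
  \int[mu]_(t in I b) f t - \int[mu]_(t in I a) f t = \int[mu]_(t in J a b) f t.
Proof.
move=> a0 ab bt fi; apply: Rintegral_itvB => //.
  exact: RIJ.
Qed.

Lemma RI_abs_continuous (f : R -> R) : RI D f -> forall e, 0 < e ->
  exists2 r, 0 < r & forall a b, 0 <= a -> a <= b -> b <= tau -> b - a <= r ->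
    \int[mu]_(t in J a b) `|f t| <= e.
Proof.
move=> fi e e0.
have fi2 : mu.-integrable setT (EFin \o (f \_ D)).
  by have [H0 _] := @integrable_mkcond _ _ _ mu D (EFin \o f) (mitv _); have := H0 fi;
    rewrite restrict_EFin.
have [r [r0 Hr]] := integral_normr_continuous fi2 e0.
exists (r / 2); first by rewrite divr_gt0.
move=> a b a0 ab bt bar.
have mJ : (mu (J a b) < r%:E)%E.
  rewrite lebesgue_measure_itv/=.
  have -> : (if (a%:E < b%:E)%E then (b%:E - a%:E)%E else 0%E) = (b - a)%:E.
    case: ifPn => //; rewrite -leNgt lee_fin => ba.
    have -> : b = a by apply/eqP; rewrite eq_le ab ba.
    by rewrite subrr.
  by rewrite lte_fin (le_lt_trans bar) ?ltr_pdivrMr ?ltr_pMr ?ltr1n.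
have /ltW := Hr (J a b) (mitv _) mJ.
apply: le_trans; rewrite le_eqVlt; apply/orP; left; apply/eqP.
by apply: eq_Rintegral => t; rewrite inE => /(subJ a0 bt) Dt; rewrite patchE mem_set.
Qed.

Definition bint g := wmeas D g /\ RI D (fun t => hn (g t)).

(** The identity is required at every t of [0, tau], so [u] is the continuous representative of the
    function with derivative [g] and value [x] at 0. The half-open intervals ]0, t] concatenate
    without overlap. *)
Definition primitive (x : E) g u := forall t, 0 <= t <= tau -> forall y,
  dot (u t) y = dot x y + \int[mu]_(s in I t) dot (g s) y.

Lemma bint_dot g y : bint g -> RI D (fun t => dot (g t) y).
Proof. by move=> [mg ig]; apply: (wmeas_dot_RI (mitv _) y mg ig). Qed.

Lemma wmeas_subset (A B : set (measurableTypeR R)) g :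
  measurable B -> A `<=` B -> wmeas B g -> wmeas A g.
Proof. by move=> mB AB mg y; apply: measurable_funS AB (mg y). Qed.

Lemma primitive_exists x g : bint g -> exists u, primitive x g u.
Proof.
move=> [mg ig].
have /choice[u uP] : forall t, exists z, 0 <= t <= tau -> weak_integral mu (I t) g z.
  move=> t; have [/andP[t0 tt]|] := boolP (0 <= t <= tau); last by exists 0.
  have [||z Hz _] := @weak_integral_exists _ _ R E mu (I t) (mitv _) g _ _ (RIJ (lexx 0) tt ig).
  - by apply: wmeas_subset mg => //; exact: subJ.
  - by [].
  by exists z.
by exists (fun t => x + u t) => t t0 y; rewrite dotDl (uP t t0).
Qed.

Lemma primitive_sub x g u (a b : R) y : bint g -> primitive x g u ->
  0 <= a -> a <= b -> b <= tau ->
  dot (u b - u a) y = \int[mu]_(s in J a b) dot (g s) y.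
Proof.
move=> ig gu a0 ab bt; rewrite dotBl !gu; last 2 first.
- by rewrite a0 (le_trans ab).
- by rewrite (le_trans a0).
by rewrite -(itv_splitR a0 ab bt (bint_dot y ig)); lra.
Qed.

Lemma primitive_lip x g u (a b : R) : bint g -> primitive x g u ->
  0 <= a -> a <= b -> b <= tau ->
  hn (u b - u a) <= \int[mu]_(s in J a b) hn (g s).
Proof.
move=> [mg ig] gu a0 ab bt; apply: hn_le_dual.
  by apply: Rintegral_ge0 => t _; exact: hn_ge0.
move=> y; rewrite (primitive_sub y _ gu)// mulrC -RintegralZl//; last exact: RIJ.
apply: le_Rintegral => //.
- by apply: RIJ => //; exact: bint_dot.
- by apply: RI_scale => //; exact: RIJ.
- by move=> t _; rewrite mulrC dot_le_hn.
Qed.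

Lemma primitive_unif x g u : bint g -> primitive x g u -> forall e, 0 < e ->
  exists2 r, 0 < r & forall a b, 0 <= a -> a <= b -> b <= tau -> b - a <= r ->
    hn (u b - u a) <= e.
Proof.
move=> ig gu e e0; have [r r0 Hr] := RI_abs_continuous ig.2 e0.
exists r => // a b a0 ab bt bar; rewrite (le_trans (primitive_lip ig gu _ _ _))//.
have := Hr a b a0 ab bt bar; under eq_Rintegral do rewrite ger0_norm ?hn_ge0//.
exact.
Qed.

Lemma primitive0 x g u : primitive x g u -> u 0 = x.
Proof.
move=> gu; apply: dot_ext => y; rewrite gu ?lexx ?ltW//.
by rewrite set_itv_ge ?bnd_simp// Rintegral_set0 addr0.
Qed.

Lemma primitive_bounded x g u (t : R) : bint g -> primitive x g u ->
  0 <= t <= tau -> hn (u t) <= hn x + \int[mu]_(s in D) hn (g s).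
Proof.
move=> ig gu /andP[t0 tt].
have -> : u t = x + (u t - u 0) by rewrite (primitive0 gu) addrC subrK.
rewrite (le_trans (hnD _ _))// lerD2l (le_trans (primitive_lip ig gu _ _ _))//.
have := itv_splitR t0 tt (lexx _) ig.2.
have : 0 <= \int[mu]_(s in J t tau) hn (g s).
  by apply: Rintegral_ge0 => s _; exact: hn_ge0.
lra.
Qed.

(* The function (u t, y), extended by constants outside [0, tau], is continuous. *)
Lemma unif_wmeas u : (forall e, 0 < e ->
  exists2 r, 0 < r & forall a b, 0 <= a -> a <= b -> b <= tau -> b - a <= r ->
    hn (u b - u a) <= e) -> wmeas D u.
Proof.
move=> H y; pose c (t : R) := Num.max 0 (Num.min t tau).
have c0 t : 0 <= c t by rewrite /c le_max lexx.
have ct t : c t <= tau by rewrite /c ge_max ltW//= ge_min lexx orbT.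
have cl s t : s <= t -> c s <= c t /\ c t - c s <= t - s.
  move=> st; rewrite /c /Num.max /Num.min; case: ifPn; case: ifPn; rewrite -?leNgt;
    case: ifPn; rewrite -?leNgt; case: ifPn; rewrite -?leNgt => *; split; lra.
apply: (@eq_measurable_fun _ _ _ _ D (fun t => dot (u (c t)) y)).
  move=> t; rewrite inE/= in_itv/= => /andP[t0 tt]; rewrite /c min_l//.
  by rewrite max_r// ltW.
apply: measurable_funTS; apply: continuous_measurable_fun => t.
apply/cvgrPdist_le => e e0.
have y1 : 0 < hn y + 1 by rewrite ltr_wpDl// hn_ge0.
have [r r0 Hr] := H _ (divr_gt0 e0 y1).
near=> s; rewrite -dotBl (le_trans (normr_dot_le _ _))//.
rewrite (@le_trans _ _ (hn (u (c t) - u (c s)) * (hn y + 1)))//.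
  by rewrite ler_wpM2l ?hn_ge0// lerDl.
rewrite -ler_pdivlMr//.
have str : `|t - s| <= r by near: s; apply: cvgr_dist_le.
have [st|ts] := leP s t.
  have [h1 h2] := cl _ _ st; apply: Hr => //; apply: (le_trans h2).
  by move: str; rewrite ger0_norm// subr_ge0.
have [h1 h2] := cl _ _ (ltW ts); rewrite hnB; apply: Hr => //; apply: (le_trans h2).
by move: str; rewrite distrC ger0_norm// subr_ge0 ltW.
Unshelve. all: by end_near. Qed.

Lemma primitive_wmeas x g u : bint g -> primitive x g u -> wmeas D u.
Proof. by move=> ig gu; apply: unif_wmeas; exact: primitive_unif ig gu. Qed.

Lemma in_ge0 (t : R) : D t -> 0 <= t <= tau.
Proof. by rewrite /= in_itv/= => /andP[/ltW -> ->]. Qed.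

Lemma RI_dot_bounded p v C : bint p -> wmeas D v ->
  (forall t, D t -> hn (v t) <= C) -> RI D (fun t => dot (p t) (v t)).
Proof.
move=> [mp ip] mv vC; apply: (RI_le (mitv _) _ (RI_scale (mitv _) C ip)).
  exact: wmeas_dot.
move=> t Dt.
rewrite (le_trans (normr_dot_le _ _))// mulrC; apply: ler_wpM2r; first exact: hn_ge0.
exact: vC.
Qed.

Section ProductRule.
Variables (x y : E) (p q u v : R -> E).
Hypotheses (ip : bint p) (iq : bint q) (pu : primitive x p u) (qv : primitive y q v).

Lemma product_rule_RI : RI D (fun s => dot (p s) (v s) + dot (u s) (q s)).
Proof.
apply: RI_add => //.
  apply: (RI_dot_bounded ip (primitive_wmeas iq qv)) => t Dt.
  exact: (primitive_bounded iq qv (in_ge0 Dt)).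
have -> : (fun s => dot (u s) (q s)) = (fun s => dot (q s) (u s)).
  by apply/funext => s; rewrite dotC.
apply: (RI_dot_bounded iq (primitive_wmeas ip pu)) => t Dt.
exact: (primitive_bounded ip pu (in_ge0 Dt)).
Qed.

(** No pointwise derivative is used: over a short interval the two sides change by amounts differing
    by at most e int (|p| + |q|), because [u] and [v] are uniformly continuous, and [const_of_osc]
    concludes. *)
Lemma product_rule (t : R) : 0 <= t <= tau ->
  dot (u t) (v t) = dot x y + \int[mu]_(s in I t) (dot (p s) (v s) + dot (u s) (q s)).
Proof.
move=> /andP[t0 tt]; have iF := product_rule_RI.
pose F s := dot (p s) (v s) + dot (u s) (q s).
pose Phi t := dot (u t) (v t) - \int[mu]_(s in I t) F s.
pose G t := \int[mu]_(s in I t) (hn (p s) + hn (q s)).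
have iG : RI D (fun s => hn (p s) + hn (q s)) by apply: RI_add => //; [exact: ip.2|exact: iq.2].
suff : Phi t = Phi 0.
  have -> : Phi 0 = dot x y.
    rewrite /Phi set_itv_ge ?bnd_simp// Rintegral_set0 subr0.
    by rewrite (primitive0 pu) (primitive0 qv).
  by move=> /eqP; rewrite subr_eq => /eqP.
apply: (@const_of_osc R Phi G tau) => // e e0.
have [r1 r10 H1] := primitive_unif ip pu e0; have [r2 r20 H2] := primitive_unif iq qv e0.
exists (Num.min r1 r2); first by rewrite lt_min r10.
move=> a b a0 ab bt; rewrite le_min => /andP[ba1 ba2].
have -> : G b - G a = \int[mu]_(s in J a b) (hn (p s) + hn (q s)) by exact: itv_splitR.
(* Abel splitting: (u b, v b) - (u a, v a) = (u b - u a, v b) + (v b - v a, u a). *)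
have -> : Phi b - Phi a = \int[mu]_(s in J a b)
    (dot (p s) (v b) + dot (q s) (u a) - F s).
  have iF1 : RI (J a b) F by exact: RIJ.
  have ip1 z : RI (J a b) (fun s => dot (p s) z) by apply: RIJ => //; exact: bint_dot.
  have iq1 z : RI (J a b) (fun s => dot (q s) z) by apply: RIJ => //; exact: bint_dot.
  rewrite RintegralB//; last exact: RI_add.
  have -> : \int[mu]_(s in J a b) (dot (p s) (v b) + dot (q s) (u a)) =
      dot (u b - u a) (v b) + dot (v b - v a) (u a).
    rewrite (primitive_sub (v b) ip pu a0 ab bt) (primitive_sub (u a) iq qv a0 ab bt).
    exact: (RintegralD (mitv _) (ip1 _) (iq1 _)).
  rewrite -(itv_splitR a0 ab bt iF) /Phi !dotBl (dotC (v b) (u a)) (dotC (v a) (u a)).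
  by lra.
have iE : RI (J a b) (fun s => dot (p s) (v b) + dot (q s) (u a) - F s).
  apply: RIJ => //; apply: RI_sub => //.
  by apply: RI_add => //; exact: bint_dot.
rewrite (le_trans (le_normr_Rintegral _ iE))//.
have iG1 : RI (J a b) (fun s => hn (p s) + hn (q s)) by exact: RIJ.
rewrite -RintegralZl//; apply: le_Rintegral => //.
- exact: RI_norm.
- exact: RI_scale.
move=> s; rewrite /= in_itv/= => /andP[as_ sb].
have -> : dot (p s) (v b) + dot (q s) (u a) - F s =
    dot (p s) (v b - v s) + dot (q s) (u a - u s).
  by rewrite /F !dotBr (dotC (u s)); lra.
rewrite (le_trans (ler_normD _ _))// mulrDr lerD//.
  rewrite (le_trans (normr_dot_le _ _))// mulrC; apply: ler_wpM2r; first exact: hn_ge0.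
  by apply: H2; rewrite ?(ltW (le_lt_trans a0 as_))//; lra.
rewrite (le_trans (normr_dot_le _ _))// mulrC; apply: ler_wpM2r; first exact: hn_ge0.
by rewrite hnB; apply: H1; rewrite ?(ltW as_) ?(le_trans sb)//; lra.
Qed.

End ProductRule.

Lemma energy x p u (t : R) : bint p -> primitive x p u -> 0 <= t <= tau ->
  hn (u t) ^+ 2 = hn x ^+ 2 + \int[mu]_(s in I t) (2 * dot (p s) (u s)).
Proof.
move=> ip pu t0; rewrite !sqr_hn (product_rule ip ip pu pu t0); congr (_ + _).
by apply: eq_Rintegral => s _; rewrite (dotC (u s)); ring.
Qed.

(** Lebesgue differentiation, applied to [f] extended by zero outside ]0, tau], whose primitive
    vanishes identically. *)
Lemma ae_zero_of_primitive (f : R -> R) : RI D f ->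
  (forall s, 0 <= s <= tau -> \int[mu]_(t in I s) f t = 0) ->
  {ae mu, forall t, D t -> f t = 0}.
Proof.
move=> fi H; pose g := f \_ D.
have gi : mu.-integrable setT (EFin \o g).
  by have [H0 _] := @integrable_mkcond _ _ _ mu D (EFin \o f) (mitv _); have := H0 fi;
    rewrite restrict_EFin.
have giy (y : R) : mu.-integrable [set` Interval (BRight 0) (BRight y)] (EFin \o g).
  by apply: (integrableS _ _ _ gi).
have lg : locally_integrable [set: R] g by exact: integrable_locally.
have F0 (y : R) : \int[mu]_(t in [set` Interval (BRight 0) (BRight y)]) g t = 0.
  rewrite -Rintegral_mkcondr.
  have [y0|y0] := leP y 0.
    have -> : `]0, y]%classic = set0 :> set R.
      by rewrite set_itv_ge// bnd_simp -leNgt.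
    by rewrite set0I Rintegral_set0.
  have -> : `]0, y]%classic `&` D = I (Num.min y tau).
    by apply/seteqP; split => s; rewrite /= !in_itv/= le_min; [move=> [/andP[-> ->] /andP[_ ->]]|
      move=> /and3P[-> -> ->]].
  by apply: H; rewrite le_min (ltW y0) (ltW tau_gt0) ge_min lexx orbT.
have := FTC1 giy lg; apply: filterS; first exact: (ae_filter_ringOfSetsType mu).
move=> x /= Hx Dx; have x0 : 0 < x by move: Dx; rewrite /= in_itv/= => /andP[].
have [_] := Hx x0.
have -> : (fun x : R => \int[mu]_(t in [set` Interval (BRight 0) (BRight x)]) g t) = cst 0.
  by apply/funext => z; rewrite F0.
by rewrite derive1_cst /g patchE mem_set.
Qed.

End TimeIntegral.

(** * Square integrable functions *)

Section SquareIntegrable.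
Variables (R : realType) (E : hilb R) (tau : R).
Local Notation mu := (@lebesgue_measure R).
Local Notation I t := (`]0, t]%classic : set (measurableTypeR R)).
Local Notation D := (`]0, tau]%classic : set (measurableTypeR R)).
Local Notation RI := (rintegrable mu).
Hypothesis (tau_gt0 : 0 < tau) (hsep : hseparable E).
Implicit Types (f g h : R -> E).

Local Hint Extern 0 (measurable _) => (exact: mitv) : core.

Let muD : (mu D < +oo)%E. Proof. exact: mu_itv_fin. Qed.

Definition sqint f := wmeas D f /\ RI D (fun t => hn (f t) ^+ 2).
(** The squared L2 norm. Square roots are avoided at the price of a factor 2 in the triangle
    inequality. *)
Definition N2 f : R := \int[mu]_(t in D) hn (f t) ^+ 2.

Lemma N2_ge0 f : 0 <= N2 f.
Proof. by apply: Rintegral_ge0 => t _; exact: sqr_ge0. Qed.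

Lemma sqint_le f (G : R -> R) : wmeas D f -> RI D G ->
  (forall t, D t -> hn (f t) ^+ 2 <= G t) -> sqint f.
Proof.
move=> mf iG fG; split => //; apply: (RI_le (mitv _) _ iG); first exact: wmeas_sqr_hn.
by move=> t Dt; rewrite ger0_norm ?sqr_ge0// fG.
Qed.

Lemma N2_le f (G : R -> R) : sqint f -> RI D G ->
  (forall t, D t -> hn (f t) ^+ 2 <= G t) -> N2 f <= \int[mu]_(t in D) G t.
Proof. by move=> [_ f2] iG fG; exact: le_Rintegral. Qed.

Lemma sqint_bounded f C : wmeas D f -> (forall t, D t -> hn (f t) <= C) -> sqint f.
Proof.
move=> mf fC; apply: (sqint_le mf (RI_cst (mitv _) (C ^+ 2) muD)) => t Dt.
by rewrite lerXn2r ?nnegrE ?hn_ge0 ?fC// (le_trans (hn_ge0 _) (fC t Dt)).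
Qed.

Lemma sqint_cst (y : E) : sqint (fun=> y).
Proof. by apply: (@sqint_bounded _ (hn y)) => //; exact: wmeas_cst. Qed.

Lemma N2_0 : N2 (fun=> 0) = 0.
Proof.
have -> : N2 (fun=> 0) = \int[mu]_(t in D) (0 : R).
  by apply: eq_Rintegral => t _; rewrite hn0 expr0n.
by rewrite Rintegral_cst// mul0r.
Qed.

Lemma sqint_bint f : sqint f -> bint tau f.
Proof.
move=> [mf f2]; split => //.
apply: (RI_le (mitv _) _ (RI_add (mitv _) (RI_cst (mitv _) 1 muD) f2)).
  exact: wmeas_hn.
move=> t _; rewrite ger0_norm ?hn_ge0//.
by have := sqr_ge0 (hn (f t) - 1); have := sqr_ge0 (hn (f t)); rewrite !expr2; lra.
Qed.

Lemma sqint_add f g : sqint f -> sqint g -> sqint (fun t => f t + g t).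
Proof.
move=> [mf f2] [mg g2]; apply: (sqint_le (wmeas_add mf mg)
  (RI_add (mitv _) (RI_scale (mitv _) 2 f2) (RI_scale (mitv _) 2 g2))) => t _.
rewrite !sqr_hn dotDl !dotDr (dotC (g t) (f t)).
by have := dot_ge0 (f t - g t); rewrite dotBl !dotBr (dotC (g t) (f t)); lra.
Qed.

Lemma N2_add f g : sqint f -> sqint g ->
  N2 (fun t => f t + g t) <= 2 * N2 f + 2 * N2 g.
Proof.
move=> f2 g2; have fg := sqint_add f2 g2.
have i1 := RI_scale (mitv _) 2 f2.2; have i2 := RI_scale (mitv _) 2 g2.2.
rewrite /N2 -(RintegralZl 2 (mitv _) f2.2) -(RintegralZl 2 (mitv _) g2.2) -RintegralD//.
apply: N2_le => //; first exact: RI_add.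
move=> t _; rewrite !sqr_hn dotDl !dotDr (dotC (g t) (f t)).
by have := dot_ge0 (f t - g t); rewrite dotBl !dotBr (dotC (g t) (f t)); lra.
Qed.

Lemma sqint_scale k f : sqint f -> sqint (fun t => k *: f t).
Proof.
move=> [mf f2]; apply: (sqint_le _ (RI_scale (mitv _) (k ^+ 2) f2)).
  by apply: wmeas_scale => //; exact: measurable_cst.
by move=> t _; rewrite hnZ exprMn real_normK// num_real.
Qed.

Lemma N2_scale k f : sqint f -> N2 (fun t => k *: f t) = k ^+ 2 * N2 f.
Proof.
move=> f2; rewrite /N2 -(RintegralZl _ (mitv _) f2.2); apply: eq_Rintegral => t _.
by rewrite hnZ exprMn real_normK// num_real.
Qed.

Lemma sqint_sub f g : sqint f -> sqint g -> sqint (fun t => f t - g t).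
Proof.
move=> f2 g2; have -> : (fun t => f t - g t) = (fun t => f t + -1 *: g t).
  by apply/funext => t; rewrite scaleN1r.
by apply: sqint_add => //; exact: sqint_scale.
Qed.

Lemma N2_subC f g : N2 (fun t => f t - g t) = N2 (fun t => g t - f t).
Proof. by apply: eq_Rintegral => t _; rewrite hnB. Qed.

Lemma N2_triangle h f g : sqint f -> sqint g -> sqint h ->
  N2 (fun t => f t - g t) <= 2 * N2 (fun t => f t - h t) + 2 * N2 (fun t => h t - g t).
Proof.
move=> f2 g2 h2.
have -> : (fun t => f t - g t) = (fun t => (f t - h t) + (h t - g t)).
  by apply/funext => t; rewrite addrA subrK.
by apply: N2_add; exact: sqint_sub.
Qed.

Lemma sqint_map (A : E -> E) C f : real_linear A -> 0 <= C -> bounded_by A C ->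
  sqint f -> sqint (fun t => A (f t)).
Proof.
move=> Al C0 AC [mf f2].
apply: (sqint_le (wmeas_map Al C0 AC mf) (RI_scale (mitv _) (C ^+ 2) f2)) => t _.
by rewrite -exprMn lerXn2r ?nnegrE ?hn_ge0// mulr_ge0// hn_ge0.
Qed.

Lemma sqint_dot f g : sqint f -> sqint g -> RI D (fun t => dot (f t) (g t)).
Proof.
move=> f2 g2; apply: (RI_le (mitv _) (wmeas_dot hsep f2.1 g2.1)
  (RI_add (mitv _) f2.2 g2.2)) => t _.
rewrite (le_trans (normr_dot_le _ _))//.
by have := sqr_ge0 (hn (f t) - hn (g t)); have := sqr_ge0 (hn (f t) + hn (g t)); rewrite !expr2; lra.
Qed.

Lemma discriminant (a b c : R) : 0 <= c ->
  (forall l, 0 <= a - 2 * l * b + l ^+ 2 * c) -> b ^+ 2 <= a * c.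
Proof.
move=> c0 H; have [c0'|cn0] := eqVneq c 0.
  have [->|b0] := eqVneq b 0; first by rewrite c0' expr0n/= mulr0.
  have := H ((a + 1) / (2 * b)); rewrite c0' mulr0 addr0.
  have -> : 2 * ((a + 1) / (2 * b)) * b = a + 1 by field.
  lra.
have cp : 0 < c by rewrite lt_def cn0.
have := H (b / c); have -> : a - 2 * (b / c) * b + (b / c) ^+ 2 * c = (a * c - b ^+ 2) / c.
  by field.
by rewrite pmulr_lge0 ?invr_gt0// subr_ge0.
Qed.

Lemma integral_cauchy_schwarz f g : sqint f -> sqint g ->
  (\int[mu]_(t in D) dot (f t) (g t)) ^+ 2 <= N2 f * N2 g.
Proof.
move=> f2 g2; apply: discriminant; first exact: N2_ge0.
move=> l; have ifg := sqint_dot f2 g2.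
have := N2_ge0 (fun t => f t - l *: g t); congr (_ <= _).
have i1 := RI_scale (mitv _) (2 * l) ifg; have i2 := RI_scale (mitv _) (l ^+ 2) g2.2.
rewrite -(RintegralZl _ (mitv _) ifg) /N2 -(RintegralZl _ (mitv _) g2.2).
rewrite -(RintegralB (mitv _) f2.2 i1) -(RintegralD (mitv _) (RI_sub (mitv _) f2.2 i1) i2).
apply: eq_Rintegral => t _; rewrite !sqr_hn dotBl !dotBr !dotZl !dotZr (dotC (g t) (f t)).
by ring.
Qed.

(** Cauchy-Schwarz against the function equal to y on ]0, t] and to 0 afterwards. *)
Lemma sqint_prim_le f (t : R) y : sqint f -> 0 <= t <= tau ->
  (\int[mu]_(s in I t) dot (f s) y) ^+ 2 <= N2 f * (hn y ^+ 2 * tau).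
Proof.
move=> f2 /andP[t0 tt].
pose g s := (\1_(I t) s : R) *: y.
have mg : wmeas D g by apply: wmeas_indic => //; exact: wmeas_cst.
have gy s : D s -> hn (g s) <= hn y.
  move=> _; rewrite /g hnZ indicE; case: (s \in _); rewrite ?normr1 ?mul1r//.
  by rewrite normr0 mul0r hn_ge0.
have g2 := sqint_bounded mg gy.
have -> : \int[mu]_(s in I t) dot (f s) y = \int[mu]_(s in D) dot (f s) (g s).
  have -> : I t = D `&` I t.
    by rewrite setIidr//; apply: subJ.
  rewrite Rintegral_mkcondr; apply: eq_Rintegral => s _.
  rewrite patchE /g indicE; case: ifPn => _; first by rewrite scale1r.
  by rewrite scale0r dot0r.
apply: (le_trans (integral_cauchy_schwarz f2 g2)); apply: ler_wpM2l; first exact: N2_ge0.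
apply: le_trans (N2_le g2 (RI_cst (mitv _) (hn y ^+ 2) muD) _) _.
  by move=> s Ds; rewrite lerXn2r ?nnegrE ?hn_ge0// gy.
have E1 : fine (mu D) = tau by rewrite lebesgue_measure_itv/= lte_fin tau_gt0 -EFinB/= subr0.
by rewrite Rintegral_cst// -[X in _ <= _ * X]E1.
Qed.

Definition N2cvg (F : nat -> R -> E) f := forall e, 0 < e -> exists N, forall n,
  (N <= n)%N -> N2 (fun t => F n t - f t) <= e.

Lemma N2cvg_prim (F : nat -> R -> E) f (t : R) y :
  (forall n, sqint (F n)) -> sqint f -> N2cvg F f -> 0 <= t <= tau ->
  \int[mu]_(s in I t) dot (F n s) y @[n --> \oo] --> \int[mu]_(s in I t) dot (f s) y.
Proof.
move=> F2 f2 Ff tt; apply/cvgrPdist_le => e e0.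
have C0 : 0 < hn y ^+ 2 * tau + 1 by rewrite ltr_wpDl// mulr_ge0 ?sqr_ge0// ltW.
have [N HN] := Ff _ (divr_gt0 (exprn_gt0 2 e0) C0).
exists N => // n /= /HN; rewrite ler_pdivlMr// => H.
have [t0 tl] := andP tt.
have iF := RIJ (lexx 0) tl (bint_dot y (sqint_bint (F2 n))).
have if_ := RIJ (lexx 0) tl (bint_dot y (sqint_bint f2)).
rewrite distrC -(RintegralB (mitv _) iF if_) -(ler_pXn2r (n := 2)) ?nnegrE ?(ltW e0)//.
rewrite real_normK ?num_real// (le_trans _ H)//.
under eq_Rintegral do rewrite -dotBl.
apply: (le_trans (sqint_prim_le y (sqint_sub (F2 n) f2) tt)).
by apply: ler_wpM2l; [exact: N2_ge0|rewrite lerDl].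
Qed.

Lemma N2_ae f g : sqint f -> sqint g ->
  {ae mu, forall t, D t -> f t = g t} -> N2 f = N2 g.
Proof.
move=> [mf f2] [mg g2] fg; congr fine; apply: ae_eq_integral => //.
- exact: (measurable_int mu f2).
- exact: (measurable_int mu g2).
- by apply: filterS fg => t /= H Dt; rewrite H.
Qed.

Lemma geo_partial_sum n : \sum_(k < n) (4^-1 : R) ^+ k <= 2.
Proof.
suff : \sum_(k < n) (4^-1 : R) ^+ k <= 2 * (1 - 4^-1 ^+ n).
  have : 0 <= (4^-1 : R) ^+ n by rewrite exprn_ge0// invr_ge0.
  lra.
elim: n => [|n IH]; first by rewrite big_ord0 expr0 subrr mulr0.
rewrite big_ord_recr/= exprS; move: IH.
have : 0 <= (4^-1 : R) ^+ n by rewrite exprn_ge0// invr_ge0.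
by move: (4^-1 ^+ n) (\sum_(_ < _) _) => a b; lra.
Qed.

(* With N2 of the k-th increment at most 16^-k along a subsequence, the function
   g = sum_k 4^k |increment_k|^2 is integrable, and where it is finite the
   increments are at most sqrt g 2^-k. *)
Lemma riesz_fischer (F : nat -> R -> E) : (forall n, sqint (F n)) ->
  (forall e, 0 < e -> exists N, forall m n, (N <= m)%N -> (N <= n)%N ->
     N2 (fun t => F m t - F n t) <= e) ->
  exists f (psi : nat -> nat), [/\ sqint f, forall k, (k <= psi k)%N,
    {ae mu, forall t, D t -> hcvg (fun k => F (psi k) t) (f t)} & N2cvg F f].
Proof.
move=> F2 Fc.
have q16 k : 0 < (16^-1 : R) ^+ k by rewrite exprn_gt0// invr_gt0.
have q4 k : 0 < (4^-1 : R) ^+ k by rewrite exprn_gt0// invr_gt0.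
have /choice[phi phiP] : forall k, exists N, forall m n, (N <= m)%N -> (N <= n)%N ->
     N2 (fun t => F m t - F n t) <= 16^-1 ^+ k by move=> k; exact: Fc.
(* [psi] is strictly increasing and stays beyond [phi], so that consecutive terms of the subsequence
   differ by at most 16^-k and psi k >= k. *)
pose fix psi k := if k is k'.+1 then maxn (psi k').+1 (phi k'.+1) else phi 0%N.
have phipsi k : (phi k <= psi k)%N by case: k => [//|k]; rewrite /= leq_maxr.
have psiS k : (psi k < psi k.+1)%N by rewrite /= leq_max ltnS leqnn.
have kpsi k : (k <= psi k)%N by elim: k => // k IH; exact: leq_ltn_trans (psiS k).
pose d k t := F (psi k.+1) t - F (psi k) t.
have d2 k : sqint (d k) by exact: sqint_sub.
have dN k : N2 (d k) <= 16^-1 ^+ k.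
  apply: phiP; rewrite // (leq_trans (phipsi k))// ltnW//; exact: psiS.
pose s k t := 4 ^+ k * hn (d k t) ^+ 2.
have s0 k t : 0 <= s k t by rewrite mulr_ge0 ?sqr_ge0// exprn_ge0.
have si k : RI D (s k) by apply: RI_scale => //; exact: (d2 k).2.
have ms k : measurable_fun D (fun t => (s k t)%:E).
  by apply/measurable_EFinP; exact: RI_meas (si k).
pose g t := (\sum_(k <oo) (s k t)%:E)%E.
have g0 t : (0 <= g t)%E by apply: nneseries_ge0 => k _ _; rewrite lee_fin.
have mg : measurable_fun D g.
  by apply: ge0_emeasurable_sum => [k t _ _|k _]; [rewrite lee_fin|exact: ms].
have gi : mu.-integrable D g.
  apply/integrableP; split => //.
  under eq_integral do rewrite gee0_abs//.
  rewrite /g integral_nneseries//; last by move=> n x _; rewrite lee_fin.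
  apply: (@le_lt_trans _ _ 2%:E); last exact: ltry.
  apply: lime_le; first by apply: is_cvg_nneseries => k _ _; apply: integral_ge0 => t _; rewrite lee_fin.
  apply: nearW => n; rewrite big_mkord.
  apply: (@le_trans _ _ (\sum_(k < n) ((4^-1 : R) ^+ k)%:E)%E); last first.
    by rewrite sumEFin lee_fin geo_partial_sum.
  apply: lee_sum => k _.
  have -> : (\int[mu]_(x in D) (s k x)%:E = (\int[mu]_(x in D) s k x)%:E)%E.
    rewrite /Rintegral fineK//; apply: integrable_fin_num => //; exact: si.
  rewrite lee_fin RintegralZl//; last exact: (d2 k).2.
  rewrite (le_trans (ler_wpM2l _ (dN k))) ?exprn_ge0//.
  rewrite -exprMn; have -> : 4 * 16^-1 = 4^-1 :> R by field.
  by [].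
have gfin : {ae mu, forall t, D t -> g t \is a fin_num} by exact: integrable_ae.
pose G := D `&` [set t | g t \is a fin_num].
have mG : measurable G by exact: emeasurable_fin_num.
pose gam t := fine (g t).
have gam0 t : 0 <= gam t by exact: fine_ge0.
have gami : RI D gam.
  apply: (le_integrable (mitv _) _ _ gi).
    by apply/measurable_EFinP; apply: measurableT_comp mg; exact: fine_measurable.
  move=> t _; rewrite /= ger0_norm// (gee0_abs (g0 t)) /gam.
  by case: (g t) (g0 t) => //= r; rewrite ?leey.
have dG k t : G t -> hn (d k t) <= Num.sqrt (gam t) * 2^-1 ^+ k.
  move=> [Dt gt].
  have : ((s k t)%:E <= g t)%E.
    have /= := @nneseries_lim_ge _ (fun k => (s k t)%:E) xpredT 0%N k.+1.
    rewrite big_nat_recr//= => /(_ _)/(le_trans _); apply.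
      by rewrite leeDr// sume_ge0// => n _; rewrite lee_fin.
    by move=> n _ _; rewrite lee_fin.
  rewrite -[g t]fineK// lee_fin -/(gam t) => H.
  have h2 : 0 <= (2^-1 : R) ^+ k by rewrite exprn_ge0// invr_ge0.
  rewrite -(ler_pXn2r (n := 2)) ?nnegrE ?hn_ge0 ?mulr_ge0 ?sqrtr_ge0//.
  rewrite exprMn (sqr_sqrtr (gam0 t)) -exprM mulnC exprM.
  have -> : (2^-1 : R) ^+ 2 = 4^-1 by rewrite exprVn -natrX.
  by rewrite exprVn ler_pdivlMr ?exprn_gt0// mulrC.
have geo k t : G t -> exists x, hcvg (fun i => F (psi i) t) x /\
    hn (x - F (psi k) t) <= 2 * (Num.sqrt (gam t) * 2^-1 ^+ k).
  move=> Gt; have [i|x [xc xk]] := @hcauchy_geo R E (fun i => F (psi (i + k)%N) t)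
      (Num.sqrt (gam t) * 2^-1 ^+ k).
    rewrite addSn (le_trans (dG _ _ Gt))// exprD mulrA mulrAC -mulrA.
    by rewrite mulrA.
  exists x; split => //.
  apply/hcvgP => e e0; have [N HN] := (hcvgP _ _).1 xc _ e0.
  exists (N + k)%N => n Nn; have nk : (k <= n)%N by rewrite (leq_trans _ Nn)// leq_addl.
  by have := HN (n - k)%N; rewrite subnK// => -> //; rewrite leq_subRL// addnC.
have /choice[l lP] : forall t, exists x, G t -> hcvg (fun i => F (psi i) t) x.
  move=> t; have [Gt|nGt] := pselect (G t); last by exists 0.
  by have [x [xc _]] := geo 0%N t Gt; exists x.
(* The limit and its approximants are both cut to 0 off [G]; the convergence then holds at every
   point and measurability passes to the limit. *)
pose f t := (\1_G t : R) *: l t.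
pose F' k t := (\1_G t : R) *: F (psi k) t.
have G1 t : G t -> (\1_G t : R) = 1 by move=> Gt; rewrite indicE mem_set.
have G0 t : ~ G t -> (\1_G t : R) = 0 by move=> Gt; rewrite indicE memNset.
have mF' k : wmeas D (F' k) by apply: wmeas_indic => //; exact: (F2 _).1.
have mf : wmeas D f.
  apply: (wmeas_cvg mF') => t _; have [Gt|nGt] := pselect (G t).
    by rewrite /f /F' G1//; under eq_fun do rewrite scale1r; rewrite scale1r; exact: lP.
  apply/hcvgP => e e0; exists 0%N => n _.
  by rewrite /f /F' G0// !scale0r subrr hn0 ltW.
have fF k t : D t -> hn (f t - F' k t) ^+ 2 <= 4 * 4^-1 ^+ k * gam t.
  move=> _; have [Gt|nGt] := pselect (G t); last first.
    by rewrite /f /F' G0// !scale0r subrr hn0 expr0n/= mulr_ge0// mulr_ge0// ltW.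
  rewrite /f /F' G1// !scale1r; have [x [xc xk]] := geo k t Gt.
  rewrite (hcvg_uniq (lP t Gt) xc).
  have h2 : 0 <= (2^-1 : R) ^+ k by rewrite exprn_ge0// invr_ge0.
  rewrite (@le_trans _ _ ((2 * (Num.sqrt (gam t) * 2^-1 ^+ k)) ^+ 2))//.
    by rewrite lerXn2r ?nnegrE ?hn_ge0 ?mulr_ge0 ?sqrtr_ge0.
  rewrite !exprMn (sqr_sqrtr (gam0 t)) -exprM mulnC exprM.
  have -> : (2^-1 : R) ^+ 2 = 4^-1 by rewrite exprVn -natrX.
  have -> : (2 : R) ^+ 2 = 4 by rewrite -natrX.
  by rewrite le_eqVlt; apply/orP; left; apply/eqP; ring.
have ae_G : {ae mu, forall t, D t -> G t}.
  by apply: filterS gfin => t /= H Dt; split; [|exact: H].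
have f2F' k : sqint (fun t => f t - F' k t).
  by apply: (sqint_le (wmeas_sub mf (mF' k)) (RI_scale (mitv _) _ gami)); exact: fF.
have F'2 k : sqint (F' k).
  apply: (sqint_le (mF' k) (F2 (psi k)).2) => t _.
  rewrite /F' hnZ indicE; case: (t \in G); rewrite ?normr1 ?mul1r//.
  by rewrite normr0 mul0r expr0n/= sqr_ge0.
have f2 : sqint f.
  have -> : f = fun t => (f t - F' 0%N t) + F' 0%N t.
    by apply/funext => t; rewrite subrK.
  exact: sqint_add.
have fN k : N2 (fun t => F (psi k) t - f t) <= 4 * 4^-1 ^+ k * \int[mu]_(t in D) gam t.
  rewrite N2_subC -RintegralZl// (@N2_ae _ (fun t => f t - F' k t))//.
  - by apply: N2_le => //; [exact: RI_scale|exact: fF].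
  - exact: sqint_sub.
  - apply: filterS ae_G.
    by move=> t /= H Dt; rewrite /F' G1 ?scale1r//; exact: H.
exists f, psi; split => //.
  apply: filterS ae_G.
  move=> t /= H Dt; rewrite /f G1 ?scale1r; last exact: H.
  by apply: lP; exact: H.
move=> e e0; have e4 : 0 < e / 4 by rewrite divr_gt0.
have [N HN] := Fc _ e4.
pose Gam := \int[mu]_(t in D) gam t.
have Gam0 : 0 <= Gam by exact: Rintegral_ge0.
have cv : (4 * Gam) * 4^-1 ^+ k @[k --> \oo] --> (0 : R).
  rewrite -[X in _ --> X](mulr0 (4 * Gam)); apply: cvgMr.
  by apply: cvg_expr; rewrite ger0_norm ?invr_ge0// invf_lt1// ltr1n.
move/cvgrPdist_le : cv => /(_ _ e4)[K _ HK].
exists N => n Nn; pose k := maxn K N.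
have := HK k (leq_maxl _ _); rewrite sub0r normrN ger0_norm; last first.
  by rewrite !mulr_ge0// ltW.
move=> Hk; have h1 := HN n (psi k) Nn (leq_trans (leq_maxr K N) (kpsi k)).
have h2 := fN k; have h3 := N2_triangle (F2 n) f2 (F2 (psi k)).
have h4 : 4 * 4^-1 ^+ k * \int[mu]_(t in D) gam t = 4 * Gam * 4^-1 ^+ k by rewrite mulrAC.
by rewrite h4 in h2; lra.
Qed.

End SquareIntegrable.

(** * Gronwall and Picard iteration *)

Lemma hcvg_hn (R : realType) (E : hilb R) (s : nat -> E) x :
  hcvg s x -> hn (s n) @[n --> \oo] --> hn x.
Proof.
move=> /hcvgP sx; apply/cvgrPdist_le => e e0; have [N HN] := sx e e0.
exists N => // n /= /HN; apply: le_trans.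
have h1 := hnD (s n) (x - s n); have h2 := hnD x (s n - x).
rewrite [s n + _]addrC subrK in h1; rewrite [x + _]addrC subrK in h2.
by rewrite ler_norml; rewrite (hnB x) in h1; lra.
Qed.

Section Gronwall.
Variables (R : realType) (tau C : R).
Local Notation mu := (@lebesgue_measure R).
Local Notation I t := (`]0, t]%classic : set (measurableTypeR R)).
Local Notation D := (`]0, tau]%classic : set (measurableTypeR R)).
Local Notation RI := (rintegrable mu).
Hypothesis (tau_gt0 : 0 < tau) (C_gt0 : 0 < C).
Local Hint Extern 0 (measurable _) => (exact: mitv) : core.

Let RI_exp (b c : R) : 0 <= b -> RI D (fun s => c * expR (b * s)).
Proof.
move=> b0; apply: (@RI_bounded _ _ _ _ _ _ (`|c| * expR (b * tau))) => //.
- exact: mu_itv_fin.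
- apply: measurable_funTS; apply: measurable_funM => //.
  by apply: measurableT_comp; [exact: measurable_expR|exact: measurable_funM].
- move=> t; rewrite /= in_itv/= => /andP[t0 tt]; rewrite normrM.
  by rewrite ler_wpM2l// ger0_norm ?expR_ge0// ler_expR ler_wpM2l.
Qed.

Let int_exp (b t : R) : 0 < b -> 0 <= t ->
  \int[mu]_(s in I t) expR (b * s) <= expR (b * t) / b.
Proof.
move=> b0; rewrite le_eqVlt => /predU1P[<-|t0].
  by rewrite set_itv_ge ?bnd_simp// Rintegral_set0 divr_ge0 ?expR_ge0 ?ltW.
have dF (x : R) : is_derive x 1 (fun s => b^-1 * expR (b * s)) (expR (b * x)).
  have d1 : is_derive x 1 (fun s : R => b * s) b.
    have H := is_deriveZ b (@is_derive_id R _ x 1).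
    by apply: (is_derive_eq H); rewrite /GRing.scale/= mulr1.
  have d2 := @is_derive1_comp R expR (fun s : R => b * s) x _ _ (is_derive_expR (b * x)) d1.
  have d3 := is_deriveZ b^-1 d2.
  by apply: (is_derive_eq d3); rewrite /GRing.scale/= mulrCA mulVf ?mulr1// gt_eqF.
have cexp : continuous (fun s : R => expR (b * s)).
  move=> s; apply: (@continuous_comp _ _ _ (fun s : R => b * s) expR).
    by apply: cvgM; [exact: cvg_cst|exact: cvg_id].
  exact: continuous_expR.
have := @FTC_segment R (fun s => b^-1 * expR (b * s)) (fun s => expR (b * s)) 0 t t0
  (fun x _ => dF x) (fun x _ => cexp x).
rewrite -integral_itv_obnd_cbnd; last first.
  apply/measurable_EFinP; apply: measurable_funTS.
  exact: continuous_measurable_fun.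
move=> /(congr1 fine) /= H; rewrite /Rintegral H mulr0 expR0 mulr1.
by rewrite mulrC lerBlDr lerDl invr_ge0 ltW.
Qed.

(* Bielecki's weight exp (4 C t) turns the Volterra operator C int_0^t into a
   contraction of factor 1/4. *)
Lemma gronwall_iterate (Z : nat -> R -> R) (A N : R) : 0 <= A -> 0 <= N ->
  (forall k, RI D (Z k)) -> (forall t, 0 <= t <= tau -> Z 0%N t <= N) ->
  (forall k t, 0 <= t <= tau -> Z k.+1 t <= A + C * \int[mu]_(s in I t) Z k s) ->
  forall k t, 0 <= t <= tau ->
    Z k t <= (2 * A + N * 4^-1 ^+ k) * expR (4 * C * t).
Proof.
move=> A0 N0 iZ Z0 ZS; pose b := 4 * C; have b0 : 0 < b by rewrite mulr_gt0.
have e1 t : 0 <= t -> 1 <= expR (b * t).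
  by move=> t0; rewrite -expR0 ler_expR mulr_ge0// ltW.
elim=> [|k IH] t tt; have [t0 tl] := andP tt.
  rewrite expr0 mulr1 (le_trans (Z0 _ tt))//.
  rewrite (@le_trans _ _ ((2 * A + N) * 1))//; first by rewrite mulr1 lerDr mulr_ge0.
  by rewrite ler_wpM2l ?e1// addr_ge0// mulr_ge0.
set c := 2 * A + N * 4^-1 ^+ k in IH.
have c0 : 0 <= c by rewrite addr_ge0 ?mulr_ge0// exprn_ge0// invr_ge0.
have h1 : \int[mu]_(s in I t) Z k s <= c * (expR (b * t) / b).
  apply: (@le_trans _ _ (\int[mu]_(s in I t) (c * expR (b * s)))).
    apply: le_Rintegral => //.
    - exact: (RIJ (lexx 0) tl (iZ k)).
    - exact: (RIJ (lexx 0) tl (RI_exp _ (ltW b0))).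
    - move=> s; rewrite /= in_itv/= => /andP[s0 st]; apply: IH.
      by rewrite ltW//= (le_trans st).
  rewrite RintegralZl//; last first.
    have := RI_exp 1 (ltW b0); have -> : (fun s => 1 * expR (b * s)) = fun s => expR (b * s).
      by apply/funext => s; rewrite mul1r.
    by move=> H; exact: (RIJ (lexx 0) tl H).
  by rewrite ler_wpM2l// int_exp.
rewrite (le_trans (ZS k t tt))//.
have h2 : C * \int[mu]_(s in I t) Z k s <= c / 4 * expR (b * t).
  rewrite (le_trans (ler_wpM2l (ltW C_gt0) h1))// le_eqVlt; apply/orP; left.
  by apply/eqP; rewrite /b; field; rewrite gt_eqF.
(* The constant 2 A is stable under the iteration because A + 2 A / 4 <= 2 A. *)
have h3 : A <= A * expR (b * t) by rewrite ler_peMr ?e1.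
rewrite (le_trans (lerD h3 h2))// -mulrDl ler_wpM2r ?expR_ge0//.
by rewrite exprS /c; move: (4^-1 ^+ k) => x; lra.
Qed.

(** A constant sequence satisfies the hypotheses of the iteration lemma, and N 4^-k vanishes as k
    grows, so the bound no longer depends on [N]. *)
Lemma gronwall (Z : R -> R) (A N : R) : 0 <= A -> RI D Z ->
  (forall t, 0 <= t <= tau -> 0 <= Z t <= N) ->
  (forall t, 0 <= t <= tau -> Z t <= A + C * \int[mu]_(s in I t) Z s) ->
  forall t, 0 <= t <= tau -> Z t <= 2 * A * expR (4 * C * t).
Proof.
move=> A0 iZ ZN ZZ t tt.
have N0 : 0 <= N by have /andP[h1 h2] := ZN t tt; exact: le_trans h2.
have H k : Z t <= (2 * A + N * 4^-1 ^+ k) * expR (4 * C * t).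
  apply: (@gronwall_iterate (fun=> Z) A N) => //.
  by move=> s ss; have /andP[] := ZN s ss.
have cv : (2 * A + N * 4^-1 ^+ k) * expR (4 * C * t) @[k --> \oo] -->
    (2 * A + N * 0) * expR (4 * C * t).
  apply: cvgMl; apply: cvgD; first exact: cvg_cst.
  apply: cvgMr; apply: cvg_expr.
  by rewrite ger0_norm ?invr_ge0// invf_lt1// ltr1n.
by rewrite mulr0 addr0 in cv; apply: (cvgr_to_ge cv); exact: nearW.
Qed.

End Gronwall.

Section AeIntegral.
Variables (R : realType) (tau : R).
Local Notation mu := (@lebesgue_measure R).
Local Notation I t := (`]0, t]%classic : set (measurableTypeR R)).
Local Notation D := (`]0, tau]%classic : set (measurableTypeR R)).
Local Notation RI := (rintegrable mu).
Local Hint Extern 0 (measurable _) => (exact: mitv) : core.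

Lemma ae_subI (P : R -> Prop) (t : R) : t <= tau -> {ae mu, forall s, D s -> P s} ->
  {ae mu, forall s, I t s -> P s}.
Proof. by move=> tt; apply: filterS => s /= H Is; apply: H; exact: (subJ (lexx 0) tt). Qed.

Lemma Rintegral_ae_eq (A : set (measurableTypeR R)) (f g : R -> R) : measurable A ->
  RI A f -> RI A g -> {ae mu, forall s, A s -> f s = g s} ->
  \int[mu]_(s in A) f s = \int[mu]_(s in A) g s.
Proof.
move=> mA fi gi fg; congr fine; apply: ae_eq_integral => //.
- exact: (measurable_int mu fi).
- exact: (measurable_int mu gi).
- by apply: filterS fg => t /= H Dt; rewrite H.
Qed.

Lemma Rintegral_ae_le (A : set (measurableTypeR R)) (f g : R -> R) : measurable A ->
  RI A f -> RI A g -> {ae mu, forall s, A s -> f s <= g s} ->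
  \int[mu]_(s in A) f s <= \int[mu]_(s in A) g s.
Proof.
move=> mA fi gi fg.
have im : RI A (fun s => Num.min (f s) (g s)).
  apply: (@RI_le _ _ _ mu A mA _ (fun s => `|f s| + `|g s|)).
  - by apply: measurable_minr; [exact: RI_meas fi|exact: RI_meas gi].
  - by apply: RI_add => //; [exact: RI_norm fi|exact: RI_norm gi].
  move=> t _; rewrite /Num.min; case: ifP => _; first by rewrite lerDl.
  by rewrite lerDr.
rewrite (@Rintegral_ae_eq A f (fun s => Num.min (f s) (g s)))//.
  by apply: le_Rintegral => // t _; rewrite ge_min lexx orbT.
by apply: filterS fg => t /= H At; rewrite min_l// H.
Qed.

Lemma ge0_Rintegral_eq0 (A : set (measurableTypeR R)) (f : R -> R) : measurable A ->
  RI A f -> (forall s, A s -> 0 <= f s) -> \int[mu]_(s in A) f s <= 0 ->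
  {ae mu, forall s, A s -> f s = 0}.
Proof.
move=> mA fi f0 If.
have := ae_eq_integral_abs mu mA (measurable_int mu fi).
have -> : (\int[mu]_(x in A) `|(EFin \o f) x| = \int[mu]_(x in A) (f x)%:E)%E.
  by apply: eq_integral => x; rewrite inE => Ax; rewrite /= ger0_norm// f0.
have -> : (\int[mu]_(x in A) (f x)%:E = (\int[mu]_(x in A) f x)%:E)%E.
  by rewrite /Rintegral fineK//; apply: integrable_fin_num.
have -> : \int[mu]_(x in A) f x = 0.
  by apply/eqP; rewrite eq_le If/=; apply: Rintegral_ge0.
move=> [+ _] => /(_ erefl); apply: filterS => s /= H As.
by have := H As; rewrite /= => -[].
Qed.

(** Measurability in t comes from monotonicity, after replacing t by min t tau. *)
Lemma nondecreasing_integral_RI (f : R -> R) : 0 < tau -> RI D f ->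
  (forall s, D s -> 0 <= f s) -> RI D (fun t => \int[mu]_(s in I t) f s).
Proof.
move=> t0 fi f0.
have mono (a b : R) : 0 <= a -> a <= b -> b <= tau ->
    \int[mu]_(s in I a) f s <= \int[mu]_(s in I b) f s.
  move=> a0 ab bt; rewrite -subr_ge0 (itv_splitR a0 ab bt fi).
  by apply: Rintegral_ge0 => s Js; apply: f0; exact: (subJ a0 bt).
apply: (@RI_bounded _ _ _ _ _ _ (\int[mu]_(s in D) f s)) => //.
- exact: mu_itv_fin.
- apply: (@eq_measurable_fun _ _ _ _ D
    (fun t => \int[mu]_(s in I (Num.min t tau)) f s)).
    by move=> t; rewrite inE/= in_itv/= => /andP[_ tt]; rewrite min_l.
  apply: nondecreasing_measurable => // a b ab.
  have [a0|a0] := leP 0 a.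
    by apply: mono; rewrite ?le_min ?a0 ?(ltW t0) ?ge_min ?ab ?lexx ?orbT.
  rewrite [X in X <= _](_ : _ = 0).
    apply: Rintegral_ge0 => s Is; apply: f0.
    by apply: (subJ (lexx 0) _ Is); rewrite ge_min lexx orbT.
  rewrite set_itv_ge ?Rintegral_set0// bnd_simp -leNgt ge_min.
  by rewrite (ltW a0).
- move=> t; rewrite /= in_itv/= => /andP[s0 st]; rewrite ger0_norm.
    by apply: mono => //; exact: ltW.
  by apply: Rintegral_ge0 => s Is; apply: f0; exact: (subJ (lexx 0) st).
Qed.

End AeIntegral.

(** * Approximation from a dense sequence and measurable families of operators *)

Section SeparableApprox.
Variables (R : realType) (E : hilb R) (e : nat -> E).

(** The point closest to x among 0, e 0, ..., e (k - 1). Starting from 0 gives [nearest_le0], which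
    provides domination by |x|. *)
Fixpoint nearest (k : nat) (x : E) : E :=
  if k is k'.+1 then
    if hn (x - e k') < hn (x - nearest k' x) then e k' else nearest k' x
  else 0.

Lemma nearest_le k i x : (i < k)%N -> hn (x - nearest k x) <= hn (x - e i).
Proof.
elim: k => [//|k IH]; rewrite ltnS leq_eqVlt => /predU1P[->|ik] /=.
  by case: ifPn => [//|]; rewrite -leNgt.
by case: ifPn => [/ltW H|_]; [exact: le_trans (IH ik)|exact: IH].
Qed.

Lemma nearest_le0 k x : hn (x - nearest k x) <= hn x.
Proof.
elim: k => [|k IH] /=; first by rewrite subr0.
by case: ifPn => [/ltW H|_]; [exact: le_trans IH|exact: IH].
Qed.

Lemma nearest_cvg x : (forall eps, 0 < eps -> exists i, hn (x - e i) <= eps) ->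
  hcvg (nearest^~ x) x.
Proof.
move=> H; apply/hcvgP => eps /H[i Hi]; exists i.+1 => n ni.
by rewrite hnB (le_trans (nearest_le _ ni)).
Qed.

End SeparableApprox.

Section OperatorValued.
Variables (R : realType) (E : hilb R) (tau : R).
Local Notation D := (`]0, tau]%classic : set (measurableTypeR R)).
Hypothesis (hsep : hseparable E).
Local Hint Extern 0 (measurable _) => (exact: mitv) : core.

Lemma wmeas_select (A : set (measurableTypeR R)) (f g h : R -> E) : measurable A ->
  wmeas D f -> wmeas D g -> (forall t, D t -> A t -> h t = f t) ->
  (forall t, D t -> ~ A t -> h t = g t) -> wmeas D h.
Proof.
move=> mA mf mg hf hg.
have m1 := wmeas_indic mA mf; have m2 := wmeas_indic (measurableC mA) mg.
move=> y; apply: (@eq_measurable_fun _ _ _ _ D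
  (fun t => dot ((\1_A t : R) *: f t + (\1_(~` A) t : R) *: g t) y)); last first.
  exact: (wmeas_add m1 m2).
move=> t; rewrite inE => Dt; have [At|nAt] := pselect (A t).
  rewrite (hf t Dt At) !indicE mem_set// memNset; last by move=> /(_ At).
  by rewrite scale1r scale0r addr0.
rewrite (hg t Dt nAt) !indicE memNset// mem_set//.
by rewrite scale1r scale0r add0r.
Qed.

Variables (C : R -> E -> E) (C0 : R).
Hypotheses (C_lin : forall t, D t -> real_linear (C t))
  (C_le : forall t, D t -> bounded_by (C t) C0)
  (C_meas : forall x, wmeas D (C^~ x)).

(** The function C t (v t) is the pointwise limit of C t (nearest e k (v t)), and the latter
    coincides on measurable pieces with finitely many functions C t y with y fixed. *)
Lemma wmeas_operator (v : R -> E) : wmeas D v -> wmeas D (fun t => C t (v t)).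
Proof.
move=> mv; have [e eP] := hsep.
have H k : wmeas D (fun t => nearest e k (v t)) /\
    wmeas D (fun t => C t (nearest e k (v t))).
  elim: k => [|k [IH1 IH2]]; first by split; [exact: wmeas_cst|exact: C_meas].
  pose A := D `&` [set t | hn (v t - e k) < hn (v t - nearest e k (v t))].
  have mA : measurable A.
    have : measurable_fun D (fun t => hn (v t - e k) < hn (v t - nearest e k (v t))).
      apply: measurable_fun_ltr.
        exact: (wmeas_hn hsep (wmeas_sub mv (wmeas_cst (e k)))).
      exact: (wmeas_hn hsep (wmeas_sub mv IH1)).
    move=> /(_ (mitv _) [set true]) H; have /H : measurable [set true] by [].
    by congr (measurable _); apply/seteqP; split => t /= [].
  split.
    apply: (wmeas_select mA (wmeas_cst (e k)) IH1) => t Dt.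
      by move=> [_ /= ->].
    by move=> nA /=; case: ifPn => // h; exfalso; apply: nA.
  apply: (wmeas_select mA (C_meas (e k)) IH2) => t Dt.
    by move=> [_ /= ->].
  by move=> nA /=; case: ifPn => // h; exfalso; apply: nA.
apply: (wmeas_cvg (fun k => (H k).2)) => t Dt.
apply: (bounded_cvg (C_lin Dt) (C_le Dt)); apply: nearest_cvg => eps; exact: eP.
Qed.

End OperatorValued.

(** * The autonomous evolution equation *)

Lemma invn_small (R : realType) (eps : R) : 0 < eps ->
  exists N, forall n, (N <= n)%N -> n.+1%:R^-1 <= eps.
Proof.
move=> e0; exists (Num.bound eps^-1) => n Nn.
rewrite -[leRHS]invrK lef_pV2 ?posrE ?invr_gt0//.
rewrite (le_trans (ltW (archi_boundP _)))// ?invr_ge0 ?(ltW e0)//.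
by rewrite ler_nat ltnW.
Qed.

Section Evolution.
Variables (R : realType) (E : hilb R) (tau : R).
Local Notation mu := (@lebesgue_measure R).
Local Notation I t := (`]0, t]%classic : set (measurableTypeR R)).
Local Notation D := (`]0, tau]%classic : set (measurableTypeR R)).
Local Notation RI := (rintegrable mu).
Hypothesis (tau_gt0 : 0 < tau) (hsep : hseparable E).
Local Hint Extern 0 (measurable _) => (exact: mitv) : core.
Local Notation sqint := (sqint tau).
Local Notation N2 := (N2 tau).
Local Notation N2cvg := (N2cvg tau).

(** What the evolution equation needs to know of S: [T] is S^(-1/2), [Rn n] is N (N + S)^-1 with N =
    n.+1, [Pn n] is the bounded operator S^(1/2) Rn n, whose norm may grow with n, and [sigma] is
    the form read on H through [T]. *)
Variables (T : E -> E) (CT : R) (Rn Pn : nat -> E -> E) (CP : nat -> R)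
  (sigma : E -> E -> R) (Ms cs : R).
Hypotheses (T_lin : real_linear T) (CT0 : 0 <= CT) (T_le : bounded_by T CT)
  (Rn_lin : forall n, real_linear (Rn n)) (Rn_le : forall n, bounded_by (Rn n) 1)
  (Rn_cvg : forall x, hcvg (Rn^~ x) x) (RnT : forall n x, Rn n (T x) = T (Rn n x))
  (Pn_lin : forall n, real_linear (Pn n)) (CP0 : forall n, 0 <= CP n)
  (Pn_le : forall n, bounded_by (Pn n) (CP n)) (PnT : forall n x, Pn n (T x) = Rn n x)
  (Pn_sigma : forall n x y, dot (Pn n x) (T (Rn n y)) = sigma (Rn n x) (Rn n y))
  (Ms0 : 0 <= Ms) (sigma_le : forall x y, sigma x y <= Ms * hn x * hn y)
  (cs0 : 0 < cs) (sigma_c : forall x, cs * hn x ^+ 2 <= sigma x x)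
  (K_ge0 : forall x, 0 <= dot (T (T x)) x)
  (K_def : forall x, dot (T (T x)) x = 0 -> x = 0)
  (T_dense : forall z e, 0 < e -> exists y, hn (z - T y) <= e).
Implicit Types (f g h u : R -> E) (x y z : E).

(* h stands for S u, where S = (T T)^-1, so that u = T (T h) solves
   u' + S u = f with u 0 = T z. *)
Definition sol z f h := exists2 u, primitive tau (T z) (fun t => f t - h t) u &
  {ae mu, forall t, D t -> T (T (h t)) = u t}.

(** The constant of Young's inequality 2 Ms |f| |h| <= cs |h|^2 + kappa |f|^2. *)
Let kappa := Ms ^+ 2 / cs.
Let kappa0 : 0 <= kappa. Proof. by rewrite divr_ge0 ?sqr_ge0// ltW. Qed.

Lemma primitive_map (A : E -> E) C x g u : real_linear A -> 0 <= C -> bounded_by A C ->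
  primitive tau x g u -> primitive tau (A x) (fun t => A (g t)) (fun t => A (u t)).
Proof.
move=> Al C0 AC gu t tt y; have [B AB] := adjoint_exists Al C0 AC.
by rewrite !AB gu//; congr (_ + _); apply: eq_Rintegral => s _; rewrite AB.
Qed.

Lemma primitive_add x y f g u v : bint tau f -> bint tau g ->
  primitive tau x f u -> primitive tau y g v ->
  primitive tau (x + y) (fun t => f t + g t) (fun t => u t + v t).
Proof.
move=> ib jb fu gv t tt z; have [t0 tl] := andP tt.
have i1 := RIJ (lexx 0) tl (bint_dot z ib); have i2 := RIJ (lexx 0) tl (bint_dot z jb).
rewrite !dotDl fu// gv// addrACA -(RintegralD (mitv _) i1 i2); congr (_ + _).
by apply: eq_Rintegral => s _; rewrite dotDl.
Qed.

Lemma primitive_scale k x f u : bint tau f -> primitive tau x f u ->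
  primitive tau (k *: x) (fun t => k *: f t) (fun t => k *: u t).
Proof.
move=> ib fu t tt z; have [t0 tl] := andP tt.
have i1 := RIJ (lexx 0) tl (bint_dot z ib).
rewrite !dotZl fu// mulrDr -(RintegralZl k (mitv _) i1); congr (_ + _).
by apply: eq_Rintegral => s _; rewrite dotZl.
Qed.

Lemma sol_add z1 z2 f1 f2 h1 h2 : sqint f1 -> sqint f2 -> sqint h1 -> sqint h2 ->
  sol z1 f1 h1 -> sol z2 f2 h2 ->
  sol (z1 + z2) (fun t => f1 t + f2 t) (fun t => h1 t + h2 t).
Proof.
move=> if1 if2 ih1 ih2 [u1 p1 k1] [u2 p2 k2]; exists (fun t => u1 t + u2 t).
  have i1 := sqint_bint hsep (sqint_sub hsep if1 ih1).
  have i2 := sqint_bint hsep (sqint_sub hsep if2 ih2).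
  rewrite T_lin.1; have := primitive_add i1 i2 p1 p2.
  congr (primitive _ _ _ _); apply/funext => t.
  by rewrite opprD addrACA.
apply: filterS2 k1 k2 => t /= H1 H2 Dt.
by rewrite !T_lin.1 H1// H2.
Qed.

Lemma sol_scale k z f h : sqint f -> sqint h -> sol z f h ->
  sol (k *: z) (fun t => k *: f t) (fun t => k *: h t).
Proof.
move=> if1 ih1 [u1 p1 k1]; exists (fun t => k *: u1 t).
  have i1 := sqint_bint hsep (sqint_sub hsep if1 ih1).
  rewrite T_lin.2; have := primitive_scale k i1 p1.
  congr (primitive _ _ _ _); apply/funext => t.
  by rewrite scalerBr.
by apply: filterS k1 => t /= H1 Dt; rewrite !T_lin.2 H1.
Qed.

Lemma sol_sub z1 z2 f1 f2 h1 h2 : sqint f1 -> sqint f2 -> sqint h1 -> sqint h2 ->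
  sol z1 f1 h1 -> sol z2 f2 h2 ->
  sol (z1 - z2) (fun t => f1 t - f2 t) (fun t => h1 t - h2 t).
Proof.
move=> if1 if2 ih1 ih2 s1 s2.
have := sol_add if1 (sqint_scale hsep (-1) if2) ih1 (sqint_scale hsep (-1) ih2) s1
  (sol_scale (-1) if2 ih2 s2).
rewrite scaleN1r; congr (sol _ _ _); apply/funext => t; by rewrite scaleN1r.
Qed.

(* Energy identity for P_n u ~ R_n S^(1/2) u: since P_n T = R_n it equals
   T R_n h almost everywhere, and its derivative is P_n (f - h). *)
Let energy_n z f h u n t : sqint f -> sqint h ->
  primitive tau (T z) (fun t => f t - h t) u ->
  {ae mu, forall t, D t -> T (T (h t)) = u t} -> 0 <= t <= tau ->
  hn (Pn n (u t)) ^+ 2 + cs * \int[mu]_(s in I t) hn (Rn n (h s)) ^+ 2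
    <= hn z ^+ 2 + kappa * \int[mu]_(s in I t) hn (f s) ^+ 2.
Proof.
move=> f2 h2 pu ku tt; have [t0 tl] := andP tt.
have i0 := sqint_bint hsep (sqint_sub hsep f2 h2).
have pnu := primitive_map (Pn_lin n) (CP0 n) (Pn_le n) pu.
have ip : bint tau (fun s => Pn n (f s - h s)).
  apply: (sqint_bint hsep).
  exact: (sqint_map hsep (Pn_lin n) (CP0 n) (Pn_le n) (sqint_sub hsep f2 h2)).
have Rh2 := sqint_map hsep (Rn_lin n) ler01 (Rn_le n) h2.
rewrite (energy tau_gt0 hsep ip pnu tt) PnT -addrA.
have hz : hn (Rn n z) ^+ 2 <= hn z ^+ 2.
  by rewrite lerXn2r ?nnegrE ?hn_ge0// -[leRHS]mul1r Rn_le.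
apply: lerD => //.
have i1 : RI (I t) (fun s => 2 * dot (Pn n (f s - h s)) (Pn n (u s))).
  apply: RI_scale => //; apply: (RIJ (lexx 0) tl).
  apply: (RI_dot_bounded hsep ip (primitive_wmeas tau_gt0 ip pnu)) => s Ds.
  exact: (primitive_bounded tau_gt0 ip pnu (in_ge0 Ds)).
have i2 : RI (I t) (fun s => hn (Rn n (h s)) ^+ 2) by exact: (RIJ (lexx 0) tl Rh2.2).
have i3 : RI (I t) (fun s => hn (f s) ^+ 2) by exact: (RIJ (lexx 0) tl f2.2).
rewrite -(RintegralZl cs (mitv _) i2) -(RintegralZl kappa (mitv _) i3).
have i4 := RI_scale (mitv _) cs i2; have i5 := RI_scale (mitv _) kappa i3.
rewrite -(RintegralD (mitv _) i1 i4).
apply: Rintegral_ae_le => //; first exact: RI_add.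
have := ae_subI tl ku; apply: filterS => s /= H /H <-.
rewrite !PnT RnT (rlB (Pn_lin n)) dotBl !Pn_sigma.
have s1 := sigma_le (Rn n (f s)) (Rn n (h s)); have s2 := sigma_c (Rn n (h s)).
have s3 : hn (Rn n (f s)) <= hn (f s) by rewrite -[leRHS]mul1r Rn_le.
have s4 : Ms * hn (Rn n (f s)) * hn (Rn n (h s)) <= Ms * hn (f s) * hn (Rn n (h s)).
  by apply: ler_wpM2r; [exact: hn_ge0|exact: ler_wpM2l].
have s5 : 2 * (Ms * hn (f s) * hn (Rn n (h s))) <=
    kappa * hn (f s) ^+ 2 + cs * hn (Rn n (h s)) ^+ 2.
  have : 0 <= (Ms * hn (f s) - cs * hn (Rn n (h s))) ^+ 2 / cs.
    by rewrite divr_ge0 ?sqr_ge0// ltW.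
  have -> : (Ms * hn (f s) - cs * hn (Rn n (h s))) ^+ 2 / cs =
     kappa * hn (f s) ^+ 2 + cs * hn (Rn n (h s)) ^+ 2 - 2 * (Ms * hn (f s) * hn (Rn n (h s))).
    by rewrite /kappa; field; rewrite gt_eqF.
  by rewrite subr_ge0.
by lra.
Qed.

Let Rn_int_cvg h t : sqint h -> 0 <= t <= tau ->
  \int[mu]_(s in I t) hn (Rn n (h s)) ^+ 2 @[n --> \oo] --> \int[mu]_(s in I t) hn (h s) ^+ 2.
Proof.
move=> h2 tt; have [t0 tl] := andP tt.
have [||||_ //] := @RI_dominated _ _ R mu (I t) (mitv _)
  (fun n s => hn (Rn n (h s)) ^+ 2) (fun s => hn (h s) ^+ 2) (fun s => hn (h s) ^+ 2).
- move=> n; apply: wmeas_sqr_hn => //.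
  apply: (wmeas_subset (mitv _) (subJ (lexx 0) tl)).
  exact: (wmeas_map (Rn_lin n) ler01 (Rn_le n) h2.1).
- exact: (RIJ (lexx 0) tl h2.2).
- move=> s _; have H := hcvg_hn (Rn_cvg (h s)).
  by rewrite expr2; under eq_fun do rewrite expr2; exact: cvgM.
- move=> n s _; rewrite ger0_norm ?sqr_ge0//.
  by rewrite lerXn2r ?nnegrE ?hn_ge0// -[leRHS]mul1r Rn_le.
Qed.

Lemma apriori z f h t : sqint f -> sqint h -> sol z f h -> 0 <= t <= tau ->
  cs * \int[mu]_(s in I t) hn (h s) ^+ 2 <=
    hn z ^+ 2 + kappa * \int[mu]_(s in I t) hn (f s) ^+ 2.
Proof.
move=> f2 h2 [u pu ku] tt.
have cv : cs * \int[mu]_(s in I t) hn (Rn n (h s)) ^+ 2 @[n --> \oo] -->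
    cs * \int[mu]_(s in I t) hn (h s) ^+ 2 by apply: cvgMr; exact: Rn_int_cvg.
apply: (cvgr_to_le cv); apply: nearW => n.
apply: le_trans (energy_n n f2 h2 pu ku tt).
by rewrite lerDr sqr_ge0.
Qed.

(** The other half of the energy estimate: the integral is dropped instead of the endpoint term, and
    T h = S^(1/2) u almost everywhere. The bound at time t involves the data up to t only, which is
    what makes a perturbation of the order of S^(1/2) a Volterra perturbation. *)
Lemma apriori_sup z f h : sqint f -> sqint h -> sol z f h ->
  {ae mu, forall t, D t -> hn (T (h t)) ^+ 2 <=
    hn z ^+ 2 + kappa * \int[mu]_(s in I t) hn (f s) ^+ 2}.
Proof.
move=> f2 h2 [u pu ku]; apply: filterS (ku) => t /= H Dt; have tt := in_ge0 Dt.
have cv : hn (Pn n (u t)) ^+ 2 @[n --> \oo] --> hn (T (h t)) ^+ 2.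
  rewrite -H//; under eq_fun do rewrite PnT.
  have H2 := hcvg_hn (Rn_cvg (T (h t))).
  by rewrite expr2; under eq_fun do rewrite expr2; exact: cvgM.
apply: (cvgr_to_le cv); apply: nearW => n.
apply: le_trans (energy_n n f2 h2 pu ku tt).
rewrite lerDl mulr_ge0 ?(ltW cs0)//.
by apply: Rintegral_ge0 => s _; exact: sqr_ge0.
Qed.

(** L2 convergence moves the primitives at each t, along the whole sequence; the relation T T h = u
    is pointwise and needs the subsequence [psi] converging almost everywhere. *)
Lemma sol_closed (F H : nat -> R -> E) (Z : nat -> E) f h z psi :
  (forall n, sqint (F n)) -> (forall n, sqint (H n)) -> sqint f -> sqint h ->
  (forall n, sol (Z n) (F n) (H n)) -> N2cvg F f -> N2cvg H h -> hcvg Z z ->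
  (forall k, (k <= psi k)%N) ->
  {ae mu, forall t, D t -> hcvg (fun k => H (psi k) t) (h t)} -> sol z f h.
Proof.
move=> F2 H2 f2 h2 sFH Ff Hh Zz kpsi Hae.
have [u uP] := primitive_exists (T z) (sqint_bint hsep (sqint_sub hsep f2 h2)).
exists u => //.
have /choice[U UP] : forall n, exists u, primitive tau (T (Z n)) (fun t => F n t - H n t) u /\
   {ae mu, forall t, D t -> T (T (H n t)) = u t}.
  by move=> n; have [v v1 v2] := sFH n; exists v.
have : {ae mu, forall t n, D t -> T (T (H n t)) = U n t}.
  by apply: ae_foralln => n; exact: (UP n).2.
apply: filterS2 Hae => t /= Hh1 HU Dt; have tt := in_ge0 Dt; have [t0 tl] := andP tt.
apply: dot_ext => y.
have psicvg (a : nat -> R) (l : R) : a n @[n --> \oo] --> l -> a (psi k) @[k --> \oo] --> l.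
  move=> /cvgrPdist_le al; apply/cvgrPdist_le => e /al[N _ HN].
  by exists N => // n Nn; apply: HN; exact: leq_trans (kpsi n).
have c1 : dot (T (T (H (psi k) t))) y @[k --> \oo] --> dot (T (T (h t))) y.
  apply: hcvg_dot; apply: (bounded_cvg T_lin T_le); apply: (bounded_cvg T_lin T_le).
  exact: Hh1.
have FH2 n := sqint_sub hsep (F2 n) (H2 n).
have fh2 := sqint_sub hsep f2 h2.
have FHcvg : N2cvg (fun n t => F n t - H n t) (fun t => f t - h t).
  move=> e e0; have e4 : 0 < e / 4 by rewrite divr_gt0.
  have [N1 H1] := Ff _ e4; have [N2' H2'] := Hh _ e4.
  exists (maxn N1 N2') => n; rewrite geq_max => /andP[n1 n2].
  have -> : (fun t => F n t - H n t - (f t - h t)) =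
     (fun t => (F n t - f t) + -1 *: (H n t - h t)).
    apply/funext => s; rewrite scaleN1r !opprB addrACA [RHS]addrACA; congr (_ + _).
    by rewrite addrC.
  have d1 := sqint_sub hsep (F2 n) f2; have d2 := sqint_sub hsep (H2 n) h2.
  rewrite (le_trans (N2_add hsep d1 (sqint_scale hsep (-1) d2)))//.
  rewrite N2_scale// sqrrN expr1n mul1r.
  by have := H1 n n1; have := H2' n n2; lra.
have c2 : dot (U (psi k) t) y @[k --> \oo] --> dot (u t) y.
  rewrite uP//; apply: (psicvg (fun n => dot (U n t) y)).
  under eq_fun do rewrite (UP _).1//.
  have c3 : dot (T (Z n)) y @[n --> \oo] --> dot (T z) y.
    by apply: hcvg_dot; apply: (bounded_cvg T_lin T_le).
  exact: (cvgD c3 (N2cvg_prim tau_gt0 hsep (y := y) FH2 fh2 FHcvg tt)).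
apply: cvg_uniqR c1 _.
by under eq_fun do rewrite HU//.
Qed.

(** By linearity [apriori] applies to differences of solutions, so convergence of the data forces
    the sequence [H] to be Cauchy in L2. *)
Lemma sol_stable (F H : nat -> R -> E) (Z : nat -> E) f z :
  (forall n, sqint (F n)) -> (forall n, sqint (H n)) -> sqint f ->
  (forall n, sol (Z n) (F n) (H n)) -> N2cvg F f -> hcvg Z z ->
  exists2 h, sqint h & sol z f h.
Proof.
move=> F2 H2 f2 sFH Ff Zz.
have Hc e : 0 < e -> exists N, forall m n, (N <= m)%N -> (N <= n)%N ->
     N2 (fun t => H m t - H n t) <= e.
  move=> e0; have ke : 0 < cs * e / (8 * kappa + 1).
    by rewrite divr_gt0 ?mulr_gt0// ltr_wpDl// mulr_ge0.
  have ze : 0 < Num.sqrt (cs * e / 8) by rewrite sqrtr_gt0 divr_gt0 ?mulr_gt0.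
  have [N1 H1] := Ff _ ke; have [N2' H2'] := (hcvgP _ _).1 Zz _ ze.
  exists (maxn N1 N2') => m n; rewrite !geq_max => /andP[m1 m2] /andP[n1 n2].
  have tt : 0 <= tau <= tau by rewrite ltW//= lexx.
  have := apriori (sqint_sub hsep (F2 m) (F2 n)) (sqint_sub hsep (H2 m) (H2 n))
    (sol_sub (F2 m) (F2 n) (H2 m) (H2 n) (sFH m) (sFH n)) tt.
  rewrite -/(N2 _) -/(N2 _) => ap.
  have a1 := N2_triangle hsep (F2 m) (F2 n) f2; rewrite (N2_subC tau f) in a1.
  have a2 := H1 m m1; have a3 := H1 n n1.
  have a4 : kappa * N2 (fun t => F m t - F n t) <= cs * e / 2.
    rewrite (@le_trans _ _ (kappa * (4 * (cs * e / (8 * kappa + 1)))))//.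
      by apply: ler_wpM2l => //; lra.
    have q1 : 0 < 8 * kappa + 1 by rewrite ltr_wpDl// mulr_ge0.
    have -> : kappa * (4 * (cs * e / (8 * kappa + 1))) =
      (4 * kappa * (cs * e)) / (8 * kappa + 1) by ring.
    rewrite ler_pdivrMr//.
    have : 0 <= cs * e by rewrite mulr_ge0// ltW.
    by move: (cs * e) => q q0; lra.
  have a5 : hn (Z m - Z n) ^+ 2 <= cs * e / 2.
    have h1 := H2' m m2; have h2 := H2' n n2.
    have h3 := hn_triangle z (Z m) (Z n); rewrite (hnB z) in h3.
    have h4 : hn (Z m - Z n) <= 2 * Num.sqrt (cs * e / 8) by lra.
    rewrite (@le_trans _ _ ((2 * Num.sqrt (cs * e / 8)) ^+ 2))//.
      by rewrite lerXn2r ?nnegrE ?hn_ge0 ?mulr_ge0 ?sqrtr_ge0.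
    rewrite exprMn sqr_sqrtr ?divr_ge0 ?mulr_ge0 ?(ltW cs0) ?(ltW e0)//.
    by rewrite le_eqVlt; apply/orP; left; apply/eqP; field.
  rewrite -(ler_pM2l cs0); lra.
have [h [psi [h2 kpsi Hae Hh]]] := riesz_fischer hsep H2 Hc.
by exists h => //; exact: sol_closed Hae.
Qed.

Lemma N2cvg_cst f g : N2 (fun t => f t - g t) <= 0 -> N2cvg (fun=> f) g.
Proof. by move=> fg e e0; exists 0%N => _ _; rewrite (le_trans fg)// ltW. Qed.

Let hcvg_cst z : hcvg (fun=> z) z.
Proof. by apply/hcvgP => e e0; exists 0%N => _ _; rewrite subrr hn0 ltW. Qed.


Let mu_I (t : R) : 0 <= t -> fine (mu (I t)) = t.
Proof.
move=> t0; have [t1|t1] := ltP 0 t.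
  by rewrite lebesgue_measure_itv/= lte_fin t1 -EFinB/= subr0.
by rewrite lebesgue_measure_itv/= lte_fin ltNge t1/=; apply/eqP; rewrite eq_le t0 t1.
Qed.

Let integral_indic_I (s t c : R) : 0 <= s <= tau -> 0 <= t <= tau ->
  \int[mu]_(r in I t) (\1_(I s) r * c) = Num.min t s * c.
Proof.
move=> /andP[s0 sl] /andP[t0 tl]; have m0 : 0 <= Num.min t s by rewrite le_min t0.
have ii : RI (I t) (fun r => \1_(I s) r : R).
  apply: (@RI_bounded _ _ _ mu (I t) (mitv _) 1 (fun r => \1_(I s) r : R)); first exact: mu_itv_fin.
    by apply: measurable_funTS; exact: measurable_indic.
  by move=> r _; rewrite indicE; case: (_ \in _); rewrite ?normr1 ?normr0.
under eq_Rintegral do rewrite mulrC.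
rewrite (RintegralZl _ (mitv _) ii) mulrC; congr (_ * _).
rewrite /Rintegral integral_indic//.
have -> : I s `&` I t = I (Num.min t s).
  apply/seteqP; split => r /=; rewrite !in_itv/= le_min.
    by move=> [/andP[-> ->] /andP[_ ->]].
  by move=> /and3P[-> -> ->].
exact: mu_I.
Qed.

Let ramp (s : R) y : 0 <= s <= tau ->
  primitive tau 0 (fun t => (\1_(I s) t : R) *: y) (fun t => Num.min t s *: y).
Proof.
move=> ss t tt x; rewrite dot0l add0r dotZl.
by under eq_Rintegral do rewrite dotZl; rewrite integral_indic_I.
Qed.

Let ramp_sqint (s : R) y : sqint (fun t => (\1_(I s) t : R) *: y).
Proof.
apply: (@sqint_bounded _ _ _ hsep _ (hn y)).
  by apply: wmeas_indic => //; exact: wmeas_cst.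
move=> t _; rewrite hnZ indicE.
by case: (_ \in _); rewrite ?normr1 ?normr0 ?mul1r// mul0r hn_ge0.
Qed.

Let ramp_sqint' (s : R) y : 0 <= s <= tau -> sqint (fun t => Num.min t s *: y).
Proof.
move=> ss; have i1 := sqint_bint hsep (ramp_sqint s y).
apply: (@sqint_bounded _ _ _ hsep _ (tau * hn y)).
  exact: (primitive_wmeas tau_gt0 i1 (ramp y ss)).
move=> t /in_ge0/andP[t0 tt]; rewrite hnZ; apply: ler_wpM2r; first exact: hn_ge0.
have /andP[s0 sl] := ss.
by rewrite ger0_norm ?le_min ?t0// ge_min tt.
Qed.

Let solvable f := sqint f /\ exists2 h, sqint h & sol 0 f h.

Let N2_subrr f : N2 (fun t => f t - f t) = 0.
Proof.
have z : N2 (fun=> 0) = 0 := N2_0 _ _.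
by rewrite -[RHS](z E); congr N2; apply/funext => t; rewrite subrr.
Qed.

Let solvable0 : solvable (fun=> 0).
Proof.
have z2 := sqint_cst tau hsep 0.
split=> //; exists (fun=> 0) => //; exists (fun=> 0).
  move=> t tt y; rewrite (rl0 T_lin) dot0l add0r.
  by under eq_Rintegral do rewrite subrr dot0l; rewrite Rintegral_cst// mul0r.
by apply: nearW => t _; rewrite !(rl0 T_lin).
Qed.

Let solvable_add f g : solvable f -> solvable g -> solvable (fun t => f t + g t).
Proof.
move=> [f2 [h h2 s1]] [g2 [k k2 s2]]; split; first exact: sqint_add.
exists (fun t => h t + k t); first exact: sqint_add.
by have := sol_add f2 g2 h2 k2 s1 s2; rewrite addr0.
Qed.

Let solvable_scale c f : solvable f -> solvable (fun t => c *: f t).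
Proof.
move=> [f2 [h h2 s1]]; split; first exact: sqint_scale.
exists (fun t => c *: h t); first exact: sqint_scale.
by have := sol_scale c f2 h2 s1; rewrite scaler0.
Qed.

(** Explicit solutions: for u = min(., s) K y with K = T T one has S u = min(., s) y, and u' is K y
    up to time s and 0 later. *)
Let solvable_test (s : R) y : 0 <= s <= tau ->
  solvable (fun t => (\1_(I s) t : R) *: T (T y) + Num.min t s *: y).
Proof.
move=> ss; split.
  exact: (sqint_add hsep (ramp_sqint s (T (T y))) (ramp_sqint' y ss)).
exists (fun t => Num.min t s *: y); first exact: ramp_sqint'.
exists (fun t => Num.min t s *: T (T y)).
  rewrite (rl0 T_lin); have := ramp (T (T y)) ss; congr (primitive _ _ _ _).
  by apply/funext => t; rewrite addrK.
by apply: nearW => t _; rewrite !T_lin.2.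
Qed.

(* A datum orthogonal to all solvable ones vanishes: testing against the data
   of u = min(.,s) K y, K = T T, gives K g = - G with G the primitive of g
   vanishing at tau, whence int (K g, g) <= 0. *)
Let orthogonal_solvable g : sqint g ->
  (forall w, solvable w -> \int[mu]_(t in D) dot (g t) (w t) = 0) -> N2 g = 0.
Proof.
move=> g2 gw; have ig := sqint_bint hsep g2; have tt0 : 0 <= tau <= tau by rewrite lexx ltW.
have [G GP] := primitive_exists 0 ig.
have g2' := sqint_scale hsep (-1) g2; have ig' := sqint_bint hsep g2'.
have GP' := primitive_scale (-1) ig GP; rewrite scaler0 in GP'.
(* [Ga t] is the integral of g over [t, tau]; its vanishing at tau removes the boundary term of the
   product rule. *)
pose Ga t := G tau - G t.
have GaP : primitive tau (G tau) (fun t => -1 *: g t) Ga.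
  move=> t tt y; rewrite /Ga dotBl; have := GP' t tt y.
  by rewrite scaleN1r dotNl dot0l add0r => <-.
have Gab t : D t -> hn (Ga t) <= hn (G tau) + \int[mu]_(s in D) hn (-1 *: g s).
  by move=> Dt; exact: (primitive_bounded tau_gt0 ig' GaP (in_ge0 Dt)).
have mGa := primitive_wmeas tau_gt0 ig' GaP.
have Ga2 := sqint_bounded hsep mGa Gab.
have Gatau : Ga tau = 0 by rewrite /Ga subrr.
have c2 y : sqint (fun=> y) := sqint_cst tau hsep y.
have i1 y : RI D (fun t => dot (g t) (T (T y)) + dot (Ga t) y).
  by apply: RI_add => //; exact: sqint_dot.
have key y s : 0 <= s <= tau -> \int[mu]_(t in I s) (dot (g t) (T (T y)) + dot (Ga t) y) = 0.
  move=> ss; have is_ := sqint_bint hsep (ramp_sqint s y).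
  have := product_rule tau_gt0 hsep ig' is_ GaP (ramp y ss) tt0.
  have i2 := product_rule_RI tau_gt0 hsep ig' is_ GaP (ramp y ss).
  rewrite Gatau dot0l dot0r add0r => pr.
  have sw := solvable_test y ss; have gw0 := gw _ sw.
  have := congr2 +%R gw0 (esym pr); rewrite addr0.
  rewrite -(RintegralD (mitv _) (sqint_dot hsep g2 sw.1) i2) => Z; rewrite -[RHS]Z.
  rewrite Rintegral_mkcond [RHS]Rintegral_mkcond; apply: eq_Rintegral => t _.
  rewrite !patchE; have [ts|ts] := boolP (t \in I s).
    have -> : t \in D.
      by move: ts; rewrite !inE; apply: subJ => //; case/andP: ss.
    rewrite indicE ts !scale1r !dotDr !dotZr scaleN1r dotNl; ring.
  case: ifP => // _; rewrite indicE (negbTE ts) !scale0r add0r dot0r addr0.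
  rewrite dotZr dotZr scaleN1r dotNl mulrN subrr; by [].
have [e eP] := hsep.
(* The exceptional null set depends on y. A single one is obtained along a dense sequence, from
   which the identity passes by continuity to the vector y = g t. *)
have zero_ae : {ae mu, forall t n, D t -> dot (g t) (T (T (e n))) + dot (Ga t) (e n) = 0}.
  apply: ae_foralln => n; exact: (ae_zero_of_primitive tau_gt0 (i1 (e n)) (key (e n))).
have gGa : {ae mu, forall t, D t -> dot (T (T (g t))) (g t) = - dot (g t) (Ga t)}.
  apply: filterS zero_ae => t /= H Dt.
  have /choice[en enP] : forall k : nat, exists i, hn (g t - e i) <= k.+1%:R^-1.
    by move=> k; have [|i Hi] := eP (g t) k.+1%:R^-1; [rewrite invr_gt0|exists i].
  have ecv : hcvg (fun k => e (en k)) (g t).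
    apply/hcvgP => eps eps0; have [N HN] := invn_small eps0.
    by exists N => n Nn; rewrite hnB (le_trans (enP n))// HN.
  have c1 := hcvg_dot (y := g t) (bounded_cvg T_lin T_le (bounded_cvg T_lin T_le ecv)).
  have c3 := hcvg_dot (y := Ga t) ecv.
  rewrite (dotC (T _)); rewrite (dotC (g t) (Ga t)).
  apply: (cvg_uniqR (u := fun k => dot (g t) (T (T (e (en k)))))).
    by under eq_fun do rewrite dotC; rewrite (dotC (g t)).
  have -> : (fun k => dot (g t) (T (T (e (en k))))) = (fun k => - dot (e (en k)) (Ga t)).
    apply/funext => k; have := H (en k) Dt.
    by rewrite (dotC (Ga t)) => /eqP; rewrite addr_eq0 => /eqP.
  by rewrite (dotC (Ga t)); exact: cvgN.
have Kg2 := sqint_map hsep T_lin CT0 T_le (sqint_map hsep T_lin CT0 T_le g2).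
have iK := sqint_dot hsep Kg2 g2; have iG := sqint_dot hsep g2 Ga2.
have K0 : \int[mu]_(t in D) dot (T (T (g t))) (g t) <= 0.
  rewrite (Rintegral_ae_eq (mitv _) iK (RI_scale (mitv _) (-1) iG)); last first.
    by apply: filterS gGa => t /= H Dt; rewrite H// mulN1r.
  (* The energy identity for [Ga] on [0, tau] gives - int (g, Ga) = - |G tau|^2 / 2. *)
  have := energy tau_gt0 hsep ig' GaP tt0; rewrite Gatau hn0 expr0n/= => en0.
  have ->: \int[mu]_(t in D) (-1 * dot (g t) (Ga t)) =
      2^-1 * \int[mu]_(s in D) (2 * dot (-1 *: g s) (Ga s)).
    rewrite -(RintegralZl _ (mitv _)); last first.
      by apply: RI_scale => //; exact: (sqint_dot hsep g2' Ga2).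
    by apply: eq_Rintegral => t _; rewrite dotZl; field.
  by have := sqr_ge0 (hn (G tau)); lra.
have gz : {ae mu, forall t, D t -> g t = 0}.
  apply: filterS (ge0_Rintegral_eq0 (mitv _) iK (fun t _ => K_ge0 (g t)) K0) => t /= H Dt.
  exact/K_def/H.
by rewrite (N2_ae g2 (sqint_cst tau hsep 0) gz) N2_0.
Qed.

(** Least squares in L2: best approximations of f by solvable data converge to some p, solvable by
    [sol_stable], and p - f is orthogonal to all solvable data. Functions are not taken modulo null
    sets; the minimization only asks for a semi-definite form. *)
Lemma sol_auto0 f : sqint f -> exists2 h, sqint h & sol 0 f h.
Proof.
move=> f2; have tt0 : 0 <= tau <= tau by rewrite lexx ltW.
pose q (F G : R -> E) := \int[mu]_(t in D) dot (F t) (G t).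
have qN F : q F F = N2 F by apply: eq_Rintegral => t _; rewrite sqr_hn.
have [||||||||||v [Pv vc vl]] := @quadratic_minimization R (R -> E) [set F | solvable F] q (q f) (N2 f).
- exact: solvable0.
- by move=> F G; exact: solvable_add.
- by move=> c F; exact: solvable_scale.
- by move=> F G _ _; apply: eq_Rintegral => t _; rewrite dotC.
- move=> F G K [F2 _] [G2 _] [K2 _].
  rewrite /q -(RintegralD (mitv _) (sqint_dot hsep F2 K2) (sqint_dot hsep G2 K2)).
  by apply: eq_Rintegral => t _; rewrite dotDl.
- move=> c F G [F2 _] [G2 _]; rewrite /q -(RintegralZl _ (mitv _) (sqint_dot hsep F2 G2)).
  by apply: eq_Rintegral => t _; rewrite dotZl.
- by move=> F _; rewrite qN; exact: N2_ge0.
- move=> F G [F2 _] [G2 _].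
  rewrite /q -(RintegralD (mitv _) (sqint_dot hsep f2 F2) (sqint_dot hsep f2 G2)).
  by apply: eq_Rintegral => t _; rewrite dotDr.
- move=> c F [F2 _]; rewrite /q -(RintegralZl _ (mitv _) (sqint_dot hsep f2 F2)).
  by apply: eq_Rintegral => t _; rewrite dotZr.
- by move=> F [F2 _]; rewrite qN; exact: integral_cauchy_schwarz.
have v2 n : sqint (v n) := (Pv n).1.
have vc' e : 0 < e -> exists N, forall m n, (N <= m)%N -> (N <= n)%N ->
    N2 (fun t => v m t - v n t) <= e.
  by move=> /vc[N HN]; exists N => m n Nm Nn; rewrite -qN; exact: HN.
have [p [psi [p2 _ _ vp]]] := riesz_fischer hsep v2 vc'.
have /choice[H HP] : forall n, exists h, sqint h /\ sol 0 (v n) h.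
  by move=> n; have [_ [h h2 sh]] := Pv n; exists h.
have [h h2 sh] := sol_stable v2 (fun n => (HP n).1) p2 (fun n => (HP n).2) vp (hcvg_cst 0).
have fp2 := sqint_sub hsep p2 f2.
have pf : N2 (fun t => p t - f t) = 0.
  apply: orthogonal_solvable => // w Pw; have w2 := Pw.1.
  have -> : \int[mu]_(t in D) dot (p t - f t) (w t) = q p w - q f w.
    rewrite /q -(RintegralB (mitv _) (sqint_dot hsep p2 w2) (sqint_dot hsep f2 w2)).
    by apply: eq_Rintegral => t _; rewrite dotBl.
  apply/eqP; rewrite subr_eq0; apply/eqP.
  apply: (cvg_uniqR _ (vl w Pw)).
  apply/cvgrPdist_le => e e0; have C0 : 0 < N2 w + 1 by rewrite ltr_wpDl// N2_ge0.
  have [N HN] := vp _ (divr_gt0 (exprn_gt0 2 e0) C0); exists N => // n /= /HN.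
  rewrite ler_pdivlMr// => HN'; rewrite distrC.
  rewrite -(ler_pXn2r (n:=2)) ?nnegrE ?(ltW e0)// real_normK ?num_real//.
  have -> : q (v n) w - q p w = \int[mu]_(t in D) dot (v n t - p t) (w t).
    rewrite /q -(RintegralB (mitv _) (sqint_dot hsep (v2 n) w2) (sqint_dot hsep p2 w2)).
    by apply: eq_Rintegral => t _; rewrite dotBl.
  apply: (le_trans (integral_cauchy_schwarz hsep (sqint_sub hsep (v2 n) p2) w2)).
  apply: le_trans HN'; apply: ler_wpM2l; first exact: N2_ge0.
  by rewrite lerDl.
(* Constant sequences: stability replaces p by f, at L2 distance zero from it. *)
apply: (sol_stable (F := fun=> p) (H := fun=> h) (Z := fun=> 0)) => //.
  by apply: N2cvg_cst; rewrite pf.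
Qed.

(** When z = T y the initial value is T T y, on which S takes the value y; adding this constant
    function reduces to zero initial value with datum f - y. Density of the range of [T] and
    [sol_stable] give every z. *)
Lemma sol_auto z f : sqint f -> exists2 h, sqint h & sol z f h.
Proof.
move=> f2.
have c2 y : sqint (fun=> y) := sqint_cst tau hsep y.
have regular y : exists2 h, sqint h & sol (T y) f h.
  have [h h2 [u pu ku]] := sol_auto0 (sqint_sub hsep f2 (c2 y)).
  exists (fun t => h t + y); first exact: sqint_add.
  exists (fun t => u t + T (T y)).
    move=> t tt x; rewrite dotDl pu// (rl0 T_lin) dot0l add0r addrC; congr (_ + _).
    by apply: eq_Rintegral => s _; rewrite opprD addrA addrAC.
  by apply: filterS ku => t /= H Dt; rewrite !T_lin.1 H.
have /choice[y yP] : forall n : nat, exists y, hn (z - T y) <= n.+1%:R^-1.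
  by move=> n; apply: T_dense; rewrite invr_gt0.
have /choice[H HP] : forall n, exists h, sqint h /\ sol (T (y n)) f h.
  by move=> n; have [h h1 h2] := regular (y n); exists h.
apply: (sol_stable (F := fun=> f) (H := H) (Z := fun n => T (y n))) => //.
- by move=> n; exact: (HP n).1.
- by move=> n; exact: (HP n).2.
- by apply: N2cvg_cst; rewrite N2_subrr.
- apply/hcvgP => e e0; have [N HN] := invn_small e0.
  by exists N => n Nn; rewrite hnB (le_trans (yP n))// HN.
Qed.

(** The triangle inequality for [N2] costs a factor 2 at each stage, which the ratio 1/4
    compensates: 2 (4 B / 4) + 2 B = 4 B. *)
Lemma N2_geo (F : nat -> R -> E) (B : R) : 0 <= B -> (forall n, sqint (F n)) ->
  (forall k, N2 (fun t => F k.+1 t - F k t) <= B * 4^-1 ^+ k) ->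
  forall m p, N2 (fun t => F (m + p)%N t - F m t) <= 4 * B * 4^-1 ^+ m.
Proof.
move=> B0 F2 FB m p; elim: p m => [|p IH] m.
  rewrite addn0 N2_subrr.
  by rewrite mulr_ge0 ?mulr_ge0// exprn_ge0// invr_ge0.
have := N2_triangle hsep (F2 (m + p.+1)%N) (F2 m) (F2 m.+1).
have := IH m.+1; rewrite addSnnS exprS; have := FB m.
by move: (4^-1 ^+ m) => q; lra.
Qed.

Lemma cauchy_of_geo (F : nat -> R -> E) (B : R) : 0 <= B -> (forall n, sqint (F n)) ->
  (forall k, N2 (fun t => F k.+1 t - F k t) <= B * 4^-1 ^+ k) ->
  forall e : R, 0 < e -> exists N, forall m n, (N <= m)%N -> (N <= n)%N ->
     N2 (fun t => F m t - F n t) <= e.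
Proof.
move=> B0 F2 FB e e0.
have [N HN] := invn_small (divr_gt0 e0 (ltr_wpDl (mulr_ge0 (ler0n R 4) B0) ltr01)).
have small m : (N <= m)%N -> 4 * B * 4^-1 ^+ m <= e.
  move=> /HN Hm; have q0 : 0 < 4 * B + 1 by rewrite ltr_wpDl ?mulr_ge0.
  have pw : (4^-1 : R) ^+ m <= m.+1%:R^-1.
    rewrite exprVn lef_pV2 ?posrE ?exprn_gt0// -natrX ler_nat.
    exact: ltn_expl.
  have := le_trans pw Hm; rewrite ler_pdivlMr// => H.
  rewrite mulrC; apply: le_trans H; apply: ler_wpM2l; last by rewrite lerDl.
  by rewrite exprn_ge0// invr_ge0.
exists N => m n Nm Nn; wlog mn : m n Nm Nn / (m <= n)%N.
  by move=> H; have [/H->//|/ltnW/H H'] := leqP m n; rewrite N2_subC H'.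
rewrite N2_subC -(subnKC mn) (le_trans (N2_geo B0 F2 FB _ _))//; exact: small.
Qed.

(** * Perturbation by operators of the order of the square root *)

Section Perturbation.
Variables (C : R -> E -> E) (C0 : R).
Hypotheses (C0_ge0 : 0 <= C0) (C_lin : forall t, D t -> real_linear (C t))
  (C_le : forall t, D t -> bounded_by (C t) C0)
  (C_meas : forall x, wmeas D (C^~ x)).
Local Notation CTo h := (fun t => C t (T (h t))).

Lemma hn_CT h t : D t -> hn (C t (T (h t))) ^+ 2 <= C0 ^+ 2 * hn (T (h t)) ^+ 2.
Proof.
move=> Dt; rewrite -exprMn lerXn2r ?nnegrE ?mulr_ge0 ?hn_ge0//; exact: C_le.
Qed.

Lemma hn_T2 x : hn (T x) ^+ 2 <= CT ^+ 2 * hn x ^+ 2.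
Proof. rewrite -exprMn lerXn2r ?nnegrE ?mulr_ge0 ?hn_ge0//; exact: T_le. Qed.

Lemma sqint_CT h : sqint h -> sqint (CTo h).
Proof.
move=> h2; have Th2 := sqint_map hsep T_lin CT0 T_le h2.
apply: (sqint_le hsep _ (RI_scale (mitv _) (C0 ^+ 2) Th2.2)).
  exact: (wmeas_operator hsep C_lin C_le C_meas Th2.1).
by move=> t Dt; exact: hn_CT.
Qed.

Lemma N2_CT h : sqint h -> N2 (CTo h) <= C0 ^+ 2 * CT ^+ 2 * N2 h.
Proof.
move=> h2; rewrite [in leRHS]/N2 -(RintegralZl _ (mitv _) h2.2).
apply: (N2_le (sqint_CT h2) (RI_scale (mitv _) _ h2.2)) => t Dt.
apply: (le_trans (hn_CT _ Dt)); rewrite -mulrA.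
by apply: ler_wpM2l; [exact: sqr_ge0|exact: hn_T2].
Qed.

Let CTB h k t : D t -> C t (T (h t)) - C t (T (k t)) = C t (T (h t - k t)).
Proof. by move=> Dt; rewrite (rlB T_lin) (rlB (C_lin Dt)). Qed.

(** The Volterra constant of the Picard iteration; the added 1 makes it positive in all cases. *)
Let Cp : R := C0 ^+ 2 * kappa + 1.
Let Cp0 : 0 < Cp. Proof. by rewrite ltr_wpDl// mulr_ge0// sqr_ge0. Qed.

Lemma picard_step z f g h k : sqint f -> sqint g -> sqint h -> sqint k ->
  sol z f h -> sol z g k ->
  {ae mu, forall t, D t -> hn (C t (T (h t)) - C t (T (k t))) ^+ 2 <=
     Cp * \int[mu]_(s in I t) hn (f s - g s) ^+ 2}.
Proof.
move=> f2 g2 h2 k2 sh sk.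
have := apriori_sup (sqint_sub hsep f2 g2) (sqint_sub hsep h2 k2)
  (sol_sub f2 g2 h2 k2 sh sk).
apply: filterS => t /= H Dt; rewrite (CTB _ _ Dt).
apply: (le_trans (hn_CT (fun s => h s - k s) Dt)).
have := H Dt; rewrite subrr hn0 expr0n/= add0r => H1.
apply: (le_trans (ler_wpM2l (sqr_ge0 C0) H1)); rewrite /Cp mulrA mulrDl mul1r lerDl.
by apply: Rintegral_ge0 => s _; exact: sqr_ge0.
Qed.

(** Each iterate solves the autonomous problem with the perturbation evaluated at the previous one.
    The increments of the data are followed: the integrals Z k of their squares satisfy Z (k+1) <=
    Cp int Z k, hence decay like 4^-k without any smallness of tau or C0. *)
Lemma sol_exists z f : sqint f ->
  exists2 h, sqint h & sol z (fun t => f t - C t (T (h t))) h.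
Proof.
move=> f2; have tt0 : 0 <= tau <= tau by rewrite lexx ltW.
have /choice[Phi PhiP] : forall h, exists k, sqint h ->
    sqint k /\ sol z (fun t => f t - C t (T (h t))) k.
  move=> h; have [h2|?] := pselect (sqint h); last by exists h.
  by have [k k2 sk] := sol_auto z (sqint_sub hsep f2 (sqint_CT h2)); exists k.
pose H k := iter k Phi (fun=> 0).
have H2 k : sqint (H k).
  by elim: k => [|k IH]; [exact: (sqint_cst tau hsep 0)|exact: (PhiP _ IH).1].
have sH k : sol z (fun t => f t - C t (T (H k t))) (H k.+1) := (PhiP _ (H2 k)).2.
pose F k t := f t - C t (T (H k t)).
have F2 k : sqint (F k) by exact: (sqint_sub hsep f2 (sqint_CT (H2 k))).
pose phi k t := F k.+1 t - F k t.
have phi2 k : sqint (phi k) by exact: (sqint_sub hsep).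
pose Z k t := \int[mu]_(s in I t) hn (phi k s) ^+ 2.
have Zi k : RI D (Z k).
  by apply: nondecreasing_integral_RI => //; [exact: (phi2 k).2|move=> s _; exact: sqr_ge0].
have ZS k (t : R) : 0 <= t <= tau -> Z k.+1 t <= 0 + Cp * \int[mu]_(s in I t) Z k s.
  move=> /andP[t0 tt]; rewrite add0r -(RintegralZl _ (mitv _) (RIJ (lexx 0) tt (Zi k))).
  apply: Rintegral_ae_le => //.
  - exact: (RIJ (lexx 0) tt (phi2 k.+1).2).
  - by apply: RI_scale => //; exact: (RIJ (lexx 0) tt (Zi k)).
  have := picard_step (F2 k.+1) (F2 k) (H2 k.+2) (H2 k.+1) (sH k.+1) (sH k).
  move=> /(ae_subI tt); apply: filterS => s /= HH /HH; apply: le_trans.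
  rewrite /phi /F (_ : f s - _ - _ = - (C s (T (H k.+2 s)) - C s (T (H k.+1 s)))) ?hnN//.
  by rewrite !opprB addrC addrA subrK.
have Z0 (t : R) : 0 <= t <= tau -> Z 0%N t <= N2 (phi 0%N).
  move=> /andP[t0 tt]; have ip := (phi2 0%N).2.
  rewrite -subr_ge0 (itv_splitR t0 tt (lexx _) ip).
  by apply: Rintegral_ge0 => s _; exact: sqr_ge0.
pose B := N2 (phi 0%N) * expR (4 * Cp * tau).
have B0 : 0 <= B by rewrite mulr_ge0 ?N2_ge0 ?expR_ge0.
have phiB k : N2 (phi k) <= B * 4^-1 ^+ k.
  have := gronwall_iterate Cp0 (lexx 0) (N2_ge0 tau (phi 0%N)) Zi Z0 ZS k tt0.
  by rewrite mulr0 add0r mulrAC.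
(* [H 0] is not a solution, so increments are compared from [H 1] on. *)
have dB k : N2 (fun t => H k.+2 t - H k.+1 t) <= kappa / cs * B * 4^-1 ^+ k.
  have := apriori (sqint_sub hsep (F2 k.+1) (F2 k)) (sqint_sub hsep (H2 k.+2) (H2 k.+1))
    (sol_sub (F2 k.+1) (F2 k) (H2 k.+2) (H2 k.+1) (sH k.+1) (sH k)) tt0.
  rewrite subrr hn0 expr0n/= add0r -/(N2 _) -/(N2 _) => ap.
  have -> : kappa / cs * B * 4^-1 ^+ k = cs^-1 * (kappa * (B * 4^-1 ^+ k)) by ring.
  rewrite ler_pdivlMl// (le_trans ap)//.
  by apply: ler_wpM2l => //; exact: phiB.
have B1 : 0 <= kappa / cs * B by rewrite mulr_ge0// divr_ge0// ltW.
have c1 := cauchy_of_geo B1 (fun n => H2 n.+1) dB.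
have c2 (e : R) : 0 < e -> exists N, forall m n, (N <= m)%N -> (N <= n)%N ->
     N2 (fun t => H m.+2 t - H n.+2 t) <= e.
  by move=> /c1[N HN]; exists N => m n Nm Nn; apply: HN; exact: leqW.
have [h [psi [h2 kpsi Hae Hh]]] := riesz_fischer hsep (fun n => H2 n.+2) c2.
have H1h : N2cvg (fun n => H n.+1) h.
  move=> e e0; have e4 : 0 < e / 4 by rewrite divr_gt0.
  have [N1 HN1] := Hh _ e4; have [N2' HN2] := c1 _ e4.
  exists (maxn N1 N2') => n; rewrite geq_max => /andP[n1 n2].
  have := N2_triangle hsep (H2 n.+1) h2 (H2 n.+2).
  by have := HN1 n n1; have := HN2 n n.+1 n2 (leqW n2); lra.
exists h => //.
(* [H n.+2] solves the equation with datum [F n.+1], built on [H n.+1]; this is why L2 convergence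
   of both shifts was established. *)
apply: (sol_closed (F := fun n => F n.+1) (H := fun n => H n.+2) (Z := fun=> z)) => //.
- exact: (sqint_sub hsep f2 (sqint_CT h2)).
- by move=> n; exact: (sH n.+1).
- move=> e e0; have q0 : 0 < C0 ^+ 2 * CT ^+ 2 + 1 by rewrite ltr_wpDl// mulr_ge0// sqr_ge0.
  have [N HN] := H1h _ (divr_gt0 e0 q0); exists N => n /HN; rewrite ler_pdivlMr// => Hn.
  have d2 := sqint_sub hsep (H2 n.+1) h2.
  have -> : N2 (fun t => F n.+1 t - (f t - C t (T (h t)))) =
      N2 (CTo (fun t => H n.+1 t - h t)).
    apply: eq_Rintegral => t; rewrite inE => Dt; rewrite -CTB//.
    by rewrite /F -hnN; congr (hn _ ^+ 2); rewrite !opprB addrC addrA subrK.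
  apply: (le_trans (N2_CT d2)); rewrite mulrC; apply: le_trans Hn.
  by apply: ler_wpM2l; [exact: N2_ge0|rewrite lerDl].
Qed.

(** Gronwall's inequality is applied to Z t = int_0^t |T h|^2, not to |T h|^2, which is controlled
    only almost everywhere. Then [apriori] is used with f - C T h as datum. *)
Lemma sol_estimate : exists2 K : R, 0 <= K & forall z f h, sqint f -> sqint h ->
  sol z (fun t => f t - C t (T (h t))) h -> N2 h <= K * (hn z ^+ 2 + N2 f).
Proof.
pose C2 := 2 * C0 ^+ 2 * kappa + 1.
have C20 : 0 < C2 by rewrite ltr_wpDl// mulr_ge0// mulr_ge0// sqr_ge0.
pose ex := 2 * tau * expR (4 * C2 * tau).
have ex0 : 0 <= ex by rewrite mulr_ge0 ?expR_ge0// mulr_ge0// ltW.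
(* Combination of cs N2 h <= |z|^2 + kappa (2 N2 f + 2 C0^2 Z tau) with Z tau <= ex (|z|^2 + 2 kappa
   N2 f). *)
exists (cs^-1 * (1 + 2 * kappa + 2 * kappa * C0 ^+ 2 * ex * (1 + 2 * kappa))).
  by rewrite !(mulr_ge0, addr_ge0, invr_ge0)// ?sqr_ge0// ltW.
move=> z f h f2 h2 sh; have tt0 : 0 <= tau <= tau by rewrite lexx ltW.
have g2 := sqint_sub hsep f2 (sqint_CT h2).
have Th2 := sqint_map hsep T_lin CT0 T_le h2.
pose Z t := \int[mu]_(s in I t) hn (T (h s)) ^+ 2.
have iT (t : R) : 0 <= t <= tau -> RI (I t) (fun s => hn (T (h s)) ^+ 2).
  by move=> /andP[t0 tt]; exact: (RIJ (lexx 0) tt Th2.2).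
have iff (t : R) : 0 <= t <= tau -> RI (I t) (fun s => hn (f s) ^+ 2).
  by move=> /andP[t0 tt]; exact: (RIJ (lexx 0) tt f2.2).
have Zi : RI D Z.
  by apply: nondecreasing_integral_RI => //; [exact: Th2.2|move=> s _; exact: sqr_ge0].
have mono (p : R -> R) (t : R) : RI D p -> (forall s, 0 <= p s) -> 0 <= t <= tau ->
    \int[mu]_(s in I t) p s <= \int[mu]_(s in D) p s.
  move=> ip p0 /andP[t0 tt]; rewrite -subr_ge0 (itv_splitR t0 tt (lexx _) ip).
  by apply: Rintegral_ge0.
have g_le (t : R) : 0 <= t <= tau ->
    \int[mu]_(s in I t) hn (f s - C s (T (h s))) ^+ 2 <= 2 * N2 f + 2 * C0 ^+ 2 * Z t.
  move=> tt; apply: (@le_trans _ _ (2 * \int[mu]_(s in I t) hn (f s) ^+ 2 + 2 * C0 ^+ 2 * Z t)).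
    have j1 := iff t tt; have j2 := iT t tt.
    rewrite -(RintegralZl _ (mitv _) j1) -(RintegralZl _ (mitv _) j2).
    have j3 := RI_scale (mitv _) 2 j1; have j4 := RI_scale (mitv _) (2 * C0 ^+ 2) j2.
    have /andP[t0 tl] := tt.
    rewrite -(RintegralD (mitv _) j3 j4); apply: Rintegral_ae_le => //.
    - exact: (RIJ (lexx 0) tl g2.2).
    - exact: RI_add.
    apply: nearW => s Is; have Ds : D s by exact: (subJ (lexx 0) tl).
    have q1 := hn_CT h Ds; have q2 := hn_sub (f s) (C s (T (h s))).
    have q3 : hn (f s - C s (T (h s))) ^+ 2 <= (hn (f s) + hn (C s (T (h s)))) ^+ 2.
      by rewrite lerXn2r ?nnegrE ?addr_ge0 ?hn_ge0.
    have q4 := sqr_ge0 (hn (f s) - hn (C s (T (h s)))).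
    move: q1 q3 q4; rewrite !expr2 => q1 q3 q4; nra.
  apply: lerD => //; rewrite ler_pM2l//; apply: mono => //; first exact: f2.2.
  by move=> s; exact: sqr_ge0.
have ub (t : R) : 0 <= t <= tau -> Z t <= (hn z ^+ 2 + 2 * kappa * N2 f) * tau
    + C2 * \int[mu]_(s in I t) Z s.
  move=> tt; have /andP[t0 tl] := tt.
  set a := hn z ^+ 2 + _; have a0 : 0 <= a.
    by rewrite addr_ge0 ?sqr_ge0// mulr_ge0 ?N2_ge0// mulr_ge0.
  have iZ := RIJ (lexx 0) tl Zi.
  apply: (@le_trans _ _ (a * t + C2 * \int[mu]_(s in I t) Z s)); last first.
    by apply: lerD => //; apply: ler_wpM2l.
  have <- : \int[mu]_(s in I t) a = a * t.
    by rewrite Rintegral_cst// mu_I.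
  have muI : (mu (I t) < +oo)%E by exact: mu_itv_fin.
  have ia := RI_cst (mitv _) a muI; have iZ2 := RI_scale (mitv _) C2 iZ.
  rewrite -(RintegralZl _ (mitv _) iZ) -(RintegralD (mitv _) ia iZ2).
  apply: Rintegral_ae_le => //; first exact: iT.
    exact: RI_add.
  have := ae_subI tl (apriori_sup g2 h2 sh); apply: filterS => s /= HH Is.
  have Ds : D s by exact: (subJ (lexx 0) tl).
  apply: (le_trans (HH Is)); rewrite /a /C2.
  have Z0 : 0 <= Z s by apply: Rintegral_ge0 => r _; exact: sqr_ge0.
  have := ler_wpM2l kappa0 (g_le s (in_ge0 Ds)); lra.
have Ztau : Z tau <= ex * (hn z ^+ 2 + 2 * kappa * N2 f).
  have a0 : 0 <= (hn z ^+ 2 + 2 * kappa * N2 f) * tau.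
    by rewrite mulr_ge0 ?(ltW tau_gt0)// addr_ge0 ?sqr_ge0// mulr_ge0 ?N2_ge0// mulr_ge0.
  have ZN (t : R) : 0 <= t <= tau -> 0 <= Z t <= Z tau.
    move=> tt; apply/andP; split; first by apply: Rintegral_ge0 => s _; exact: sqr_ge0.
    by apply: mono => //; [exact: Th2.2|move=> s; exact: sqr_ge0].
  apply: (le_trans (gronwall C20 a0 Zi ZN ub tt0)); rewrite /ex.
  by rewrite le_eqVlt; apply/orP; left; apply/eqP; ring.
have ap := apriori g2 h2 sh tt0; rewrite -/(N2 h) in ap.
have g3 := ler_wpM2l kappa0 (g_le tau tt0).
have g4 := ler_wpM2l (mulr_ge0 kappa0 (mulr_ge0 (ler0n R 2) (sqr_ge0 C0))) Ztau.
rewrite -(mulrA cs^-1) ler_pdivlMl//.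
have n0 := N2_ge0 tau f; have z0 := sqr_ge0 (hn z).
have e1 : 0 <= ex * C0 ^+ 2 * kappa.
  by apply: mulr_ge0 => //; apply: mulr_ge0 => //; exact: sqr_ge0.
have e2 : 0 <= ex * C0 ^+ 2 * kappa * kappa by rewrite mulr_ge0.
have p1 : 0 <= ex * C0 ^+ 2 * kappa * N2 f by rewrite mulr_ge0.
have p2 : 0 <= ex * C0 ^+ 2 * kappa * kappa * hn z ^+ 2 by rewrite mulr_ge0.
have p3 : 0 <= kappa * hn z ^+ 2 by rewrite mulr_ge0.
have -> : (1 + 2 * kappa + 2 * kappa * C0 ^+ 2 * ex * (1 + 2 * kappa)) * (hn z ^+ 2 + N2 f)
  = hn z ^+ 2 + N2 f + 2 * (kappa * hn z ^+ 2) + 2 * kappa * N2 f +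
    2 * kappa * C0 ^+ 2 * ex * hn z ^+ 2 + 2 * (ex * C0 ^+ 2 * kappa * N2 f)
    + 4 * (ex * C0 ^+ 2 * kappa * kappa * hn z ^+ 2) +
    4 * kappa * kappa * C0 ^+ 2 * ex * N2 f by ring.
have E4 : kappa * (2 * C0 ^+ 2) * (ex * (hn z ^+ 2 + 2 * kappa * N2 f)) =
    2 * kappa * C0 ^+ 2 * ex * hn z ^+ 2 + 4 * kappa * kappa * C0 ^+ 2 * ex * N2 f by ring.
rewrite E4 in g4; lra.
Qed.

End Perturbation.

End Evolution.

(** * The square root of the operator of a coercive form *)

(** The minimizing sequence yields the projection p of x on the closure of the range, and x - p is
    orthogonal to the range. *)
Lemma dense_of_orthogonal (R : realType) (W : lmodType R) (E : hilb R) (g : W -> E) :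
  real_linear g -> (forall z, (forall w, dot z (g w) = 0) -> z = 0) ->
  forall x (e : R), 0 < e -> exists w, hn (x - g w) <= e.
Proof.
move=> gl gz x e e0.
have [||||||||||v [_ vc vl]] := @quadratic_minimization R W setT
  (fun v w => dot (g v) (g w)) (fun w => dot x (g w)) (hn x ^+ 2) => //.
- by move=> v w _ _; exact: dotC.
- by move=> u v w _ _ _; rewrite gl.1 dotDl.
- by move=> a v w _ _; rewrite gl.2 dotZl.
- by move=> v _; exact: dot_ge0.
- by move=> v w _ _; rewrite gl.1 dotDr.
- by move=> a v _; rewrite gl.2 dotZr.
- move=> v _; rewrite -sqr_hn -exprMn -real_normK ?num_real//.
  by rewrite lerXn2r ?nnegrE ?mulr_ge0 ?hn_ge0 ?normr_dot_le.
have [|p vp] := @hcauchyP R E (fun n => g (v n)).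
  move=> r r0; have [N HN] := vc _ (exprn_gt0 2 r0).
  exists N => m n Nm Nn; have := HN m n Nm Nn; rewrite (rlB gl) -sqr_hn.
  by rewrite ler_pXn2r ?nnegrE ?hn_ge0 ?(ltW r0).
have xp : x - p = 0.
  apply: gz => w; rewrite dotBl; apply/eqP; rewrite subr_eq0; apply/eqP.
  exact: (cvg_uniqR (vl w I) (hcvg_dot vp)).
have [N HN] := (hcvgP _ _).1 vp _ e0; exists (v N).
by move/eqP: xp; rewrite subr_eq0 => /eqP ->; rewrite hnB; exact: HN.
Qed.

Lemma bounded_cvg_dense (R : realType) (W : lmodType R) (E : hilb R) (g : W -> E)
    (A : nat -> E -> E) (C : R) :
  (forall n, real_linear (A n)) -> (forall n, bounded_by (A n) C) -> 0 <= C ->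
  (forall x (e : R), 0 < e -> exists w, hn (x - g w) <= e) ->
  (forall w, hcvg (A^~ (g w)) (g w)) -> forall x, hcvg (A^~ x) x.
Proof.
move=> Al AC C0 gd Ag x; apply/hcvgP => e e0.
have C1 : 0 < 2 * (C + 1) by rewrite mulr_gt0// ltr_wpDl.
have [w Hw] := gd x _ (divr_gt0 e0 C1).
have e2 : 0 < e / 2 by rewrite divr_gt0.
have [N HN] := (hcvgP _ _).1 (Ag w) _ e2; exists N => n /HN Hn.
have h1 := hn_triangle (A n (g w)) (A n x) x; have h2 := hn_triangle (g w) (A n (g w)) x.
rewrite -(rlB (Al n)) in h1; rewrite (hnB (g w)) in h2.
have h3 := AC n (x - g w).
have h4 : C * hn (x - g w) + hn (x - g w) <= e / 2.
  move: Hw; rewrite ler_pdivlMr// => H; lra.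
lra.
Qed.

Section FormOperator.
Variables (R : realType) (H V : hilb R) (j : V -> H) (s : V -> V -> R) (Cj M delta : R).
Hypotheses (j_lin : real_linear j) (Cj0 : 0 <= Cj) (j_le : bounded_by j Cj)
  (j_inj : forall v, j v = 0 -> v = 0)
  (j_dense : forall x (e : R), 0 < e -> exists v, hn (x - j v) <= e)
  (sDl : forall u v w, s (u + v) w = s u w + s v w)
  (sZl : forall a u w, s (a *: u) w = a * s u w)
  (sDr : forall u v w, s w (u + v) = s w u + s w v)
  (sZr : forall a u w, s w (a *: u) = a * s w u)
  (M0 : 0 <= M) (sM : forall u v, s u v <= M * hn u * hn v)
  (delta0 : 0 < delta) (sc : forall u, delta * hn u ^+ 2 <= s u u).
Implicit Types (x y z : H) (u v w : V) (l : R).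

Lemma sBl u v w : s (u - v) w = s u w - s v w.
Proof. by rewrite sDl -scaleN1r sZl mulN1r. Qed.

Lemma s_ge0 u : 0 <= s u u.
Proof. by rewrite (le_trans _ (sc u))// mulr_ge0 ?sqr_ge0// ltW. Qed.

Lemma j_sub u v : j (u - v) = j u - j v. Proof. exact: rlB. Qed.

Lemma j_ext u v : j u = j v -> u = v.
Proof.
move=> uv; apply/eqP; rewrite -subr_eq0; apply/eqP/j_inj.
by rewrite j_sub uv subrr.
Qed.

Lemma dot_j0 x : (forall v, dot x (j v) = 0) -> x = 0.
Proof.
move=> H0; apply: hn_eq0; apply/eqP; rewrite eq_le hn_ge0 andbT.
apply/ler_addgt0Pr => e e0; have [v Hv] := j_dense x e0; rewrite add0r.
apply: le_trans Hv; have [->|x0] := eqVneq (hn x) 0; first exact: hn_ge0.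
have xp : 0 < hn x by rewrite lt_def x0 hn_ge0.
rewrite -(ler_pM2l xp) -expr2 sqr_hn; have := dot_le_hn x (x - j v).
by rewrite dotBr H0 subr0.
Qed.

Definition shifted l u v := s u v + l * dot (j u) (j v).

Lemma shifted_coercive l u : 0 <= l -> delta * hn u ^+ 2 <= shifted l u u.
Proof. by move=> l0; rewrite (le_trans (sc u))// lerDl mulr_ge0// dot_ge0. Qed.

Lemma lift_exists l x : 0 <= l -> exists u, forall v, shifted l u v = dot x (j v).
Proof.
move=> l0; have [||||||||||||u uP] := @lax_milgram R V (shifted l) (M + l * (Cj * Cj)) delta
   _ _ _ _ _ _ _ _ (fun v => dot x (j v)) (hn x * Cj); last by exists u.
- by move=> u v w; rewrite /shifted sDl j_lin.1 dotDl; ring.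
- by move=> a u w; rewrite /shifted sZl j_lin.2 dotZl; ring.
- by move=> u v w; rewrite /shifted sDr j_lin.1 dotDr; ring.
- by move=> a u w; rewrite /shifted sZr j_lin.2 dotZr; ring.
- by rewrite addr_ge0// mulr_ge0// mulr_ge0.
- move=> u v; rewrite /shifted 2!mulrDl; apply: lerD => //.
  rewrite -!mulrA; apply: (ler_wpM2l l0); apply: (le_trans (dot_le_hn _ _)).
  have -> : Cj * (Cj * (hn u * hn v)) = (Cj * hn u) * (Cj * hn v) by ring.
  by apply: ler_pM; rewrite ?hn_ge0 ?j_le.
- exact: delta0.
- by move=> u; exact: shifted_coercive.
- by rewrite mulr_ge0 ?hn_ge0.
- by move=> v w; rewrite j_lin.1 dotDr.
- by move=> a v; rewrite j_lin.2 dotZr.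
- move=> v; apply: (le_trans (dot_le_hn _ _)); rewrite -mulrA.
  by apply: ler_wpM2l; [exact: hn_ge0|exact: j_le].
Qed.

(** The resolvent (l + S)^-1 x as an element of V; the default 0 of [xget] is never reached for l >=
    0. *)
Definition vlift l x : V := xget 0 [set u | forall v, shifted l u v = dot x (j v)].

Lemma liftP l x v : 0 <= l -> shifted l (vlift l x) v = dot x (j v).
Proof.
move=> l0; have [u uP] := lift_exists x l0.
exact: (@xgetPex _ 0 [set u | forall v, shifted l u v = dot x (j v)] (ex_intro _ u uP)).
Qed.

Lemma lift_uniq l x u : 0 <= l -> (forall v, shifted l u v = dot x (j v)) -> u = vlift l x.
Proof.
move=> l0 uP; apply/eqP; rewrite -subr_eq0; apply/eqP/hn_eq0/eqP; rewrite -sqrf_eq0.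
have := shifted_coercive (u - vlift l x) l0.
have -> : shifted l (u - vlift l x) (u - vlift l x) = 0.
  have -> (w : V) : shifted l (u - vlift l x) w = shifted l u w - shifted l (vlift l x) w.
    by rewrite /shifted sBl j_sub dotBl; ring.
  by rewrite uP liftP// subrr.
by rewrite pmulr_rle0// => H0; rewrite eq_le H0 sqr_ge0.
Qed.

Lemma lift_lin l : 0 <= l -> real_linear (vlift l).
Proof.
move=> l0; split=> [x y|a x]; apply/esym/lift_uniq => // v.
  by rewrite dotDl -!(liftP _ _ l0) /shifted sDl j_lin.1 dotDl; ring.
by rewrite dotZl -!(liftP _ _ l0) /shifted sZl j_lin.2 dotZl; ring.
Qed.

Definition rho l x : H := j (vlift l x).

Lemma rho_lin l : 0 <= l -> real_linear (rho l).
Proof.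
move=> l0; split=> [x y|a x]; rewrite /rho.
  by rewrite (lift_lin l0).1 j_lin.1.
by rewrite (lift_lin l0).2 j_lin.2.
Qed.

Lemma rho_le l x : 0 < l -> hn (rho l x) <= l^-1 * hn x.
Proof.
move=> l0; rewrite ler_pdivlMl//.
have [->|u0] := eqVneq (hn (rho l x)) 0; first by rewrite mulr0 hn_ge0.
have up : 0 < hn (rho l x) by rewrite lt_def u0 hn_ge0.
rewrite -(ler_pM2r up) -mulrA -expr2 sqr_hn.
apply: le_trans (dot_le_hn _ _); rewrite -(liftP x _ (ltW l0)) /shifted.
by rewrite lerDr s_ge0.
Qed.

Lemma lift_le l x : 0 <= l -> hn (vlift l x) <= Cj / delta * hn x.
Proof.
move=> l0; rewrite -mulrA mulrCA ler_pdivlMl// mulrC.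
have [->|u0] := eqVneq (hn (vlift l x)) 0; first by rewrite mul0r mulr_ge0 ?hn_ge0.
have up : 0 < hn (vlift l x) by rewrite lt_def u0 hn_ge0.
rewrite -(ler_pM2r up); have := shifted_coercive (vlift l x) l0; rewrite liftP// => H1.
have H2 := dot_le_hn x (j (vlift l x)).
have H3 : hn x * hn (j (vlift l x)) <= hn x * (Cj * hn (vlift l x)).
  by apply: ler_wpM2l; [exact: hn_ge0|exact: j_le].
move: H1 H3; rewrite expr2; lra.
Qed.

Lemma rho_le0 l x : 0 <= l -> hn (rho l x) <= Cj * (Cj / delta) * hn x.
Proof.
move=> l0; apply: (le_trans (j_le _)); rewrite -mulrA.
by apply: ler_wpM2l => //; exact: lift_le.
Qed.

Lemma lift_res l m x : 0 <= l -> 0 <= m ->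
  vlift l x - vlift m x = (m - l) *: vlift l (rho m x).
Proof.
move=> l0 m0; rewrite -(lift_lin l0).2; apply: lift_uniq => // v.
have H1 := liftP x v l0; have H2 := liftP x v m0; rewrite dotZl /rho.
move: H1 H2; rewrite /shifted sBl j_sub dotBl; lra.
Qed.

Lemma rho_res l m x : 0 <= l -> 0 <= m -> rho l x - rho m x = (m - l) *: rho l (rho m x).
Proof. by move=> l0 m0; rewrite /rho -j_sub lift_res// j_lin.2. Qed.

(** Density of D(S) in V. If z is orthogonal to it in V, Lax-Milgram for the adjoint form writes (v,
    z) as s v w; then (x, j w) = 0 for all x, so w = 0 and z = 0. *)
Lemma range_lift0_dense u (e : R) : 0 < e -> exists x, hn (u - vlift 0 x) <= e.
Proof.
apply: dense_of_orthogonal; first exact: lift_lin.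
move=> z zP; have sD2 u' v' w : s w (u' + v') = s w u' + s w v' by exact: sDr.
have [||||||||||||w wP] := @lax_milgram R V (fun u v => s v u) M delta
   _ _ _ _ _ _ _ _ (fun v => dot v z) (hn z) => //.
- by move=> u' v'; rewrite mulrAC.
- exact: hn_ge0.
- by move=> v w; rewrite dotDl.
- by move=> a v; rewrite dotZl.
- by move=> v; rewrite mulrC; exact: dot_le_hn.
have jw x : dot x (j w) = 0.
  have <- := liftP x w (lexx 0); rewrite /shifted mul0r addr0 wP dotC; exact: zP.
have w0 : w = 0 by apply: j_inj; apply: dot_eq0.
apply: dot_eq0; rewrite -wP w0.
by have := sZr 0 0 z; rewrite scale0r mul0r.
Qed.

(* n (n + S)^-1 on V and on H. *)
Definition Vn n u : V := n.+1%:R *: vlift n.+1%:R (j u).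
Definition Rn n x : H := n.+1%:R *: rho n.+1%:R x.

Let n0 n : 0 <= n.+1%:R :> R. Proof. exact: ler0n. Qed.
Let n1 n : 0 < n.+1%:R :> R. Proof. exact: ltr0Sn. Qed.

Lemma Rn_lin n : real_linear (Rn n).
Proof.
split=> [x y|a x]; rewrite /Rn; first by rewrite (rho_lin (n0 n)).1 scalerDr.
by rewrite (rho_lin (n0 n)).2 !scalerA mulrC.
Qed.

Lemma Vn_lin n : real_linear (Vn n).
Proof.
split=> [x y|a x]; rewrite /Vn; first by rewrite j_lin.1 (lift_lin (n0 n)).1 scalerDr.
by rewrite j_lin.2 (lift_lin (n0 n)).2 !scalerA mulrC.
Qed.

Lemma j_Vn n u : j (Vn n u) = Rn n (j u).
Proof. by rewrite /Vn j_lin.2. Qed.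

Lemma Rn_le n : bounded_by (Rn n) 1.
Proof.
move=> x; rewrite /Rn hnZ ger0_norm// mul1r; have := rho_le x (n1 n).
by rewrite ler_pdivlMl.
Qed.

(** The difference w - u solves the shifted equation with right-hand side - s u, and the shift has
    the good sign: coercivity bounds it in V uniformly in n. *)
Lemma Vn_le n : bounded_by (Vn n) (1 + M / delta).
Proof.
move=> u; set w := Vn n u.
have wP v : s (w - u) v + n.+1%:R * dot (j (w - u)) (j v) = - s u v.
  rewrite sBl j_sub dotBl mulrBr.
  have -> : n.+1%:R * dot (j u) (j v) = s w v + n.+1%:R * dot (j w) (j v).
    have := congr1 (fun r : R => n.+1%:R * r) (liftP (j u) v (n0 n)) => /= <-.
    by rewrite /w /Vn /shifted sZl j_lin.2 dotZl; ring.
  by ring.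
have wu : hn (w - u) <= M / delta * hn u.
  rewrite -mulrA mulrCA ler_pdivlMl// mulrC.
  have [->|z0] := eqVneq (hn (w - u)) 0; first by rewrite mul0r mulr_ge0 ?hn_ge0.
  have zp : 0 < hn (w - u) by rewrite lt_def z0 hn_ge0.
  rewrite -(ler_pM2r zp); have := shifted_coercive (w - u) (n0 n).
  rewrite /shifted wP; have := sM (- u) (w - u).
  by rewrite hnN -scaleN1r sZl mulN1r expr2; lra.
have := hnD (w - u) u; rewrite subrK mulrDl mul1r; lra.
Qed.

Lemma small_n (C : R) : 0 <= C -> forall e : R, 0 < e ->
  exists N, forall n, (N <= n)%N -> n.+1%:R^-1 * C <= e.
Proof.
move=> C0 e e0; have C1 : 0 < C + 1 by rewrite ltr_wpDl.
have [N HN] := invn_small (divr_gt0 e0 C1); exists N => n /HN.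
rewrite ler_pdivlMr//; apply: le_trans; apply: ler_wpM2l; last by rewrite lerDl.
by rewrite invr_ge0.
Qed.

Let Vn_lift0 n x : vlift 0 x - Vn n (vlift 0 x) = vlift n.+1%:R x.
Proof.
have := lift_res x (n0 n) (lexx 0); rewrite sub0r scaleNr.
by rewrite -/(Vn _ _) => H1; rewrite -[RHS](subrK (vlift 0 x)) H1 /Vn addrC.
Qed.

(** On the dense set of vectors S^-1 x the error is (N + S)^-1 x with N = n.+1, whose squared norm
    in V is at most |x|^2 / (delta N). *)
Lemma Vn_cvg u : hcvg (Vn^~ u) u.
Proof.
apply: (bounded_cvg_dense (g := vlift 0) Vn_lin Vn_le).
- by rewrite addr_ge0// divr_ge0// ltW.
- exact: range_lift0_dense.
move=> x; apply/hcvgP => e e0.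
have [N HN] := small_n (mulr_ge0 (sqr_ge0 (hn x)) (ltW (ltr0Sn R 0))) (mulr_gt0 delta0 (exprn_gt0 2 e0)).
exists N => n /HN Hn; rewrite hnB Vn_lift0.
rewrite -(ler_pXn2r (n:=2)) ?nnegrE ?hn_ge0 ?(ltW e0)// -(ler_pM2l delta0).
apply: le_trans Hn; apply: (le_trans (shifted_coercive _ (n0 n))); rewrite liftP//.
apply: (le_trans (dot_le_hn _ _)); rewrite mulr1 expr2 mulrCA.
by apply: ler_wpM2l; [exact: hn_ge0|exact: rho_le].
Qed.

Lemma range_rho0_dense x (e : R) : 0 < e -> exists y, hn (x - rho 0 y) <= e.
Proof.
move=> e0; have e2 : 0 < e / 2 by rewrite divr_gt0.
have C1 : 0 < Cj + 1 by rewrite ltr_wpDl.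
have [v Hv] := j_dense x e2; have [y Hy] := range_lift0_dense v (divr_gt0 e2 C1).
exists y; apply: (le_trans (hn_triangle (j v) _ _)).
have : hn (j v - rho 0 y) <= e / 2.
  rewrite /rho -j_sub (le_trans (j_le _))//; move: Hy; rewrite ler_pdivlMr//.
  by have := hn_ge0 (v - vlift 0 y); lra.
lra.
Qed.

Lemma Rn_cvg x : hcvg (Rn^~ x) x.
Proof.
apply: (bounded_cvg_dense (g := rho 0) Rn_lin Rn_le ler01 range_rho0_dense) => y.
have -> : Rn^~ (rho 0 y) = fun n => j (Vn n (vlift 0 y)).
  by apply/funext => n; rewrite j_Vn.
by apply: (bounded_cvg j_lin j_le); exact: Vn_cvg.
Qed.

Lemma rho0_ge0 x : 0 <= dot (rho 0 x) x.
Proof.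
rewrite dotC -(liftP _ _ (lexx 0)) /shifted mul0r addr0; exact: s_ge0.
Qed.

Lemma lift0_inj x : vlift 0 x = 0 -> x = 0.
Proof.
move=> u0; apply: dot_j0 => v; rewrite -(liftP _ _ (lexx 0)) u0 /shifted mul0r addr0.
by have := sZl 0 0 v; rewrite scale0r mul0r.
Qed.

Lemma rho0_def x : dot (rho 0 x) x = 0 -> x = 0.
Proof.
rewrite dotC -(liftP _ _ (lexx 0)) /shifted mul0r addr0 => H0; apply: lift0_inj.
apply: hn_eq0; apply/eqP; rewrite -sqrf_eq0 eq_le sqr_ge0 andbT.
by have := sc (vlift 0 x); rewrite H0 pmulr_rle0.
Qed.

(** In operator terms N Rn-type regularization reads S (N + S)^-1 = 1 - N (N + S)^-1; this is what
    turns [Pn n] after [T] into [Rn n]. *)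
Lemma rho_bootstrap n x : rho n.+1%:R x = rho 0 (x - Rn n x).
Proof.
have := rho_res x (lexx 0) (n0 n); rewrite subr0 -(rho_lin (lexx 0)).2 -/(Rn n x).
by rewrite (rlB (rho_lin (lexx 0))) => <-; rewrite opprB addrC subrK.
Qed.

(** * Operators between H and V attached to the square root *)

Section SquareRoot.
Variables (T : H -> H) (CT : R).
Hypotheses (T_lin : real_linear T) (CT0 : 0 <= CT) (T_le : bounded_by T CT)
  (TT : forall x, T (T x) = rho 0 x)
  (T_rho : forall l x, 0 <= l -> rho l (T x) = T (rho l x))
  (T_range : forall x, exists v, T x = j v) (T_onto : forall v, exists x, T x = j v).

Lemma T_inj x : T x = 0 -> x = 0.
Proof.
by move=> x0; apply: rho0_def; rewrite -TT x0 (rl0 T_lin) dot0l.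
Qed.

Lemma T_ext x y : T x = T y -> x = y.
Proof.
move=> xy; apply/eqP; rewrite -subr_eq0; apply/eqP/T_inj.
by rewrite (rlB T_lin) xy subrr.
Qed.

(** [Th] is S^(-1/2) with values in V and [Ti] is S^(1/2) from V to H. Both are everywhere defined
    because the range of [T] is exactly the image of V. *)
Definition Th x : V := xget 0 [set v | T x = j v].
Definition Ti v : H := xget 0 [set x | T x = j v].

Lemma j_Th x : j (Th x) = T x.
Proof. by have [v xv] := T_range x; rewrite -(@xgetPex _ 0 [set v | T x = j v] (ex_intro _ v xv)). Qed.

Lemma T_Ti v : T (Ti v) = j v.
Proof.
have [x xv] := T_onto v; exact: (@xgetPex _ 0 [set x | T x = j v] (ex_intro _ x xv)).
Qed.

Lemma Th_lin : real_linear Th.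
Proof.
split=> [x y|a x]; apply: j_ext; first by rewrite j_lin.1 !j_Th T_lin.1.
by rewrite j_lin.2 !j_Th T_lin.2.
Qed.

Lemma Ti_lin : real_linear Ti.
Proof.
split=> [u v|a u]; apply: T_ext; first by rewrite T_lin.1 !T_Ti j_lin.1.
by rewrite T_lin.2 !T_Ti j_lin.2.
Qed.

Lemma RnT n x : Rn n (T x) = T (Rn n x).
Proof. by rewrite /Rn T_rho// T_lin.2. Qed.

(** With N = n.+1, N (1 - Rn n) is S Rn n, so this is S^(1/2) Rn n, written in a form that makes
    sense and is bounded on all of H. *)
Definition Pn n x : H := n.+1%:R *: T (x - Rn n x).

Lemma Pn_lin n : real_linear (Pn n).
Proof.
split=> [x y|a x]; rewrite /Pn.
  by rewrite -scalerDr -T_lin.1; congr (_ *: T _); rewrite (Rn_lin n).1 opprD addrACA.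
by rewrite (Rn_lin n).2 -scalerBr T_lin.2 !scalerA mulrC.
Qed.

Lemma PnT n x : Pn n (T x) = Rn n x.
Proof. by rewrite /Pn RnT -(rlB T_lin) TT -rho_bootstrap. Qed.

Lemma Pn_le n : bounded_by (Pn n) (n.+1%:R * (CT * 2)).
Proof.
move=> x; rewrite /Pn hnZ ger0_norm// -!mulrA; apply: ler_wpM2l => //.
apply: (le_trans (T_le _)); apply: ler_wpM2l => //.
by have := hn_sub x (Rn n x); have := Rn_le n x; lra.
Qed.

(** A closed graph argument. For fixed n, Vn n (Th x) depends on T x alone and is bounded in x; for
    fixed x it is bounded in n by [Vn_le]. The uniform bound survives the limit in n. *)
Lemma Th_le : exists2 C, 0 <= C & bounded_by Th C.
Proof.
have [||||C C0 HC] := @uniform_boundedness R H (fun n x => hn (Vn n (Th x)))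
    (fun n => n.+1%:R * (Cj / delta * CT)).
- by move=> n x y; rewrite Th_lin.1 (Vn_lin n).1 hnD.
- by move=> n a x; rewrite Th_lin.2 (Vn_lin n).2 hnZ.
- move=> n x; rewrite /Vn j_Th hnZ ger0_norm// -mulrA; apply: ler_wpM2l => //.
  apply: (le_trans (lift_le _ (n0 n))); rewrite -[leRHS]mulrA.
  by apply: ler_wpM2l; [rewrite divr_ge0// ltW|exact: T_le].
- by move=> x; exists ((1 + M / delta) * hn (Th x)) => n; exact: Vn_le.
exists C => // x; apply: (hcvg_le (Vn_cvg (Th x))) => n; exact: HC.
Qed.

(** As for [Th_le], with Rn n (Ti v) = Pn n (j v), bounded in v for each n, and the contractions
    [Rn n]. *)
Lemma Ti_le : exists2 C, 0 <= C & bounded_by Ti C.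
Proof.
have RnTi n v : Rn n (Ti v) = Pn n (j v) by rewrite -T_Ti PnT.
have [||||C C0 HC] := @uniform_boundedness R V (fun n v => hn (Rn n (Ti v)))
    (fun n => n.+1%:R * (CT * 2) * Cj).
- by move=> n x y; rewrite Ti_lin.1 (Rn_lin n).1 hnD.
- by move=> n a x; rewrite Ti_lin.2 (Rn_lin n).2 hnZ.
- move=> n v; rewrite RnTi (le_trans (Pn_le _ _))// -[leRHS]mulrA.
  by apply: ler_wpM2l; [rewrite !mulr_ge0|exact: j_le].
- by move=> v; exists (hn (Ti v)) => n; have := Rn_le n (Ti v); rewrite mul1r.
exists C => // x; apply: (hcvg_le (Rn_cvg (Ti x))) => n; exact: HC.
Qed.

(** The form transported to H: sigma (S^(1/2) u) (S^(1/2) v) = s u v. It is bounded by [Th_le] and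
    coercive by [Ti_le]. *)
Definition sigma x y := s (Th x) (Th y).

Lemma Th_Rn n x : Th (Rn n x) = Vn n (Th x).
Proof. by apply: j_ext; rewrite j_Th j_Vn -RnT j_Th. Qed.

Lemma Pn_sigma n x y : dot (Pn n x) (T (Rn n y)) = sigma (Rn n x) (Rn n y).
Proof.
rewrite /sigma Th_Rn /Vn sZl j_Th.
have H1 := liftP (T x) (Th (Rn n y)) (n0 n); rewrite /shifted -/(rho _ _) j_Th in H1.
have -> : s (vlift n.+1%:R (T x)) (Th (Rn n y)) = dot (T x - Rn n (T x)) (T (Rn n y)).
  by rewrite dotBl [dot (Rn n _) _]dotZl; lra.
by rewrite /Pn dotZl RnT -(rlB T_lin).
Qed.

Lemma sqrt_T_dense z (e : R) : 0 < e -> exists y, hn (z - T y) <= e.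
Proof.
by move=> /(j_dense z)[v Hv]; have [y yv] := T_onto v; exists y; rewrite yv.
Qed.

(** * The evolution equation in terms of forms *)

Section Evolve.
Variables (tau : R) (B : R -> V -> H) (CB : R).
Local Notation mu := (@lebesgue_measure R).
Local Notation I t := (`]0, t]%classic : set (measurableTypeR R)).
Local Notation D := (`]0, tau]%classic : set (measurableTypeR R)).
Hypotheses (tau_gt0 : 0 < tau) (hsep : hseparable H) (CB0 : 0 <= CB)
  (B_lin : forall t, D t -> real_linear (B t))
  (B_le : forall t, D t -> bounded_by (B t) CB)
  (B_meas : forall u, wmeas D (B^~ u)).

(* y t is the value at u t of the operator associated with the form
   s u v + (B t u, j v). *)
Definition evolves (u0 : V) (f y U : R -> H) :=
  primitive tau (j u0) (fun t => f t - y t) U /\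
  {ae mu, forall t, D t -> exists2 w, j w = U t &
     forall v, s w v + dot (B t w) (j v) = dot (y t) (j v)}.

(** B(t) S^(-1/2), uniformly bounded on H by [Th_le]. *)
Let C t x := B t (Th x).

Let C_lin t : D t -> real_linear (C t).
Proof.
move=> Dt; split=> [x y|a x]; rewrite /C.
  by rewrite Th_lin.1 (B_lin Dt).1.
by rewrite Th_lin.2 (B_lin Dt).2.
Qed.

Let C_le : exists2 C0, 0 <= C0 & forall t, D t -> bounded_by (C t) C0.
Proof.
have [K K0 HK] := Th_le; exists (CB * K); first by rewrite mulr_ge0.
move=> t Dt x; apply: (le_trans (B_le Dt _)); rewrite -mulrA; exact: ler_wpM2l.
Qed.

Let sqint_C (v : R -> H) : sqint tau v -> sqint tau (fun t => C t (v t)).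
Proof.
have [C0 C00 HC] := C_le => v2.
apply: (sqint_le hsep _ (RI_scale (mitv _) (C0 ^+ 2) v2.2)).
  exact: (wmeas_operator hsep C_lin HC (fun x => B_meas (Th x)) v2.1).
by move=> t Dt; rewrite -exprMn lerXn2r ?nnegrE ?mulr_ge0 ?hn_ge0// HC.
Qed.

Let Ms_le : exists2 Ms, 0 <= Ms & forall x y, sigma x y <= Ms * hn x * hn y.
Proof.
have [K K0 HK] := Th_le; exists (M * K * K); first by rewrite !mulr_ge0.
move=> x y; apply: (le_trans (sM _ _)).
have -> : M * K * K * hn x * hn y = M * ((K * hn x) * (K * hn y)) by ring.
rewrite -mulrA; apply: (ler_wpM2l M0).
by apply: ler_pM; rewrite ?hn_ge0.
Qed.

Let cs_le : exists2 cs, 0 < cs & forall x, cs * hn x ^+ 2 <= sigma x x.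
Proof.
have [K K0 HK] := Ti_le; have K1 : 0 < K ^+ 2 + 1 by rewrite ltr_wpDl// sqr_ge0.
exists (delta / (K ^+ 2 + 1)); first by rewrite divr_gt0.
move=> x; apply: le_trans (sc _); rewrite -mulrA; apply: (ler_wpM2l (ltW delta0)).
rewrite ler_pdivrMl//; have := HK (Th x).
have -> : Ti (Th x) = x by apply: T_ext; rewrite T_Ti j_Th.
move=> H1; rewrite (@le_trans _ _ ((K * hn (Th x)) ^+ 2))//.
  by rewrite lerXn2r ?nnegrE ?mulr_ge0 ?hn_ge0.
by rewrite exprMn mulrDl mul1r lerDl sqr_ge0.
Qed.

Lemma evolution_exists (u0 : V) (f : R -> H) : sqint tau f ->
  exists y U : R -> H, sqint tau y /\ evolves u0 f y U.
Proof.
move=> f2; have [C0 C00 HC] := C_le; have [Ms Ms0 HMs] := Ms_le; have [cs cs0 Hcs] := cs_le.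
have CP0 n : 0 <= n.+1%:R * (CT * 2) by rewrite !mulr_ge0.
have KT x : 0 <= dot (T (T x)) x by rewrite TT; exact: rho0_ge0.
have KD x : dot (T (T x)) x = 0 -> x = 0 by rewrite TT; exact: rho0_def.
have [z zu] := T_onto u0.
have [h h2 [U pU hU]] := sol_exists tau_gt0 hsep T_lin CT0 T_le Rn_lin Rn_le Rn_cvg RnT
  Pn_lin CP0 Pn_le PnT Pn_sigma Ms0 HMs cs0 Hcs KT KD sqrt_T_dense C00 C_lin HC
  (fun x => B_meas (Th x)) z f2.
have Th2 := sqint_map hsep T_lin CT0 T_le h2.
have C2 := sqint_C Th2.
(* With w = S^-1 h one has S w = h and B(t) w = C t (T h), so y is their sum. *)
exists (fun t => C t (T (h t)) + h t), U; split; first exact: sqint_add.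
split.
  rewrite -zu; have := pU; congr (primitive _ _ _ _); apply/funext => t.
  by rewrite opprD addrA.
apply: filterS hU => t /= Ht Dt.
have lE : vlift 0 (h t) = Th (T (h t)) by apply: j_ext; rewrite j_Th TT.
exists (vlift 0 (h t)); first by rewrite -Ht// TT.
move=> v; rewrite dotDl addrC {1}lE; congr (_ + _).
by rewrite -(liftP _ _ (lexx 0)) /shifted mul0r addr0.
Qed.

(** Here y and U are arbitrary and not built from some h. The lift w of U to V must first be shown
    measurable and square integrable; then h = S w is recovered from y, and [sol_estimate]
    applies. *)
Lemma evolution_estimate : exists2 K : R, 0 <= K & forall (u0 : V) (f y U : R -> H),
  sqint tau f -> sqint tau y -> evolves u0 f y U ->
  N2 tau y <= K * (hn u0 ^+ 2 + N2 tau f).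
Proof.
have [C0 C00 HC] := C_le; have [Ms Ms0 HMs] := Ms_le; have [cs cs0 Hcs] := cs_le.
have CP0 n : 0 <= n.+1%:R * (CT * 2) by rewrite !mulr_ge0.
have [K K0 HK] := sol_estimate tau_gt0 hsep T_lin CT0 T_le Rn_lin Rn_le Rn_cvg RnT
  Pn_lin CP0 Pn_le PnT Pn_sigma Ms0 HMs cs0 Hcs C00 C_lin HC (fun x => B_meas (Th x)).
have [KT KT0 HKT] := Ti_le.
(* The first factor comes from y = h + C T h; the factor KT^2 + 1 from the bound of S^(1/2) u0 by
   the norm of u0 in V. *)
exists ((2 + 2 * (C0 ^+ 2 * CT ^+ 2)) * (K * (KT ^+ 2 + 1))).
  by rewrite !(mulr_ge0, addr_ge0)// sqr_ge0.
move=> u0 f y U f2 y2 [pU yU].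
have i1 := sqint_bint hsep (sqint_sub hsep f2 y2).
have mU := primitive_wmeas tau_gt0 i1 pU.
have U2 : sqint tau U.
  by apply: (sqint_bounded hsep mU) => t /in_ge0 Dt; exact: (primitive_bounded tau_gt0 i1 pU Dt).
have [N [mN N0 NP]] := yU.
(* On the exceptional null set w is 0, so that later bounds can be stated for every t in ]0,
   tau]. *)
have /choice[w wP] : forall t : R, exists w : V, (N t -> w = 0) /\ (D t -> ~ N t ->
    j w = U t /\ forall v, s w v + dot (B t w) (j v) = dot (y t) (j v)).
  move=> t; have [Nt|nNt] := pselect (N t); first by exists 0.
  have [Dt|nDt] := pselect (D t); last by exists 0.
  have [w w1 w2] : exists2 w, j w = U t & forall v, s w v + dot (B t w) (j v) = dot (y t) (j v).
    by apply: contrapT => H0; apply: nNt; apply: NP => /(_ Dt).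
  by exists w.
have good (P : R -> Prop) : (forall t, D t -> ~ N t -> P t) -> {ae mu, forall t, D t -> P t}.
  move=> HP; exists N; split => // t /= nP; apply: contrapT => nNt.
  by apply: nP => Dt; exact: HP.
have [jd jdP] := adjoint_exists j_lin Cj0 j_le.
(* Measurability of w in V: the pairings (w, jd x) = (U, x) are measurable, up to the null set, and
   the range of the adjoint of an injective [j] is dense. *)
have jd_lin : real_linear jd.
  by split=> [x x'|a x]; apply: dot_ext => v; rewrite ?dotDl ?dotZl !(dotC _ v) -!jdP ?dotDr ?dotZr.
have jd_dense v (e : R) : 0 < e -> exists x, hn (v - jd x) <= e.
  apply: dense_of_orthogonal => // z zP; apply: j_inj; apply: dot_eq0.
  by rewrite jdP zP.
have mw : wmeas D w.
  move=> v; have /choice[x xP] : forall n : nat, exists x, hn (v - jd x) <= n.+1%:R^-1.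
    by move=> n; apply: jd_dense; rewrite invr_gt0.
  apply: (@measurable_fun_cvg _ _ _ D (fun n t => dot (w t) (jd (x n)))).
    move=> n; apply: (@eq_measurable_fun _ _ _ _ D (fun t => dot ((\1_(~` N) t : R) *: U t) (x n))).
      move=> t; rewrite inE => Dt; rewrite -jdP indicE.
      have [Nt|nNt] := pselect (N t).
        rewrite memNset; last by move=> /(_ Nt).
        by rewrite ((wP t).1 Nt) (rl0 j_lin) scale0r.
      by rewrite mem_set// scale1r (((wP t).2 Dt nNt).1).
    exact: (wmeas_indic (measurableC mN) mU).
  move=> t _; rewrite dotC; under eq_fun do rewrite dotC.
  apply: hcvg_dot; apply/hcvgP => e e0; have [k Hk] := invn_small e0.
  by exists k => n kn; rewrite hnB (le_trans (xP n))// Hk.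
pose x t := Ti (w t).
have mx : wmeas D x := wmeas_map Ti_lin KT0 HKT mw.
(* Coercivity and the equation tested with w itself bound w in V by y and U; the term of B is
   absorbed by Young's inequality at the price CB^2 / delta. *)
have wle t : D t -> hn (w t) ^+ 2 <= delta^-1 * (hn (y t) ^+ 2 + (1 + CB ^+ 2 / delta) * hn (U t) ^+ 2).
  move=> Dt; rewrite ler_pdivlMl//.
  have q0 : 0 <= 1 + CB ^+ 2 / delta by rewrite addr_ge0// divr_ge0 ?sqr_ge0// ltW.
  have [Nt|nNt] := pselect (N t).
    rewrite ((wP t).1 Nt) hn0 expr0n/= mulr0.
    by apply: addr_ge0; [exact: sqr_ge0|apply: mulr_ge0 => //; exact: sqr_ge0].
  have [w1 w2] := (wP t).2 Dt nNt.
  have h1 := sc (w t); have h2 := w2 (w t).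
  have h3 := dot_le_hn (y t) (j (w t)).
  have h4 := dot_le_hn (- B t (w t)) (j (w t)); rewrite dotNl hnN in h4.
  have h5 : hn (B t (w t)) * hn (j (w t)) <= CB * hn (w t) * hn (j (w t)).
    by apply: ler_wpM2r; [exact: hn_ge0|exact: B_le].
  rewrite w1 in h2 h3 h4 h5.
  have h6 : 2 * (CB * hn (w t) * hn (U t)) <= delta * hn (w t) ^+ 2 + CB ^+ 2 / delta * hn (U t) ^+ 2.
    have := mulr_ge0 (ltW delta0) (sqr_ge0 (hn (w t) - CB / delta * hn (U t))).
    have -> : delta * (hn (w t) - CB / delta * hn (U t)) ^+ 2 =
      delta * hn (w t) ^+ 2 + CB ^+ 2 / delta * hn (U t) ^+ 2 - 2 * (CB * hn (w t) * hn (U t)).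
      by field; rewrite gt_eqF.
    by lra.
  have h7 := sqr_ge0 (hn (y t) - hn (U t)).
  rewrite (mulrDl 1) mul1r; move: h6; move: (CB ^+ 2 / delta * _) => q h6; lra.
have x2 : sqint tau x.
  apply: (sqint_le hsep mx (RI_scale (mitv _) (KT ^+ 2 * delta^-1)
    (RI_add (mitv _) y2.2 (RI_scale (mitv _) (1 + CB ^+ 2 / delta) U2.2)))) => t Dt.
  rewrite -mulrA; apply: le_trans (ler_wpM2l (sqr_ge0 KT) (wle t Dt)).
  by rewrite -exprMn lerXn2r ?nnegrE ?mulr_ge0 ?hn_ge0// HKT.
(* Since x = S^(1/2) w, C t (x t) is B(t) w, and the equation says that the difference h is S w. *)
have Cx2 := sqint_C x2; pose h t := y t - C t (x t).
have h2 : sqint tau h := sqint_sub hsep y2 Cx2.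
have Thx t : Th (x t) = w t by apply: j_ext; rewrite j_Th T_Ti.
have lh t : D t -> ~ N t -> w t = vlift 0 (h t).
  move=> Dt nNt; have [w1 w2] := (wP t).2 Dt nNt.
  apply: lift_uniq => // v; rewrite /shifted mul0r addr0 /h dotBl -w2 /C Thx; ring.
have Th_x t : D t -> ~ N t -> T (h t) = x t.
  by move=> Dt nNt; apply: T_ext; rewrite TT T_Ti (lh t Dt nNt).
have TTh t : D t -> ~ N t -> T (T (h t)) = U t.
  by move=> Dt nNt; rewrite Th_x// T_Ti (((wP t).2 Dt nNt).1).
have CTh2 := sqint_C (sqint_map hsep T_lin CT0 T_le h2).
have sh : sol tau T (Ti u0) (fun t => f t - C t (T (h t))) h.
  exists U; last by apply: good; exact: TTh.
  have i2 := sqint_bint hsep (sqint_sub hsep (sqint_sub hsep f2 CTh2) h2).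
  move=> t tt v; rewrite T_Ti pU//; congr (_ + _); have /andP[t0 tl] := tt.
  apply: Rintegral_ae_eq => //; [exact: (RIJ (lexx 0) tl (bint_dot v i1))|
    exact: (RIJ (lexx 0) tl (bint_dot v i2))|].
  exists N; split => // r /= nP; apply: contrapT => nNr; apply: nP => Ir.
  have Dr : D r by exact: (subJ (lexx 0) tl).
  by rewrite Th_x// /h opprB addrA subrK.
have Nh := HK _ _ _ f2 h2 sh.
have -> : N2 tau y = N2 tau (fun t => h t + C t (T (h t))).
  apply: N2_ae => //; first exact: sqint_add.
  by apply: good => t Dt nNt; rewrite Th_x// /h subrK.
apply: (le_trans (N2_add hsep h2 CTh2)).
have NC : N2 tau (fun t => C t (T (h t))) <= C0 ^+ 2 * CT ^+ 2 * N2 tau h.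
  rewrite [in leRHS]/N2 -(RintegralZl _ (mitv _) h2.2).
  apply: (N2_le CTh2 (RI_scale (mitv _) _ h2.2)) => t Dt.
  rewrite -!exprMn lerXn2r ?nnegrE ?mulr_ge0 ?hn_ge0//.
  by rewrite (le_trans (HC t Dt _))// -mulrA; apply: ler_wpM2l.
have zle : hn (Ti u0) ^+ 2 <= KT ^+ 2 * hn u0 ^+ 2.
  by rewrite -exprMn lerXn2r ?nnegrE ?mulr_ge0 ?hn_ge0// HKT.
have n0f := N2_ge0 tau f; have z0 := sqr_ge0 (hn u0); have k0 := sqr_ge0 KT.
have zz : hn (Ti u0) ^+ 2 + N2 tau f <= (KT ^+ 2 + 1) * (hn u0 ^+ 2 + N2 tau f).
  by have := mulr_ge0 k0 n0f; lra.
have Nh2 := le_trans Nh (ler_wpM2l K0 zz).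
have cc0 : 0 <= C0 ^+ 2 * CT ^+ 2 by rewrite mulr_ge0// sqr_ge0.
have Nh3 := ler_wpM2l (addr_ge0 (ler0n R 2) (mulr_ge0 (ler0n R 2) cc0)) Nh2.
apply: le_trans (le_trans Nh3 _); last by rewrite !mulrA.
by rewrite mulrDl; lra.
Qed.

End Evolve.
End SquareRoot.

End FormOperator.

(** * Scalars and real structures *)

Section Scalars.
Variables (R : realType) (k : scalar_kind).
Local Notation K := (scalars R k).

Lemma ofRD : {morph @ofR R k : a b / a + b}.
Proof. by case: k => //= a b; rewrite /ofR; simpc. Qed.

Lemma ofRM : {morph @ofR R k : a b / a * b}.
Proof. by case: k => //= a b; rewrite /ofR; simpc. Qed.

Lemma ofR1 : @ofR R k 1 = 1. Proof. by case: k. Qed.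

Lemma reKD (z w : K) : reK (z + w) = reK z + reK w.
Proof. by move: z w; case: k => //= -[a b] [c d]. Qed.

Lemma reKN (z : K) : reK (- z) = - reK z.
Proof. by move: z; case: k => //= -[a b]. Qed.

Lemma reK_ofRM (a : R) (z : K) : reK (ofR a * z) = a * reK z.
Proof. by move: z; case: k => //= -[c d] /=; rewrite mul0r subr0. Qed.

Lemma reK_ofR (a : R) : reK (@ofR R k a) = a. Proof. by case: k. Qed.

Lemma reK_conj (z : K) : reK (conjK z) = reK z.
Proof. by move: z; case: k => //= -[a b]. Qed.

Lemma conjK_ofR (a : R) : conjK (@ofR R k a) = ofR a.
Proof. by case: k => //=; rewrite oppr0. Qed.

Lemma ge0_ofR (z : K) : 0 <= z -> z = ofR (reK z) /\ 0 <= reK z.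
Proof.
move: z; case: k => //= -[a b] /=; rewrite lecE/= => /andP[/eqP-> a0].
by split.
Qed.

Lemma ofR_le (a b : R) : (@ofR R k a <= ofR b) = (a <= b).
Proof. by case: k => //=; rewrite lecE/= eqxx. Qed.

Lemma ofR_lt (a b : R) : (@ofR R k a < ofR b) = (a < b).
Proof. by case: k => //=; rewrite ltcE/= eqxx. Qed.

Lemma normr_reK (z : K) : `|reK z| <= reK `|z|.
Proof.
move: z; case: k => [//|z]; change (`|complex.Re z| <= complex.Re `|(z : R[i])|).
rewrite normc_def; case: z => a b /=; rewrite -[`|a|]sqrtr_sqr.
by rewrite ler_sqrt ?addr_ge0 ?sqr_ge0// lerDl sqr_ge0.
Qed.

Lemma conjK_mul_eq0 (z : K) : reK (conjK z * z) = 0 -> z = 0.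
Proof.
move: z; case: k => /= [z|[a b]] /=; first by move/eqP; rewrite mulf_eq0 orbb => /eqP.
rewrite mulNr opprK -!expr2 => /eqP; rewrite paddr_eq0 ?sqr_ge0// !sqrf_eq0.
by case/andP => /eqP-> /eqP->.
Qed.

Lemma ofR0 : @ofR R k 0 = 0. Proof. by case: k. Qed.

End Scalars.

Section Rnorm.
Variables (R : realType) (k : scalar_kind) (E : normedModType (scalars R k)).
Implicit Types x y : E.

Lemma norm_rnorm x : `|x| = ofR (rnorm x).
Proof. by have [] := ge0_ofR (normr_ge0 x). Qed.

Lemma rnorm_ge0 x : 0 <= rnorm x.
Proof. by have [] := ge0_ofR (normr_ge0 x). Qed.

Lemma rnormN x : rnorm (- x) = rnorm x.
Proof. by rewrite /rnorm normrN. Qed.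

Lemma rcvgP (s : nat -> E) x : s @ \oo --> x <->
  forall e : R, 0 < e -> exists N, forall n, (N <= n)%N -> rnorm (s n - x) <= e.
Proof.
split=> [/cvgrPdist_le H e e0|H].
  have [|N _ HN] := H (ofR e); first by rewrite -(ofR0 R k) ofR_lt.
  exists N => n Nn; have := HN n Nn.
  by rewrite norm_rnorm ofR_le -rnormN opprB.
apply/cvgrPdist_le => e e0; have [eE _] := ge0_ofR (ltW e0).
have e1 : 0 < reK e by rewrite -(ofR_lt k) ofR0 -eE.
have [N HN] := H _ e1; exists N => // n /= /HN.
by rewrite -(ofR_le k) -eE -norm_rnorm distrC.
Qed.

End Rnorm.

Section SesquiTheory.
Variables (R : realType) (k : scalar_kind) (E : normedModType (scalars R k))
  (b : {bilinear E -> E -> scalars R k | *%R & (@conjK R k \; *%R)}).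

Lemma sesqDl x y z : b (x + y) z = b x z + b y z.
Proof. exact: linearDl. Qed.

Lemma sesqDr x y z : b z (x + y) = b z x + b z y.
Proof. exact: linearDr. Qed.

Lemma sesqZl c x z : b (c *: x) z = c * b x z.
Proof. exact: linearZl_LR. Qed.

Lemma sesqZr c x z : b z (c *: x) = conjK c * b z x.
Proof. exact: linearZr_LR. Qed.

End SesquiTheory.

(** * The real Hilbert space underlying a Hilbert space over R or C *)

Section Realification.
Variables (R : realType) (k : scalar_kind) (E : completeNormedModType (scalars R k)).

(** An alias of [E], so that the module structure over R does not clash with the one over the
    original scalars. *)
Definition realified : Type := E.

HB.instance Definition _ := GRing.Zmodule.on realified.

Definition real_scale (a : R) (x : realified) : realified := ofR a *: (x : E).

Lemma real_scaleA a b x : real_scale a (real_scale b x) = real_scale (a * b) x.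
Proof. by rewrite /real_scale scalerA ofRM. Qed.

Lemma real_scale1 : left_id 1 real_scale.
Proof. by move=> x; rewrite /real_scale ofR1 scale1r. Qed.

Lemma real_scaleDr : right_distributive real_scale +%R.
Proof. by move=> a x y; rewrite /real_scale scalerDr. Qed.

Lemma real_scaleDl x : {morph real_scale^~ x : a b / a + b}.
Proof. by move=> a b; rewrite /real_scale ofRD scalerDl. Qed.

HB.instance Definition _ := GRing.Zmodule_isLmodule.Build R realified
  real_scaleA real_scale1 real_scaleDr real_scaleDl.

Variable ip : {dot E for @conjK R k}.
Hypothesis ipE : inner_product_of_norm ip.

Definition rdot (x y : realified) : R := reK (ip x y).

Lemma rdotC x y : rdot x y = rdot y x.
Proof.
by rewrite /rdot (hermitian_subproof (x : E) y) expr0 mul1r reK_conj.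
Qed.

Lemma rdotDl x y z : rdot (x + y) z = rdot x z + rdot y z.
Proof. by rewrite /rdot (sesqDl ip) reKD. Qed.

Lemma rdotZl a x y : rdot (a *: x) y = a * rdot x y.
Proof. by rewrite /rdot (sesqZl ip) reK_ofRM. Qed.

Lemma rdot_rnorm x : rdot x x = rnorm (x : E) ^+ 2.
Proof. by rewrite /rdot ipE norm_rnorm expr2 reK_ofRM reK_ofR. Qed.

Lemma rdot_ge0 x : 0 <= rdot x x.
Proof. by rewrite rdot_rnorm sqr_ge0. Qed.

Lemma rdot_eq0 x : rdot x x = 0 -> x = 0.
Proof.
rewrite rdot_rnorm => /eqP; rewrite sqrf_eq0 => /eqP x0.
by apply/eqP; rewrite -normr_eq0 (norm_rnorm (x : E)) x0 ofR0.
Qed.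

Lemma rdot_complete s : sqnorm_cauchy rdot s ->
  exists x, rdot (s n - x) (s n - x) @[n --> \oo] --> (0 : R).
Proof.
move=> sc; have /cauchy_cvgP sE : cauchy ((s : nat -> E) @ \oo).
  apply/cauchyP => e e0; have [eE _] := ge0_ofR (ltW e0).
  have e1 : 0 < reK e / 2 by rewrite divr_gt0// -(ofR_lt k) ofR0 -eE.
  have [N HN] := sc _ (exprn_gt0 2 e1).
  exists (s N); exists N => // n /= Nn; rewrite -ball_normE/= norm_rnorm eE ofR_lt.
  have := HN N n (leqnn N) Nn; rewrite rdot_rnorm.
  rewrite ler_pXn2r ?nnegrE ?rnorm_ge0 ?(ltW e1)// => h.
  by apply: (le_lt_trans h); lra.
exists (lim ((s : nat -> E) @ \oo)); move/rcvgP : sE => sE.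
apply/cvgrPdist_le => e e0; have e1 : 0 < Num.sqrt e by rewrite sqrtr_gt0.
have [N HN] := sE _ e1; exists N => // n /= /HN h.
rewrite sub0r normrN ger0_norm ?rdot_ge0// rdot_rnorm.
by rewrite -[leRHS](sqr_sqrtr (ltW e0)) lerXn2r ?nnegrE ?rnorm_ge0 ?sqrtr_ge0.
Qed.

Definition rhilb : hilb R :=
  @Hilb R realified rdot rdotC rdotDl rdotZl rdot_ge0 rdot_eq0 rdot_complete.

Lemma hn_rnorm (x : rhilb) : hn x = rnorm (x : E).
Proof. by rewrite /hn /= rdot_rnorm sqrtr_sqr ger0_norm// rnorm_ge0. Qed.

Lemma hcvg_rcvg (s : nat -> rhilb) (x : rhilb) :
  hcvg s x <-> (s : nat -> E) @ \oo --> (x : E).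
Proof.
split=> [/hcvgP H|/rcvgP H]; [apply/rcvgP|apply/hcvgP] => e /H[N HN];
by exists N => n /HN; rewrite hn_rnorm.
Qed.

Lemma rhilb_separable : separable E -> hseparable rhilb.
Proof.
move=> [e ed]; exists e => x eps eps0.
have [|y [bx [i _ iy]]] := ed (ball (x : E) (ofR eps)) _ (@ball_open _ E _ _).
  by exists x; apply: ballxx; rewrite -(ofR0 R k) ofR_lt.
exists i; move: bx; rewrite -iy -ball_normE/= norm_rnorm ofR_lt => /ltW.
by rewrite hn_rnorm.
Qed.

End Realification.

(** * Bochner integrals *)

Section GeneralIntegral.
Local Open Scope ereal_scope.
Variables (d : measure_display) (T : measurableType d) (R : realType)
  (mu : {measure set T -> \bar R}).
Implicit Types (D N : set T) (f g : T -> \bar R).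
Import HBNNSimple.

(* The next lemmas do not assume measurability of the integrands. *)
Lemma le_integral_ge0 D f g : (forall x, D x -> 0 <= f x) ->
  (forall x, D x -> f x <= g x) -> \int[mu]_(x in D) f x <= \int[mu]_(x in D) g x.
Proof.
move=> f0 fg; have g0 x : D x -> 0 <= g x by move=> Dx; exact: le_trans (f0 x Dx) (fg x Dx).
rewrite !ge0_integralE//; apply: le_ereal_sup => _ [h /= hf <-]; exists h => //= x.
apply: (le_trans (hf x)); rewrite !patchE; case: ifPn => // /[!inE]; exact: fg.
Qed.

(** The norms integrated in [in_L2] and [bochner_integral] are not known to be measurable. The
    integral is a supremum over simple functions below f, and such a function may be cut to zero on
    [N] at no cost. *)
Lemma le_integral_ae D N f g : measurable N -> mu N = 0 ->
  (forall x, D x -> 0 <= f x) -> (forall x, D x -> 0 <= g x) ->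
  (forall x, D x -> ~ N x -> f x <= g x) -> \int[mu]_(x in D) f x <= \int[mu]_(x in D) g x.
Proof.
move=> mN N0 f0 g0 fg; rewrite [leLHS]ge0_integralE//.
apply: ge_ereal_sup => _ [h /= hf <-].
rewrite -integralT_nnsfun (ge0_negligible_integral mN _ _ _ N0)//; last first.
- by move=> x _; rewrite lee_fin; exact: fun_ge0.
- by apply/measurable_EFinP; exact: measurable_funTS.
rewrite integral_mkcond [leRHS]integral_mkcond.
apply: le_integral_ge0 => x _.
  by rewrite patchE; case: ifPn => // _; rewrite lee_fin; exact: fun_ge0.
rewrite !patchE; case: ifPn => [|_]; last by case: ifPn => // /[!inE]; exact: g0.
rewrite inE => -[_ nN]; apply: (le_trans (hf x)); rewrite patchE.
by case: ifPn => // /[!inE] Dx; exact: fg.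
Qed.

Lemma eq_integral_ae D N f g : measurable N -> mu N = 0 ->
  (forall x, D x -> 0 <= f x) -> (forall x, D x -> 0 <= g x) ->
  (forall x, D x -> ~ N x -> f x = g x) -> \int[mu]_(x in D) f x = \int[mu]_(x in D) g x.
Proof.
move=> mN N0 f0 g0 fg; apply/eqP; rewrite eq_le; apply/andP; split;
  by apply: (le_integral_ae mN N0) => // x Dx nN; rewrite fg.
Qed.

End GeneralIntegral.

Section BochnerWeak.
Variables (R : realType) (k : scalar_kind) (E : completeNormedModType (scalars R k))
  (ip : {dot E for @conjK R k}).
Hypotheses (ipE : inner_product_of_norm ip) (sepE : separable E).
Local Notation K := (scalars R k).
Local Notation mu := (@lebesgue_measure R).
Local Notation rE := (rhilb ipE).
Local Notation T := (measurableTypeR R).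
Variables (D : set T).
Hypothesis mD : measurable D.
Local Notation RI := (rintegrable mu D).

Let hsepE : hseparable rE := rhilb_separable ipE sepE.

Lemma simple_comp_measurable (F : normedModType K) (s : R -> F) (h : F -> R) :
  simple D s -> measurable_fun D ((fun t => h (s t)) : T -> R).
Proof.
move=> [fs ms] _ Y mY.
have -> : D `&` (fun t : T => h (s t)) @^-1` Y =
    \bigcup_(z in (s @` D) `&` [set z | Y (h z)]) (D `&` s @^-1` [set z]).
  apply/seteqP; split => [t [Dt Yt]|t [z [_ Yz] [Dt /= stz]]].
    by exists (s t) => //; split => //; exists t.
  by split => //=; rewrite stz.
apply: fin_bigcup_measurable => [|z _]; last exact: ms.
exact: finite_setIl.
Qed.

Lemma simple_wmeas (s : R -> E) : simple D s -> wmeas D (s : T -> rE).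
Proof. by move=> ss y; exact: (simple_comp_measurable (fun z => dot (z : rE) y) ss). Qed.

Lemma simple_pairing (s : R -> E) (y : rE) : integrable_simple D s ->
  RI (fun t => dot (s t : rE) y) /\
  dot (simple_integral D s : rE) y = \int[mu]_(t in D) dot (s t : rE) y.
Proof.
move=> [[fs ms] msf].
pose A (z : E) : set T := D `&` s @^-1` [set z].
rewrite /simple_integral (fsbig_finite _ _ fs)//=.
set r := finmap.enum_fset _.
have sE t : t \in D -> dot (s t : rE) y = \sum_(z <- r) (dot (z : rE) y * \1_(A z) t).
  move=> /[!inE] Dt.
  have st : s t \in r by rewrite in_fset_set// inE; exists t.
  rewrite (big_rem (s t))//= indicE mem_set//= mulr1 big_seq big1 ?addr0// => z zs.
  rewrite indicE memNset ?mulr0// => -[_ /= stz].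
  by move: zs; rewrite mem_rem_uniq ?finmap.fset_uniq// inE stz eqxx.
have RIz z : RI (fun t => dot (z : rE) y * \1_(A z) t) /\
    \int[mu]_(t in D) (dot (z : rE) y * \1_(A z) t) = dot (z : rE) y * fine (mu (A z)).
  (* The level set of the value 0 may have infinite measure, but it contributes nothing. *)
  have [->|z0] := eqVneq z 0.
    rewrite (_ : (fun _ => _) = fun=> 0); last by apply/funext => t; rewrite dot0l mul0r.
    by split; [exact: integrable0|rewrite Rintegral_cst// dot0l !mul0r].
  have Ai : A z `&` D = A z by apply/seteqP; split => [t []|t At]//; split => //; case: At.
  have ii : RI (\1_(A z) : T -> R).
    apply/integrableP; split.
      by apply/measurable_EFinP; apply: measurable_funTS; apply: measurable_indic; exact: ms.
    under eq_integral do rewrite /= ger0_norm//.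
    by rewrite (integral_indic mu mD (ms z)) Ai; exact: msf.
  split; first exact: RI_scale.
  by rewrite (RintegralZl _ mD ii) /Rintegral (integral_indic mu mD (ms z)) Ai.
have [I1 I2] : RI (fun t => \sum_(z <- r) dot (z : rE) y * \1_(A z) t) /\
  \int[mu]_(t in D) \sum_(z <- r) (dot (z : rE) y * \1_(A z) t) =
  \sum_(z <- r) dot (z : rE) y * fine (mu (A z)); last first.
  split.
    rewrite /rintegrable; apply: (eq_integrable mD _ _ _ I1) => t Dt /=; by rewrite -sE.
  rewrite (eq_Rintegral mu sE) I2.
  elim: r {sE I1 I2} => [|z r IH]; first by rewrite !big_nil; exact: (@dot0l _ rE y).
  rewrite !big_cons -IH; apply: etrans; first exact: rdotDl.
  congr (_ + _); apply: etrans; first exact: rdotZl.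
  by rewrite mulrC.
elim: r {sE} => [|z r [IH1 IH2]].
  rewrite big_nil (_ : (fun _ => _) = fun=> 0); last by apply/funext => t; rewrite big_nil.
  by split; [exact: integrable0|rewrite Rintegral_cst// mul0r].
rewrite big_cons -IH2 -(RIz z).2 -(RintegralD mD (RIz z).1 IH1).
rewrite (_ : (fun t => \sum_(_ <- _ :: _) _) =
   (fun t => dot (z : rE) y * \1_(A z) t + \sum_(x <- r) dot (x : rE) y * \1_(A x) t)).
  by split => //; exact: RI_add (RIz z).1 IH1.
by apply/funext => t; rewrite big_cons.
Qed.


Let pos_small (c e : R) : 0 <= c -> 0 < e -> exists2 r, 0 < r & c * r <= e.
Proof.
move=> c0 e0; have c1 : 0 < c + 1 by rewrite ltr_wpDl.
exists (e / (c + 1)); first by rewrite divr_gt0.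
by rewrite mulrCA ger_pMr// ler_pdivrMr// mul1r lerDl.
Qed.

Let int_lt (g : R -> R) (r : R) : measurable_fun D (g : T -> R) -> (forall t, 0 <= g t) ->
  (\int[mu]_(t in D) (g t)%:E < r%:E)%E -> RI g /\ \int[mu]_(t in D) g t <= r.
Proof.
move=> mg g0 gr; split.
  apply/integrableP; split; first exact/measurable_EFinP.
  under eq_integral do rewrite /= ger0_norm//.
  by rewrite (lt_trans gr)// ltry.
have p0 : (0 <= \int[mu]_(t in D) (g t)%:E)%E by apply: integral_ge0 => t _; rewrite lee_fin.
by rewrite -lee_fin fineK ?(ltW gr)// ge0_fin_numE// (lt_trans gr)// ltry.
Qed.

(** Both sides agree for the simple approximants, and the L1 distance to f controls both errors when
    tested against y. *)
Lemma bochner_weak (f : R -> E) (x : E) : wmeas D (f : T -> rE) ->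
  bochner_integral D f x -> weak_integral mu D (f : T -> rE) (x : rE).
Proof.
move=> mf [s [si _ sf sx]] y; apply/eqP; rewrite -subr_eq0 -normr_le0.
apply/ler_addgt0Pr => e e0; rewrite add0r.
have [r r0 Hr] := pos_small (hn_ge0 (y : rE)) (divr_gt0 e0 (ltr0Sn R 1)).
have /hcvgP/(_ _ r0)[N1 HN1] : hcvg (fun n => simple_integral D (s n) : rE) (x : rE).
  exact/hcvg_rcvg.
have [N2 _ HN2] : \forall n \near \oo, (\int[mu]_(t in D) (rnorm (s n t - f t))%:E < r%:E)%E.
  apply: (sf [set x | x < r%:E]%E); apply: (@open_ereal_lt' R 0%E r%:E).
  by rewrite lte_fin.
pose n := maxn N1 N2.
have h1 := HN1 n (leq_maxl _ _); have h2 := HN2 n (leq_maxr _ _).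
have msf : wmeas D ((fun t => s n t - f t) : T -> rE).
  exact: (wmeas_sub (simple_wmeas (si n).1) mf).
have mg : measurable_fun D ((fun t => rnorm (s n t - f t)) : T -> R).
  have := wmeas_hn hsepE msf; by under eq_fun do rewrite hn_rnorm.
have [ig gr] := int_lt mg (fun t => rnorm_ge0 _) h2.
have [is1 is2] := simple_pairing y (si n).
have id : RI (fun t => dot (s n t - f t : rE) y).
  by apply: (wmeas_dot_RI mD y msf ig) => t _; rewrite hn_rnorm.
have fE : \int[mu]_(t in D) dot (f t : rE) y =
   \int[mu]_(t in D) dot (s n t : rE) y - \int[mu]_(t in D) dot (s n t - f t : rE) y.
  rewrite -(RintegralB mD is1 id); apply: eq_Rintegral => t _.
  by rewrite dotBl opprB addrC subrK.
rewrite fE -is2.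
have -> : dot (x : rE) y - (dot (simple_integral D (s n) : rE) y - \int[mu]_(t in D) dot (s n t - f t : rE) y)
  = - dot (simple_integral D (s n) - x : rE) y + \int[mu]_(t in D) dot (s n t - f t : rE) y.
  by rewrite dotBl; ring.
apply: (le_trans (ler_normD _ _)); rewrite normrN.
have h3 := le_trans (normr_dot_le (simple_integral D (s n) - x : rE) y) (ler_wpM2r (hn_ge0 _) h1).
have h4 : `|\int[mu]_(t in D) dot (s n t - f t : rE) y| <= hn (y : rE) * r.
  apply: (le_trans (le_normr_Rintegral mD id)); apply: le_trans (ler_wpM2l (hn_ge0 _) gr).
  rewrite -(RintegralZl _ mD ig); apply: le_Rintegral => //; [exact: RI_norm|exact: RI_scale|].
  move=> t _; apply: (le_trans (normr_dot_le _ _)).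
  by rewrite mulrC (hn_rnorm (s n t - f t : rE)).
by move: Hr h3 h4; rewrite (mulrC r); lra.
Qed.

Lemma bochner_ae (f g : R -> E) (x : E) : {ae mu, forall t, D t -> f t = g t} ->
  bochner_integral D f x -> bochner_integral D g x.
Proof.
move=> fg [s [si sf sfi sx]]; exists s; split => //.
  by apply: filterS2 fg sf => t /= fgt H Dt; rewrite -fgt//; exact: H.
have [N [mN N0 NP]] := fg.
have H : (fun n => \int[mu]_(t in D) (rnorm (s n t - g t))%:E)%E =
    (fun n => \int[mu]_(t in D) (rnorm (s n t - f t))%:E)%E; last by rewrite H.
apply/funext => n.
apply: (eq_integral_ae mN N0) => [t _|t _|t Dt nN]; rewrite ?lee_fin ?rnorm_ge0//.
by have -> : f t = g t by apply: contrapT => fgt; apply: nN; apply: NP => /= /(_ Dt).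
Qed.

Section Nearest.
Variable e : nat -> rE.
Hypothesis eP : forall (x : rE) (eps : R), 0 < eps -> exists i, hn (x - e i) <= eps.

Lemma nearest_simple (f : R -> E) m : wmeas D (f : T -> rE) ->
  simple D (fun t => nearest e m (f t : rE) : E).
Proof.
move=> mf; elim: m => [|m IH].
  split; first by apply: (sub_finite_set _ (finite_set1 (0 : E))) => _ [t _ <-].
  move=> y; have [y0|y0] := eqVneq y 0.
    rewrite (_ : _ `&` _ = D)//; apply/seteqP; split => [t []//|t Dt]; split => //=.
  rewrite (_ : _ `&` _ = set0)//; apply/seteqP; split => // t [_ /= ty].
  by move: y0; rewrite -ty eqxx.
pose A : set T := D `&` [set t | hn ((f t : rE) - e m) < hn ((f t : rE) - nearest e m (f t : rE))].
have mA : measurable A.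
  have m1 := wmeas_hn hsepE (wmeas_sub mf (wmeas_cst (e m))).
  have m2 := wmeas_hn hsepE (wmeas_sub mf (simple_wmeas IH)).
  have : measurable_fun D (fun t : T => hn ((f t : rE) - e m) < hn ((f t : rE) - nearest e m (f t : rE))).
    exact: measurable_fun_ltr.
  move=> /(_ mD [set true]) H; have /H : measurable [set true] by [].
  by congr (measurable _); apply/seteqP; split => t /= [].
split.
  have : finite_set ([set (e m : E)] `|` (fun t => nearest e m (f t : rE) : E) @` D).
    by rewrite finite_setU; split; [exact: finite_set1|exact: IH.1].
  apply: sub_finite_set => _ [t Dt <-] /=.
  by case: ifPn => _; [left|right; exists t].
move=> y; rewrite (_ : _ `&` _ = (A `&` [set t : T | (e m : E) = y]) `|`
   ((D `&` [set t | (nearest e m (f t : rE) : E) = y]) `\` A)).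
  apply: measurableU; last by apply: measurableD => //; exact: IH.2.
  have [<-|ky] := eqVneq (e m : E) y; first by rewrite (_ : [set _ | _] = setT) ?setIT//; apply/seteqP.
  rewrite (_ : [set _ | _] = set0) ?setI0//; apply/seteqP; split => // t /= /eqP.
  by rewrite (negbTE ky).
apply/seteqP; split => [t [Dt /=]|t /=].
  by case: ifPn => [H emy|H emy]; [left|right; split => // -[_ /=]; rewrite (negbTE H)].
move=> [[[Dt H] emy]|[[Dt ny] nA]]; split => //=; first by rewrite H.
by case: ifPn => // H; exfalso; apply: nA.
Qed.

(** Where the nearest point is y, |y| <= 2 |f t|, so the level sets of nonzero values have finite
    measure by Markov's inequality. *)
Lemma nearest_integrable_simple (f : R -> E) m : wmeas D (f : T -> rE) ->
  RI (fun t => hn (f t : rE)) -> integrable_simple D (fun t => nearest e m (f t : rE) : E).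
Proof.
move=> mf iff_; split; first exact: nearest_simple.
move=> y y0; have hy : 0 < hn (y : rE).
  rewrite lt_def hn_ge0 andbT; apply: contra y0 => /eqP y0; exact/eqP/(hn_eq0 y0).
have c0 : 0 < hn (y : rE) / 2 by rewrite divr_gt0.
have ms := (nearest_simple m mf).2 y.
set B := D `&` _; have : ((hn (y : rE) / 2)%:E * mu B < +oo)%E.
  have mf' := measurable_int mu iff_.
  apply: (le_lt_trans _ ((integrableP _ _ _ iff_).2)).
  apply: le_trans (le_integral_abse mu mD mf' c0).
  rewrite lee_pmul2l ?lte_fin//; apply: le_measure; rewrite ?inE.
  - exact: ms.
  - by apply: emeasurable_fun_c_infty => //; exact: measurableT_comp.
  move=> t [Dt /= ty]; split => //=; rewrite lee_fin ger0_norm ?hn_ge0//.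
  have := nearest_le0 e m (f t : rE); have := hn_triangle (f t : rE) (nearest e m (f t : rE)) 0.
  rewrite !subr0 hnB (_ : nearest e m (f t : rE) = (y : rE))// => h1 h2; lra.
move=> H; rewrite ltey; apply/eqP => Binf; move: H; rewrite Binf gt0_muley ?lte_fin//.
Qed.

End Nearest.

(** The approximants nearest e n (f t) converge pointwise with error at most |f t|: dominated
    convergence gives the L1 convergence, and duality the convergence of the integrals. *)
Lemma weak_bochner (f : R -> E) (x : E) : wmeas D (f : T -> rE) ->
  RI (fun t => hn (f t : rE)) -> weak_integral mu D (f : T -> rE) (x : rE) ->
  bochner_integral D f x.
Proof.
move=> mf iff_ fx; have [e eP] := hsepE.
pose s n t : E := nearest e n (f t : rE).
have ss n : integrable_simple D (s n) by exact: nearest_integrable_simple.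
have msf n : wmeas D ((fun t => s n t - f t) : T -> rE).
  exact: (wmeas_sub (simple_wmeas (ss n).1) mf).
have mh n := wmeas_hn hsepE (msf n).
have sle n t : hn (s n t - f t : rE) <= hn (f t : rE).
  by rewrite hnB; exact: nearest_le0.
have [||||i0 cv] := @RI_dominated _ _ R mu D mD (fun n t => hn (s n t - f t : rE))
   (fun=> 0) (fun t => hn (f t : rE)).
- exact: mh.
- exact: iff_.
- by move=> t _; exact: (nearest_cvg (eP (f t : rE))).
- by move=> n t _; rewrite ger0_norm ?hn_ge0.
rewrite Rintegral_cst// mul0r in cv.
have ih n : RI (fun t => hn (s n t - f t : rE)).
  by apply: (RI_le mD (mh n) iff_) => t _; rewrite ger0_norm ?hn_ge0.
exists s; split => //.
- apply: nearW => t _.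
  have H := nearest_cvg (eP (f t : rE)); have H2 := (hcvg_rcvg (ipE := ipE) _ _).1 H; exact: H2.
- rewrite (_ : (fun n => _) = (fun n => (\int[mu]_(t in D) hn (s n t - f t : rE))%:E)).
    by apply: cvg_EFin; [exact: nearW|exact: cv].
  apply/funext => n; rewrite fineK.
    by apply: eq_integral => t _; rewrite hn_rnorm.
  exact: (integrable_fin_num mD (ih n)).
- apply: (hcvg_rcvg (ipE := ipE) _ _).1; apply/hcvgP => r r0; move/cvgrPdist_le: cv => /(_ _ r0)[N _ HN].
  exists N => n /HN; rewrite sub0r normrN => H.
  apply: hn_le_dual; first exact: ltW.
  move=> y; have [is1 is2] := simple_pairing y (ss n).
  have idf : RI (fun t => dot (f t : rE) y) by apply: (wmeas_dot_RI mD y mf iff_).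
  rewrite dotBl is2 fx -(RintegralB mD is1 idf).
  have id : RI (fun t => dot (s n t - f t : rE) y).
    by apply: (wmeas_dot_RI mD y (msf n) (ih n)).
  rewrite (_ : Rintegral _ _ _ = \int[mu]_(t in D) dot (s n t - f t : rE) y); last first.
    by apply: eq_Rintegral => t _; rewrite dotBl.
  apply: (le_trans (ler_norm _)); apply: (le_trans (le_normr_Rintegral mD id)).
  apply: le_trans (ler_wpM2r (hn_ge0 _) (le_trans (ler_norm _) H)).
  rewrite mulrC -(RintegralZl _ mD (ih n)); apply: le_Rintegral => //; [exact: RI_norm|exact: RI_scale|].
  by move=> t _; rewrite (le_trans (normr_dot_le _ _))// mulrC.
Qed.

End BochnerWeak.

(** * Square integrable functions on the open interval and their measurable representatives *)

Section OpenInterval.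
Variables (R : realType) (k : scalar_kind) (E : completeNormedModType (scalars R k))
  (ip : {dot E for @conjK R k}).
Hypotheses (ipE : inner_product_of_norm ip) (sepE : separable E).
Variable tau : R.
Hypothesis tau_gt0 : 0 < tau.
Local Notation mu := (@lebesgue_measure R).
Local Notation rE := (rhilb ipE).
Local Notation T := (measurableTypeR R).
Local Notation I t := (`]0, t]%classic : set T).
Local Notation D := (`]0, tau]%classic : set T).
Local Notation D' := (`]0, tau[%classic : set T).
Local Notation RI := (rintegrable mu).
Local Hint Extern 0 (measurable _) => (exact: mitv) : core.
Let hsepE : hseparable rE := rhilb_separable ipE sepE.

Lemma oo_sub_oc : D' `<=` D.
Proof. by move=> t; rewrite /= !in_itv/= => /andP[-> /ltW ->]. Qed.

Lemma in_ooP (t : R) : D' t <-> 0 < t < tau.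
Proof. by rewrite /= in_itv/=. Qed.

Lemma ae_oc (P : R -> Prop) : {ae mu, forall t, 0 < t < tau -> P t} <-> {ae mu, forall t, D t -> P t}.
Proof.
split=> [[N [mN N0 NP]]|]; last first.
  by apply: filterS => t /= H /andP[t0 tt]; apply: H; rewrite in_itv/= t0 ltW.
exists (N `|` [set tau]); split; first exact: measurableU.
  by rewrite measureU0//; exact: lebesgue_measure_set1.
move=> t /= nP; have [->|tn] := eqVneq t tau; [by right|left].
apply: NP => /= H; apply: nP; rewrite in_itv/= => /andP[t0 tt].
by apply: H; rewrite t0 lt_neqAle tn.
Qed.

Lemma ae_mem (P : R -> Prop) : {ae mu, forall t, 0 < t < tau -> P t} <-> {ae mu, forall t, D' t -> P t}.
Proof.
split=> -[N [mN N0 NP]]; exists N; split => // t nP; apply: NP => /= H; apply: nP => /= Dt;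
  by apply: H; move: Dt; rewrite in_itv.
Qed.

Lemma RI_oc (f : R -> R) : RI D f -> \int[mu]_(t in D') f t = \int[mu]_(t in D) f t.
Proof.
move=> iff_; apply: Rintegral_itv_bndo_bndc.
exact: (RI_subset (mitv _) (mitv _) oo_sub_oc iff_).
Qed.

Lemma good_version (f : R -> E) : in_L2 D' f ->
  exists2 g : R -> rE, sqint tau g & {ae mu, forall t, 0 < t < tau -> f t = g t}.
Proof.
move=> [[s [ss sae]] f2]; have [N [mN N0 NP]] := sae.
pose B : set T := D' `\` N.
have mB : measurable B by exact: measurableD.
pose g t : rE := if t \in B then f t else 0.
have fg t : D' t -> ~ N t -> f t = g t by move=> Dt nN; rewrite /g mem_set.
have mg : wmeas D g.
  apply: (@wmeas_cvg _ _ _ rE D (fun n t => (\1_B t : R) *: ((s n t : rE)))).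
    move=> n y; rewrite (_ : (fun t => _) = (fun t : T => (\1_B t : R) * ((fun t => dot (s n t : rE) y) \_ D') t)).
      apply: measurable_funM; first by apply: measurable_funTS; exact: measurable_indic.
      apply: measurable_funTS; apply: (measurable_restrictT _ (mitv _)).1.
      exact: (simple_wmeas (ss n)).
    apply/funext => t; rewrite dotZl indicE patchE.
    have [tB|_] := boolP (t \in B); last by rewrite !mul0r.
    by rewrite mem_set//; case/set_mem: tB.
  move=> t Dt; rewrite /g indicE; case: ifPn => [/set_mem [D't nN]|_].
    rewrite (_ : (fun n => _) = (fun n => s n t : rE)); last by apply/funext => n; rewrite scale1r.
    apply: (hcvg_rcvg (ipE := ipE) _ _).2.
    by apply: contrapT => nc; apply: nN; apply: NP => /= /(_ D't).
  rewrite (_ : (fun n => _) = (fun n => 0 : rE)); last by apply/funext => n; rewrite scale0r.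
  by apply/hcvgP => e e0; exists 0%N => n _; rewrite subrr hn0 ltW.
exists g; last first.
  by exists N; split => // t /= nP; apply: contrapT => nN; apply: nP => /in_ooP Dt; exact: fg.
split => //; apply/integrableP; split.
  by apply/measurable_EFinP; exact: (wmeas_sqr_hn hsepE mg).
apply: le_lt_trans f2; rewrite [leRHS]integral_mkcond [leLHS]integral_mkcond.
apply: le_integral_ge0 => t _.
  by rewrite patchE; case: ifPn.
rewrite !patchE; case: ifPn => Dt; last by case: ifPn => // _; rewrite lee_fin sqr_ge0.
rewrite /g /= ger0_norm ?sqr_ge0//; have [/set_mem tB|tB] := boolP (t \in B).
  by rewrite mem_set ?hn_rnorm//; case: tB.
by case: ifPn => _; rewrite hn0 expr0n// lee_fin sqr_ge0.
Qed.

Lemma sqint_in_L2 (g : R -> rE) : sqint tau g -> in_L2 D' (g : R -> E).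
Proof.
move=> [mg g2]; have [e eP] := hsepE.
have mg' : wmeas D' g by exact: (wmeas_subset (mitv _) oo_sub_oc mg).
split.
  exists (fun n t => nearest e n (g t : rE) : E); split.
    by move=> n; exact: (nearest_simple sepE (mitv _) e n mg').
  apply: nearW => t _; have H := nearest_cvg (eP (g t : rE)).
  by have H2 := (hcvg_rcvg (ipE := ipE) _ _).1 H; exact: H2.
have g2' := RI_subset (mitv _) (mitv _) oo_sub_oc g2.
apply: (le_lt_trans _ ((integrableP _ _ _ g2').2)).
apply: le_integral_ge0 => t _; rewrite lee_fin ?sqr_ge0//= hn_rnorm.
by rewrite ler_norm.
Qed.

Lemma in_L2_ae (f g : R -> E) : {ae mu, forall t, 0 < t < tau -> f t = g t} ->
  in_L2 D' f -> in_L2 D' g.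
Proof.
move=> fg [[s [ss sae]] f2]; split.
  exists s; split => //; apply: filterS2 ((ae_mem _).1 fg) sae => t /= ft st Dt.
  by rewrite -ft//; exact: st.
have [N [mN N0 NP]] := fg.
rewrite (_ : (\int[mu]_(t in D') _)%E = (\int[mu]_(t in D') (rnorm (f t) ^+ 2)%:E)%E)//.
apply: (eq_integral_ae mN N0) => [t _|t _|t /in_ooP Dt nN]; rewrite ?lee_fin ?sqr_ge0//.
by have -> : f t = g t by apply: contrapT => fgt; apply: nN; apply: NP => /= /(_ Dt).
Qed.

Lemma L2norm_N2 (f : R -> E) (g : R -> rE) : sqint tau g ->
  {ae mu, forall t, 0 < t < tau -> f t = g t} -> L2norm D' f ^+ 2 = N2 tau g.
Proof.
move=> g2 [N [mN N0 NP]]; rewrite /L2norm.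
have -> : \int[mu]_(t in D') rnorm (f t) ^+ 2 = N2 tau g.
  rewrite /N2 -(RI_oc g2.2); congr fine.
  apply: (eq_integral_ae mN N0) => [t _|t _|t /in_ooP Dt nN]; rewrite ?lee_fin ?sqr_ge0//.
  have -> : f t = g t by apply: contrapT => fgt; apply: nN; apply: NP => /= /(_ Dt).
  by rewrite hn_rnorm.
by rewrite sqr_sqrtr// N2_ge0.
Qed.

End OpenInterval.

(** * Test functions and weak derivatives *)

Section TestFunctions.
Variables (R : realType) (tau : R).
Hypothesis tau_gt0 : 0 < tau.
Local Notation mu := (@lebesgue_measure R).
Local Notation T := (measurableTypeR R).
Local Notation I t := (`]0, t]%classic : set T).
Local Notation D := (`]0, tau]%classic : set T).
Local Notation D' := (`]0, tau[%classic : set T).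
Local Notation RI := (rintegrable mu).
Local Hint Extern 0 (measurable _) => (exact: mitv) : core.

Lemma continuous_bounded (f : R -> R) : continuous f ->
  exists2 C, 0 <= C & forall t, 0 <= t <= tau -> `|f t| <= C.
Proof.
move=> cf; have cn : {within `[0, tau], continuous (fun t => `|f t|)}.
  apply: continuous_subspaceT => t.
  by apply: (@continuous_comp _ _ _ f); [exact: cf|exact: norm_continuous].
have [c _ Hc] := EVT_max (ltW tau_gt0) cn.
by exists `|f c| => // t tt; apply: Hc; rewrite in_itv.
Qed.

Lemma continuous_RI (f : R -> R) : continuous f -> RI D f.
Proof.
move=> cf; have [C _ HC] := continuous_bounded cf.
apply: (@RI_bounded _ _ _ mu D (mitv _) C f); first exact: mu_itv_fin.
  by apply: measurable_funTS; exact: continuous_measurable_fun.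
by move=> t /in_ge0; exact: HC.
Qed.

Lemma continuous_integral0 (f : R -> R) : continuous f -> (forall t, 0 <= f t) ->
  \int[mu]_(t in D) f t <= 0 -> forall t : R, 0 < t < tau -> f t = 0.
Proof.
move=> cf f0 If t /andP[t0 tt]; apply: contrapT => ft.
have [N [mN N0 NP]] := ge0_Rintegral_eq0 (mitv _) (continuous_RI cf) (fun t _ => f0 t) If.
have fp : 0 < f t by rewrite lt_def f0 andbT; apply/eqP.
have := cf t; move=> /cvgrPdist_lt/(_ _ fp)/nbhs_ballP[r /= r0 Hr].
pose q := Num.min (r / 2) (Num.min (t / 2) ((tau - t) / 2)).
have q0 : 0 < q by rewrite !lt_min !divr_gt0// subr_gt0.
have q1 : q <= r / 2 by rewrite ge_min lexx.
have q2 : q <= t / 2 by rewrite !ge_min lexx orbT.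
have q3 : q <= (tau - t) / 2 by rewrite !ge_min lexx !orbT.
pose J : set T := `]t - q, t + q]%classic.
have sub : J `<=` N.
  move=> s; rewrite /J /= in_itv/= => /andP[s1 s2]; apply: NP => /= H.
  have bs : ball t r s.
    by rewrite -ball_normE/= ltr_norml; apply/andP; split; lra.
  have := Hr _ bs; rewrite /= ltr_norml => /andP[_ h]; move: h.
  rewrite H ?subr0 ?ltxx// in_itv/=; apply/andP; split; lra.
have : (mu J <= mu N)%E by apply: le_measure; rewrite ?inE.
rewrite lebesgue_measure_itv/= lte_fin ifT; last by lra.
by rewrite N0 -EFinB lee_fin; lra.
Qed.

Variable phi : R -> R.
Hypothesis phi_test : test_function tau phi.

Lemma test_continuous : continuous phi.
Proof.
have [dphi _ _] := phi_test.
by move=> t; apply/differentiable_continuous/derivable1_diffP.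
Qed.

Lemma test0 (t : R) : t <= 0 -> phi t = 0.
Proof.
have [_ _ [a [b [a0 bt H]]]] := phi_test => t0; apply: H => /andP[at_ _].
by have := lt_le_trans a0 (le_trans at_ t0); rewrite ltxx.
Qed.

Lemma test_tau : phi tau = 0.
Proof.
have [_ _ [a [b [a0 bt H]]]] := phi_test; apply: H => /andP[_ tb].
by have := lt_le_trans bt tb; rewrite ltxx.
Qed.

Lemma test_ftc (t : R) : 0 <= t <= tau -> phi t = \int[mu]_(s in I t) derive1 phi s.
Proof.
have [dphi cphi _] := phi_test; move=> /andP[]; rewrite le_eqVlt => /predU1P[<-|t0] tt.
  by rewrite set_itv_ge ?bnd_simp// Rintegral_set0 test0.
have H (x : R) : 0 <= x <= t -> is_derive x 1 phi (derive1 phi x).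
  by move=> _; rewrite derive1E; apply: DeriveDef => //; exact: dphi.
have H2 := FTC_segment t0 H (fun x _ => cphi x).
rewrite Rintegral_itv_obnd_cbnd; last exact: (RIJ (lexx 0) tt (continuous_RI cphi)).
by rewrite /Rintegral H2 /= (test0 (lexx 0)) subr0.
Qed.

Lemma test_primitive (E : hilb R) (y : E) :
  primitive tau 0 (fun t => derive1 phi t *: y) (fun t => phi t *: y).
Proof.
have [_ cphi _] := phi_test.
move=> t tt x; rewrite dot0l add0r dotZl test_ftc//; have /andP[t0 tl] := tt.
rewrite mulrC -(RintegralZl _ (mitv _) (RIJ (lexx 0) tl (continuous_RI cphi))).
by apply: eq_Rintegral => s _; rewrite dotZl mulrC.
Qed.

Lemma sqint_continuous_scale (E : hilb R) (f : R -> R) (u : R -> E) : hseparable E ->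
  continuous f -> sqint tau u -> sqint tau (fun t => f t *: u t).
Proof.
move=> hsep cf u2; have [C C0 HC] := continuous_bounded cf.
apply: (sqint_le hsep _ (RI_scale (mitv _) (C ^+ 2) u2.2)).
  apply: wmeas_scale u2.1.
  by apply: measurable_funTS; exact: continuous_measurable_fun.
move=> t /in_ge0 Dt; rewrite hnZ exprMn; apply: ler_wpM2r; first exact: sqr_ge0.
by rewrite lerXn2r ?nnegrE// HC.
Qed.

Lemma test_by_parts (E : hilb R) x (g U : R -> E) y : hseparable E -> sqint tau g ->
  primitive tau x g U ->
  \int[mu]_(t in D) dot (phi t *: g t) y = - \int[mu]_(t in D) dot (derive1 phi t *: U t) y.
Proof.
move=> hsep g2 gU; have [_ cphi _] := phi_test; have ig := sqint_bint hsep g2.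
have tt0 : 0 <= tau <= tau by rewrite lexx ltW.
have c2 : sqint tau (fun=> y) := sqint_cst tau hsep y.
have U2 : sqint tau U.
  apply: (sqint_bounded hsep (primitive_wmeas tau_gt0 ig gU)) => t /in_ge0 Dt.
  exact: (primitive_bounded tau_gt0 ig gU Dt).
have i2 := sqint_bint hsep (sqint_continuous_scale hsep cphi c2).
have := product_rule tau_gt0 hsep ig i2 gU (test_primitive y) tt0.
have i1 := sqint_continuous_scale hsep test_continuous g2.
have i3 := sqint_continuous_scale hsep cphi U2.
rewrite test_tau scale0r !dot0r add0r => /esym H; apply/eqP; rewrite -addr_eq0; apply/eqP.
rewrite -[RHS]H -(RintegralD (mitv _) (sqint_dot hsep i1 c2) (sqint_dot hsep i3 c2)).
by apply: eq_Rintegral => t _; rewrite !dotZl !dotZr.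
Qed.

End TestFunctions.

Section DuBoisReymond.
Variables (R : realType) (tau : R).
Hypothesis tau_gt0 : 0 < tau.
Local Notation mu := (@lebesgue_measure R).
Local Notation T := (measurableTypeR R).
Local Notation D := (`]0, tau]%classic : set T).
Local Notation RI := (rintegrable mu).
Local Hint Extern 0 (measurable _) => (exact: mitv) : core.
Variable v : R -> R.
Hypotheses (v_cont : continuous v)
  (v_test : forall phi, test_function tau phi -> \int[mu]_(t in D) (derive1 phi t * v t) = 0).

(* The test function is a primitive of chi (v - c), where chi is a bump and c
   the mean of v for the weight chi; then int chi (v - c)^2 = 0. *)
Let const_ab (a b : R) : 0 < a -> a < b -> b < tau ->
  exists c, forall t, a < t < b -> v t = c.
Proof.
move=> a0 ab bt; pose chi (t : R) := Num.max 0 ((t - a) * (b - t)).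
have chi0 t : 0 <= chi t by rewrite le_max lexx.
have cchi : continuous chi.
  move=> t; apply: (@continuous_max _ _ (fun=> 0) (fun t => (t - a) * (b - t))).
    exact: cvg_cst.
  by apply: cvgM; apply: cvgB => //; exact: cvg_cst.
have chi_out t : ~ (a <= t <= b) -> chi t = 0.
  move=> H; apply/eqP; rewrite eq_le chi0 andbT /chi ge_max lexx/=.
  have [ta|ta] := ltP t a; first by rewrite nmulr_rle0 ?subr_lt0// subr_ge0; lra.
  have [tb|tb] := ltP b t; first by rewrite nmulr_lle0 ?subr_lt0// subr_ge0; lra.
  by exfalso; apply: H; rewrite ta.
have chi_in t : a < t < b -> 0 < chi t.
  by move=> /andP[ta tb]; rewrite lt_max mulr_gt0 ?orbT// subr_gt0.
have k0 : 0 < \int[mu]_(t in D) chi t.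
  rewrite ltNge; apply/negP => /(continuous_integral0 tau_gt0 cchi chi0).
  move=> /(_ ((a + b) / 2)) H; have : 0 < chi ((a + b) / 2) by apply: chi_in; lra.
  by rewrite H ?ltxx//; lra.
have cM (f g : R -> R) : continuous f -> continuous g -> continuous (fun t => f t * g t).
  by move=> cf cg t; apply: cvgM; [exact: cf|exact: cg].
have icv := continuous_RI tau_gt0 (cM _ _ cchi v_cont).
pose c := (\int[mu]_(t in D) (chi t * v t)) / \int[mu]_(t in D) chi t.
pose psi t := chi t * (v t - c).
have cpsi : continuous psi.
  by apply: cM => // t; apply: cvgB; [exact: v_cont|exact: cvg_cst].
have psi_out t : ~ (a <= t <= b) -> psi t = 0 by move=> /chi_out H; rewrite /psi H mul0r.
have psiI : \int[mu]_(t in D) psi t = 0.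
  have i1 := RI_scale (mitv _) c (continuous_RI tau_gt0 cchi).
  transitivity (\int[mu]_(t in D) (chi t * v t - c * chi t)).
    by apply: eq_Rintegral => t _; rewrite /psi; ring.
  rewrite (RintegralB (mitv _) icv i1) (RintegralZl _ (mitv _) (continuous_RI tau_gt0 cchi)).
  by rewrite /c divfK ?subrr// gt_eqF.
(* [phi] vanishes to the left of a because [psi] does, and to the right of b because [psi] has
   integral zero: this is the role of the weighted mean [c]. *)
pose phi x := \int[mu]_(t in (`]-oo, x]%classic : set T)) psi t.
have patchD (A : set T) : (forall t, a <= t <= b -> A t) -> psi \_ A = psi.
  move=> HA; apply/funext => t; rewrite patchE; case: ifPn => // tA; apply/esym/psi_out.
  by move=> /HA At; move: tA; rewrite mem_set.
have psiT : RI setT psi.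
  have [H0 _] := @integrable_mkcond _ _ _ mu D (EFin \o psi) (mitv _).
  have := H0 (continuous_RI tau_gt0 cpsi).
  rewrite /rintegrable restrict_EFin.
  rewrite patchD// => t /andP[at_ tb].
  by rewrite /= in_itv/= (lt_le_trans a0)//= (le_trans tb)// ltW.
have dphi x : derivable phi x 1 /\ derive1 phi x = psi x.
  have xx : (x < x + 1)%R by rewrite ltrDl.
  have ix : RI (`]-oo, (x + 1)]%classic : set T) psi.
    by apply: (RI_subset measurableT (mitv _) _ psiT).
  have H := @continuous_FTC1 R psi -oo%O x (x + 1) xx ix.
  by apply: H; [exact: ltNyr|exact: cpsi].
have phi' : derive1 phi = psi by apply/funext => x; exact: (dphi x).2.
have test : test_function tau phi.
  split; [by move=> x; exact: (dphi x).1|by rewrite phi'|].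
  exists a, b; split => // x nx; rewrite /phi Rintegral_mkcond.
  have [xa|xa] := ltP x a.
    rewrite (_ : psi \_ _ = fun=> 0); last first.
      apply/funext => t; rewrite patchE; case: ifPn => // /set_mem.
      rewrite /= in_itv/= => tx; apply: psi_out => /andP[at_ _]; lra.
    by rewrite Rintegral_cst// mul0r.
  have bx : b < x by rewrite ltNge; apply/negP => xb; apply: nx; rewrite xa.
  rewrite patchD.
    rewrite -[RHS]psiI [RHS]Rintegral_mkcond patchD// => t /andP[at_ tb].
    by rewrite /= in_itv/= (lt_le_trans a0)//= (le_trans tb)// ltW.
  by move=> t /andP[_ tb]; rewrite /= in_itv/=; lra.
have := v_test test; rewrite phi' => Ipv.
(* The integrand is phi' (v - c), and the integrals of phi' v and of phi' both vanish. *)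
have Isq : \int[mu]_(t in D) (chi t * (v t - c) ^+ 2) <= 0.
  have i1 := continuous_RI tau_gt0 (cM _ _ cpsi v_cont).
  have i2 := continuous_RI tau_gt0 cpsi.
  rewrite le_eqVlt; apply/orP; left; apply/eqP.
  transitivity (\int[mu]_(t in D) (psi t * v t - c * psi t)).
    by apply: eq_Rintegral => t _; rewrite /psi; ring.
  by rewrite (RintegralB (mitv _) i1 (RI_scale (mitv _) c i2)) (RintegralZl _ (mitv _) i2) Ipv psiI mulr0 subrr.
exists c => t tab; have /andP[ta tb] := tab.
have csq : continuous (fun t => chi t * (v t - c) ^+ 2).
  apply: cM => // s; rewrite /=; under eq_fun do rewrite expr2.
  by apply: cvgM; apply: cvgB; [exact: v_cont|exact: cvg_cst|exact: v_cont|exact: cvg_cst].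
have sq0 s : 0 <= chi s * (v s - c) ^+ 2 by rewrite mulr_ge0// sqr_ge0.
have := continuous_integral0 tau_gt0 csq sq0 Isq (t := t).
rewrite (lt_trans a0 ta) (lt_trans tb bt) => /(_ isT)/eqP.
by rewrite mulf_eq0 gt_eqF ?chi_in//= sqrf_eq0 subr_eq0 => /eqP.
Qed.

(** The previous step makes v constant on each interval compactly inside ]0, tau[; one containing
    both t and a point q close to 0 is used, and continuity at 0 gives the value. *)
Lemma du_bois_reymond t : 0 < t < tau -> v t = v 0.
Proof.
move=> /andP[t0 tt].
apply/eqP; rewrite -subr_eq0 -normr_le0; apply/ler_addgt0Pr => e e0; rewrite add0r.
have := @v_cont 0; move=> /cvgrPdist_le/(_ _ e0)/nbhs_ballP[r /= r0 Hr].
pose q := Num.min (r / 2) (t / 2).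
have q0 : 0 < q by rewrite lt_min !divr_gt0.
have q1 : q <= r / 2 by rewrite ge_min lexx.
have q2 : q <= t / 2 by rewrite ge_min lexx orbT.
have [||| c Hc] := @const_ab (q / 2) ((t + tau) / 2); [lra|lra|lra|].
rewrite Hc; last by lra.
rewrite -(Hc q); last by lra.
rewrite distrC; apply: Hr; rewrite -ball_normE/= sub0r normrN gtr0_norm//; lra.
Qed.

End DuBoisReymond.

Lemma ae_imp (R : realType) (P Q : R -> Prop) : (forall t, P t -> Q t) ->
  {ae (@lebesgue_measure R), forall t, P t} -> {ae (@lebesgue_measure R), forall t, Q t}.
Proof.
by move=> PQ [N [mN N0 NP]]; exists N; split => // t nQ; apply: NP => /= /PQ.
Qed.

(** * Sobolev functions as primitives *)

Section Sobolev.
Variables (R : realType) (k : scalar_kind) (E : completeNormedModType (scalars R k))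
  (ip : {dot E for @conjK R k}).
Hypotheses (ipE : inner_product_of_norm ip) (sepE : separable E).
Variable tau : R.
Hypothesis tau_gt0 : 0 < tau.
Local Notation mu := (@lebesgue_measure R).
Local Notation rE := (rhilb ipE).
Local Notation T := (measurableTypeR R).
Local Notation I t := (`]0, t]%classic : set T).
Local Notation D := (`]0, tau]%classic : set T).
Local Notation D' := (`]0, tau[%classic : set T).
Local Notation RI := (rintegrable mu).
Local Hint Extern 0 (measurable _) => (exact: mitv) : core.
Let hsepE : hseparable rE := rhilb_separable ipE sepE.

Lemma within_epsP (f : R -> E) : {within `[0, tau], continuous f} <->
  forall x : R, 0 <= x <= tau -> forall e : R, 0 < e -> exists2 r : R, 0 < r &
    forall t, 0 <= t <= tau -> `|x - t| <= r -> rnorm (f t - f x) <= e.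
Proof.
split=> [/subspace_continuousP H x xx e e0|H].
  have := H x; rewrite /= in_itv/= => /(_ xx)/cvgrPdist_le/(_ (ofR e)).
  rewrite -(ofR0 R k) ofR_lt => /(_ e0)/nbhs_ballP[r /= r0 Hr].
  exists (r / 2); first by rewrite divr_gt0.
  move=> t tt xt; have : ball x r t by rewrite -ball_normE/=; lra.
  move=> /Hr/=; rewrite in_itv/= => /(_ tt).
  by rewrite norm_rnorm ofR_le -rnormN opprB.
apply/subspace_continuousP => x; rewrite /= in_itv/= => xx.
apply/cvgrPdist_le => e e0; have [eE _] := ge0_ofR (ltW e0).
have e1 : 0 < reK e by rewrite -(ofR_lt k) ofR0 -eE.
have [r r0 Hr] := H x xx _ e1; apply/nbhs_ballP; exists r => //= t.
rewrite -ball_normE/= in_itv/= => /ltW xt tt; rewrite eE norm_rnorm ofR_le -rnormN opprB.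
exact: Hr.
Qed.

Lemma primitive_continuous x (g U : R -> rE) : sqint tau g -> primitive tau x g U ->
  {within `[0, tau], continuous (U : R -> E)}.
Proof.
move=> g2 gU; apply/within_epsP => s /andP[s0 st] e e0.
have [r r0 Hr] := primitive_unif (sqint_bint hsepE g2) gU e0.
exists r => // t /andP[t0 tt]; rewrite -(hn_rnorm (U t - U s : rE)); have [ts|ts] := leP t s.
  by rewrite ger0_norm ?subr_ge0// => H; rewrite hnB; exact: Hr.
by rewrite ltr0_norm ?subr_lt0// opprB => H; apply: Hr => //; exact: ltW.
Qed.

Lemma primitive_initial x (g U : R -> rE) : sqint tau g -> primitive tau x g U ->
  initial_value tau (U : R -> E) x.
Proof.
move=> g2 gU; exists U; split; first exact: primitive_continuous gU.
  exact: nearW.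
exact: (primitive0 tau_gt0 gU).
Qed.

Lemma primitive_sqint x (g U : R -> rE) : sqint tau g -> primitive tau x g U -> sqint tau U.
Proof.
move=> g2 gU; have ig := sqint_bint hsepE g2.
apply: (sqint_bounded hsepE (primitive_wmeas tau_gt0 ig gU)) => t /in_ge0 Dt.
exact: (primitive_bounded tau_gt0 ig gU Dt).
Qed.

Lemma primitive_weak_derivative x (g U : R -> rE) : sqint tau g -> primitive tau x g U ->
  weak_derivative tau (U : R -> E) (g : R -> E).
Proof.
move=> g2 gU phi phi_test; have [_ cphi _] := phi_test.
have U2 := primitive_sqint g2 gU.
have f1 := sqint_bint hsepE (sqint_continuous_scale tau_gt0 hsepE cphi U2).
have f2 := sqint_bint hsepE (sqint_continuous_scale tau_gt0 hsepE (test_continuous phi_test) g2).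
have m1 := wmeas_subset (mitv _) (@oo_sub_oc R tau) f1.1.
have m2 := wmeas_subset (mitv _) (@oo_sub_oc R tau) f2.1.
have i1 := RI_subset (mitv _) (mitv _) (@oo_sub_oc R tau) f1.2.
have i2 := RI_subset (mitv _) (mitv _) (@oo_sub_oc R tau) f2.2.
have [X XP _] := weak_integral_exists (mitv _) m1 i1 (fun t _ => lexx _).
exists X; split; first exact: (weak_bochner sepE (mitv _) m1 i1 XP).
apply: (weak_bochner sepE (mitv _) m2 i2) => y.
rewrite dotNl XP (RI_oc (bint_dot y f1)) (RI_oc (bint_dot y f2)).
by rewrite (test_by_parts tau_gt0 phi_test y hsepE g2 gU).
Qed.

(** The projection on [0, tau]: composing with it makes a function continuous within [0, tau]
    continuous on the whole line, as [du_bois_reymond] requires. *)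
Let cl (t : R) : R := Num.max 0 (Num.min t tau).

Let cl_in t : 0 <= cl t <= tau.
Proof. by rewrite /cl le_max lexx/= ge_max ltW//= ge_min lexx orbT. Qed.

Let cl_id t : 0 <= t <= tau -> cl t = t.
Proof. by move=> /andP[t0 tt]; rewrite /cl min_l// max_r. Qed.

Let cl_lip x t : `|cl x - cl t| <= `|x - t|.
Proof.
rewrite /cl; have := ler_norm (x - t); have := ler_norm (t - x); rewrite distrC.
have := normr_ge0 (x - t); rewrite ler_norml.
rewrite /Num.max /Num.min.
by case: (ltP x tau) => h1; case: (ltP t tau) => h2; case: ltP => h3; case: ltP => h4;
  move=> *; apply/andP; split; lra.
Qed.

(** For each y, the scalar function (w - U, y), with w the continuous representative, has weak
    derivative zero and vanishes at 0. *)
Lemma H1_primitive x (u du : R -> E) (u' g U : R -> rE) : sqint tau u' -> sqint tau g ->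
  {ae mu, forall t, 0 < t < tau -> u t = u' t} ->
  {ae mu, forall t, 0 < t < tau -> du t = g t} ->
  weak_derivative tau u du -> initial_value tau u x ->
  primitive tau (x : rE) g U -> {ae mu, forall t, 0 < t < tau -> u t = U t}.
Proof.
move=> u2 g2 uu' dug wd [w [cw uw w0]] gU.
have U2 := primitive_sqint g2 gU.
suff wU t : 0 < t < tau -> w t = U t.
  by apply: ae_imp uw => t H tt; rewrite H// wU.
move=> tt; apply: (@dot_ext _ rE) => y.
pose v s := dot ((w (cl s) : rE) - U (cl s)) y.
have cU := (within_epsP U).1 (primitive_continuous g2 gU).
have cv : continuous v.
  move=> s; apply/cvgrPdist_le => e e0.
  have y0 : 0 < 2 * (hn y + 1) by rewrite mulr_gt0// ltr_wpDl// hn_ge0.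
  have [r1 r10 H1] := (within_epsP w).1 cw _ (cl_in s) _ (divr_gt0 e0 y0).
  have [r2 r20 H2] := cU _ (cl_in s) _ (divr_gt0 e0 y0).
  apply/nbhs_ballP; exists (Num.min r1 r2); first by rewrite /= lt_min r10.
  move=> r /=; rewrite lt_min => /andP[/ltW s1 /ltW s2].
  have h1 := H1 _ (cl_in r) (le_trans (cl_lip s r) s1).
  have h2 := H2 _ (cl_in r) (le_trans (cl_lip s r) s2).
  rewrite distrC /v -dotBl (le_trans (normr_dot_le _ _))//.
  have -> : (w (cl r) : rE) - U (cl r) - (w (cl s) - U (cl s)) =
     ((w (cl r) : rE) - w (cl s)) - (U (cl r) - U (cl s)).
    by rewrite !opprB addrACA [RHS]addrACA; congr (_ + _); rewrite addrC.
  rewrite -(hn_rnorm (w (cl r) - w (cl s) : rE)) in h1.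
  rewrite -(hn_rnorm (U (cl r) - U (cl s) : rE)) in h2.
  have h3 := hn_sub ((w (cl r) : rE) - w (cl s)) (U (cl r) - U (cl s)).
  have h4 : hn (((w (cl r) : rE) - w (cl s)) - (U (cl r) - U (cl s))) <= e / (hn y + 1).
    apply: (le_trans h3); apply: (le_trans (lerD h1 h2)).
    rewrite le_eqVlt; apply/orP; left; apply/eqP; field.
    by rewrite gt_eqF// ltr_wpDl// hn_ge0.
  move: h4; rewrite ler_pdivlMr ?ltr_wpDl ?hn_ge0//; apply: le_trans.
  by apply: ler_wpM2l; [exact: hn_ge0|rewrite lerDl].
have vt phi : test_function tau phi -> \int[mu]_(s in D) (derive1 phi s * v s) = 0.
  move=> phi_test; have [_ cphi _] := phi_test; have [X [b1 b2]] := wd phi phi_test.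
  have f1 := sqint_bint hsepE (sqint_continuous_scale tau_gt0 hsepE cphi u2).
  have f2 := sqint_bint hsepE (sqint_continuous_scale tau_gt0 hsepE (test_continuous phi_test) g2).
  have f3 := sqint_bint hsepE (sqint_continuous_scale tau_gt0 hsepE cphi U2).
  have m1 := wmeas_subset (mitv _) (@oo_sub_oc R tau) f1.1.
  have m2 := wmeas_subset (mitv _) (@oo_sub_oc R tau) f2.1.
  have b1' : bochner_integral D' (fun t => derive1 phi t *: u' t : rE) X.
    by apply: bochner_ae b1; apply/ae_mem; apply: ae_imp uu' => s H ss; rewrite H.
  have b2' : bochner_integral D' (fun t => phi t *: g t : rE) (- X).
    by apply: bochner_ae b2; apply/ae_mem; apply: ae_imp dug => s H ss; rewrite H.
  have w1 := bochner_weak sepE (mitv _) m1 b1' y.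
  have w2 := bochner_weak sepE (mitv _) m2 b2' y.
  rewrite (RI_oc (bint_dot y f1)) in w1; rewrite (RI_oc (bint_dot y f2)) in w2.
  rewrite (test_by_parts tau_gt0 phi_test y hsepE g2 gU) in w2.
  have w3 : dot (X : rE) y = \int[mu]_(t in D) dot (derive1 phi t *: U t) y.
    by apply: oppr_inj; rewrite -w2 -(@dotNl _ rE).
  transitivity (\int[mu]_(s in D) (dot (derive1 phi s *: u' s) y - dot (derive1 phi s *: U s) y)).
    apply: Rintegral_ae_eq => //.
    - by apply: continuous_RI => // s; apply: cvgM; [exact: cphi|exact: cv].
    - exact: (RI_sub (mitv _) (bint_dot y f1) (bint_dot y f3)).
    have uo := (ae_oc tau _).1 uu'; have wo := (ae_oc tau _).1 uw.
    apply: filterS2 uo wo => s s1 s2 Ds.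
    by rewrite -dotBl -scalerBr dotZl /v cl_id ?(in_ge0 Ds)// -s1// s2.
  by rewrite (RintegralB (mitv _) (bint_dot y f1) (bint_dot y f3)) -w1 -w3 subrr.
have := du_bois_reymond tau_gt0 cv vt tt.
have /andP[/ltW t0 /ltW tl] := tt.
have e1 : cl t = t by apply: cl_id; rewrite t0.
have e2 : cl 0 = 0 by apply: cl_id; rewrite lexx ltW.
rewrite /v e1 e2 w0 (primitive0 tau_gt0 gU) subrr dot0l.
by rewrite dotBl => /eqP; rewrite subr_eq0 => /eqP.
Qed.

End Sobolev.

(** * Non-autonomous forms *)

Section Forms.
Variables (R : realType) (k : scalar_kind)
  (H : completeNormedModType (scalars R k)) (ipH : {dot H for @conjK R k})
  (V : completeNormedModType (scalars R k)) (ipV : {dot V for @conjK R k})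
  (j : {linear V -> H}) (tau : R)
  (a : R -> {bilinear V -> V -> scalars R k | *%R & (@conjK R k \; *%R)})
  (M delta nu M0 : R).
Hypotheses (ipHE : inner_product_of_norm ipH) (sepH : separable H)
  (ipVE : inner_product_of_norm ipV) (sepV : separable V)
  (j_inj : injective j) (j_cont : continuous j) (j_dense : dense (range j))
  (tau_gt0 : 0 < tau) (M_gt0 : 0 < M) (delta_gt0 : 0 < delta)
  (a_meas : forall u v : V,
     @strongly_measurable R k (scalars R k)^o `[0, tau] (fun t => a t u v))
  (a_bounded : forall (t : R) (u v : V), 0 <= t <= tau ->
     rnorm (a t u v) <= M * rnorm u * rnorm v)
  (a_coercive : forall (t : R) (u : V), 0 <= t <= tau ->
     delta * rnorm u ^+ 2 <= reK (a t u u) + nu * rnorm (j u) ^+ 2)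
  (M0_gt0 : 0 < M0)
  (a_diff : forall (t s : R) (u v : V), 0 <= t <= tau -> 0 <= s <= tau ->
     rnorm (a t u v - a s u v) <= M0 * rnorm u * rnorm (j v)).
Local Notation mu := (@lebesgue_measure R).
Local Notation T := (measurableTypeR R).
Local Notation D := (`]0, tau]%classic : set T).
Local Notation rH := (rhilb ipHE).
Local Notation rV := (rhilb ipVE).
Local Notation RI := (rintegrable mu).
Local Hint Extern 0 (measurable _) => (exact: mitv) : core.

Definition rj (v : rV) : rH := j v.

Lemma rj_lin : real_linear rj.
Proof.
split=> [x y|c x]; first exact: (raddfD j).
exact: (linearZ_LR j (ofR c) x).
Qed.

Lemma rj_inj v : rj v = 0 -> v = 0.
Proof. by move=> v0; apply: j_inj; rewrite raddf0. Qed.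

Lemma rj_dense (x : rH) (e : R) : 0 < e -> exists v, hn (x - rj v) <= e.
Proof.
move=> e0; have [|y [bx [v _ vy]]] := j_dense _ (@ball_open _ H (x : H) (ofR e)).
  by exists x; apply: ballxx; rewrite -(ofR0 R k) ofR_lt.
exists v; move: bx; rewrite -vy -ball_normE/= norm_rnorm ofR_lt => /ltW.
by rewrite hn_rnorm.
Qed.

Lemma rj_le : exists2 C, 0 <= C & bounded_by rj C.
Proof.
have := @j_cont 0; rewrite /continuous_at raddf0 => /cvgrPdist_le/(_ 1 ltr01)/nbhs_ballP[r /= r0 Hr].
have [rE _] := ge0_ofR (ltW r0).
have r1 : 0 < reK r by rewrite -(ofR_lt k) ofR0 -rE.
exists (2 / reK r); first by rewrite divr_ge0// ltW.
move=> v; have [->|v0] := eqVneq v 0; first by rewrite (rl0 rj_lin) !hn0 mulr0.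
have vp : 0 < hn v.
  rewrite lt_def hn_ge0 andbT; apply: contra v0 => /eqP v0; exact/eqP/(hn_eq0 v0).
pose c := reK r / 2 / hn v; have c0 : 0 < c by rewrite !divr_gt0.
have : ball (0 : V) r ((c *: v : rV) : V).
  rewrite -ball_normE/= sub0r normrN norm_rnorm rE ofR_lt -(hn_rnorm (c *: v : rV)).
  by rewrite hnZ gtr0_norm// /c divfK ?gt_eqF//; lra.
move=> /Hr/=; rewrite sub0r normrN norm_rnorm -(ofR1 R k) ofR_le.
rewrite -/(rj (c *: v)) -(hn_rnorm (rj (c *: v))) rj_lin.2 hnZ gtr0_norm// /c.
rewrite mulrAC ler_pdivrMr// mul1r => h.
by rewrite mulrAC ler_pdivlMr//; lra.
Qed.

Definition form (t : R) (u v : rV) : R := reK (a t (u : V) (v : V)).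

Lemma formDl t u v w : form t (u + v) w = form t u w + form t v w.
Proof. by rewrite /form (sesqDl (a t)) reKD. Qed.

Lemma formDr t u v w : form t w (u + v) = form t w u + form t w v.
Proof. by rewrite /form (sesqDr (a t)) reKD. Qed.

Lemma formZl t c u w : form t (c *: u) w = c * form t u w.
Proof. by rewrite /form (sesqZl (a t)) reK_ofRM. Qed.

Lemma formZr t c u w : form t w (c *: u) = c * form t w u.
Proof. by rewrite /form (sesqZr (a t)) conjK_ofR reK_ofRM. Qed.

Lemma formBl t u v w : form t (u - v) w = form t u w - form t v w.
Proof. by rewrite formDl -scaleN1r formZl mulN1r. Qed.

Lemma formBr t u v w : form t w (u - v) = form t w u - form t w v.
Proof. by rewrite formDr -scaleN1r formZr mulN1r. Qed.

Lemma form_norm t u v : 0 <= t <= tau -> `|form t u v| <= M * hn u * hn v.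
Proof.
move=> tt; apply: (le_trans (normr_reK _)); rewrite !hn_rnorm; exact: a_bounded.
Qed.

Lemma form_diff t s u v : 0 <= t <= tau -> 0 <= s <= tau ->
  form t u v - form s u v <= M0 * hn u * hn (rj v).
Proof.
move=> tt ss; rewrite /form -reKN -reKD !hn_rnorm.
apply: (le_trans (ler_norm _)); apply: (le_trans (normr_reK _)); exact: a_diff.
Qed.

(* Real parts determine the form, since v may be replaced by z v for any
   scalar z. *)
Lemma part_in_HP t (x y : H) : part_in_H ipH j (a t) x y <->
  exists2 u : rV, rj u = x & forall v : rV, form t u v = dot (y : rH) (rj v).
Proof.
split=> [[u ux uy]|[u ux uy]]; exists u => // v.
  by rewrite /form uy.
apply/eqP; rewrite -subr_eq0; apply/eqP/conjK_mul_eq0.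
set z := a t u v - ipH y (j v).
have := uy (z *: (v : V) : rV); rewrite /form /= /rdot /rj.
rewrite (sesqZr (a t)) linearZ /= (sesqZr ipH) => H0.
by rewrite /z mulrBr -/z -mulrN reKD mulrN reKN H0 subrr.
Qed.

Variable t0 : R.
Hypothesis t0_in : 0 <= t0 <= tau.

(** The form of S = A(t0) + nu. The shift is taken inside, which makes it coercive on V. *)
Definition sform (u v : rV) : R := form t0 u v + nu * dot (rj u) (rj v).

Lemma sformDl u v w : sform (u + v) w = sform u w + sform v w.
Proof. by rewrite /sform formDl rj_lin.1 dotDl; ring. Qed.

Lemma sformDr u v w : sform w (u + v) = sform w u + sform w v.
Proof. by rewrite /sform formDr rj_lin.1 dotDr; ring. Qed.

Lemma sformZl c u w : sform (c *: u) w = c * sform u w.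
Proof. by rewrite /sform formZl rj_lin.2 dotZl; ring. Qed.

Lemma sformZr c u w : sform w (c *: u) = c * sform w u.
Proof. by rewrite /sform formZr rj_lin.2 dotZr; ring. Qed.

Lemma sform_le C : 0 <= C -> bounded_by rj C ->
  forall u v, sform u v <= (M + `|nu| * (C * C)) * hn u * hn v.
Proof.
move=> C0 jC u v; rewrite /sform 2!mulrDl.
apply: lerD; first exact: le_trans (ler_norm _) (form_norm _ _ t0_in).
apply: (le_trans (ler_norm _)); rewrite normrM -!mulrA; apply: ler_wpM2l => //.
apply: (le_trans (normr_dot_le _ _)).
have -> : C * (C * (hn u * hn v)) = (C * hn u) * (C * hn v) by ring.
by apply: ler_pM; rewrite ?hn_ge0 ?jC.
Qed.

Lemma sform_coercive u : delta * hn u ^+ 2 <= sform u u.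
Proof.
rewrite /sform -sqr_hn !hn_rnorm; exact: a_coercive.
Qed.

Lemma shift_partP (l : R) (x y : H) :
  op_shift (op_shift (part_in_H ipH j (a t0)) nu) l x y <->
  exists2 u : rV, rj u = x & forall v, shifted rj sform l u v = dot (y : rH) (rj v).
Proof.
have E (u v : rV) (z : H) : rj u = z -> form t0 u v = dot (y - ofR l *: z - ofR nu *: z : rH) (rj v) <->
    shifted rj sform l u v = dot (y : rH) (rj v).
  move=> uz; rewrite (@dotBl _ rH) (@dotBl _ rH) (@dotZl _ rH l) (@dotZl _ rH nu) /shifted /sform uz.
  by split; lra.
split=> [/part_in_HP[u ux uy]|[u ux uy]].
  by exists u => // v; apply/(E _ _ _ ux).
by apply/part_in_HP; exists u => // v; apply/(E _ _ _ ux).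
Qed.


Let halfline : set T := `]0, +oo[%classic.

Hypothesis a_sqrt : op_dom (op_sqrt (op_shift (part_in_H ipH j (a t0)) nu)) = range j.

(** The [S] produced here is the inverse square root of A(t0) + nu. Its weak integral is also the
    Bochner integral of [op_invsqrt], since its integrand has integrable norm, so the hypothesis on
    the domain says that its range is the image of V. *)
Lemma form_square_root : exists (S : rH -> rH) (CS : R),
  [/\ real_linear S, 0 <= CS, bounded_by S CS, forall x, S (S x) = rho rj sform 0 x &
      forall l x, 0 <= l -> rho rj sform l (S x) = S (rho rj sform l x)] /\
  (forall x, exists v, S x = rj v) /\ (forall v, exists x, S x = rj v).
Proof.
have [C C0 jC] := rj_le; have sM := sform_le C0 jC.
have Mk0 : 0 <= M + `|nu| * (C * C) by rewrite addr_ge0 ?(ltW M_gt0)// !mulr_ge0.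
have c0 : 0 <= C * (C / delta) by rewrite mulr_ge0// divr_ge0// ltW.
pose r := rho rj sform.
have r_lin (l : R) : 0 <= l -> real_linear (r l).
  exact: (rho_lin rj_lin C0 jC sformDl sformZl sformDr sformZr Mk0 sM delta_gt0 sform_coercive).
have r_le (l : R) x : 0 < l -> hn (r l x) <= l^-1 * hn x.
  exact: (rho_le rj_lin C0 jC sformDl sformZl sformDr sformZr Mk0 sM delta_gt0 sform_coercive).
have r_le0 (l : R) x : 0 <= l -> hn (r l x) <= C * (C / delta) * hn x.
  exact: (rho_le0 rj_lin C0 jC sformDl sformZl sformDr sformZr Mk0 sM delta_gt0 sform_coercive).
have r_res (l m : R) x : 0 <= l -> 0 <= m -> r l x - r m x = (m - l) *: r l (r m x).
  exact: (rho_res rj_lin C0 jC sformDl sformZl sformDr sformZr Mk0 sM delta_gt0 sform_coercive).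
have [S [SI S_lin S_le SS S_r]] := sqrt_resolvent c0 r_lin r_le r_le0 r_res.
have RIr x := sqrt_resolvent_RI c0 r_le r_le0 r_res x (rhilb_separable ipHE sepH).
exists S, (C * (C / delta) + 1); split; first by split => //; rewrite addr_ge0.
split=> [x|v].
  suff : range j (S x) by move=> [v _ <-]; exists v.
  rewrite -a_sqrt; exists x; exists (fun l => r l x); split.
    move=> l l0; apply/shift_partP; exists (vlift rj sform l x) => // v.
    exact: (liftP rj_lin C0 jC sformDl sformZl sformDr sformZr Mk0 sM delta_gt0 sform_coercive x v (ltW l0)).
  exact: (weak_bochner sepH (mitv _) (RIr x).1 (RIr x).2 (SI x)).
have : range j (j v) by exists v.
rewrite -a_sqrt => -[x [q [qP qI]]]; exists x.
have rq (l : R) : 0 < l -> q l = r l x.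
  move=> l0; have [u uq uP] := (shift_partP _ _ _).1 (qP l l0).
  by rewrite -uq (lift_uniq rj_lin C0 jC sformDl sformZl sformDr sformZr Mk0 sM
    delta_gt0 sform_coercive (ltW l0) uP).
have qI' : bochner_integral halfline (fun l => sqrt_weight l *: r l x : rH) (j v).
  apply: bochner_ae qI; apply: nearW => l.
  by rewrite /halfline /= in_itv/= andbT => l0; rewrite rq.
have := bochner_weak sepH (mitv _) (RIr x).1 qI'.
exact: (weak_integral_uniq (SI x)).
Qed.


Let rVsep : hseparable rV := rhilb_separable ipVE sepV.
Let rHsep : hseparable rH := rhilb_separable ipHE sepH.

Lemma lipschitz_cvg (E : hilb R) (f : E -> R) (L : R) (x : E) (s : nat -> E) :
  (forall y, `|f x - f y| <= L * hn (x - y)) -> hcvg s x -> f (s n) @[n --> \oo] --> f x.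
Proof.
move=> fL /hcvgP sx; apply/cvgrPdist_le => e e0.
have L1 : 0 < `|L| + 1 by rewrite ltr_wpDl.
have [N HN] := sx _ (divr_gt0 e0 L1); exists N => // n /= /HN.
rewrite ler_pdivlMr// => h; apply: (le_trans (fL _)); apply: le_trans h.
rewrite (hnB x) mulrC; apply: ler_wpM2l; first exact: hn_ge0.
by rewrite (le_trans (ler_norm _))// lerDl.
Qed.

Lemma dense_seq (E : hilb R) (W : Type) (g : W -> E) (x : E) :
  (forall e : R, 0 < e -> exists w, hn (x - g w) <= e) -> exists w : nat -> W, hcvg (g \o w) x.
Proof.
move=> gx; have /choice[w wP] : forall n : nat, exists w, hn (x - g w) <= n.+1%:R^-1.
  by move=> n; apply: gx; rewrite invr_gt0.
exists w; apply/hcvgP => e e0; have [N HN] := invn_small e0.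
by exists N => n Nn; rewrite hnB (le_trans (wP n))// HN.
Qed.

(** The null set granted by strong measurability depends on the pair u, v. One null set serves a
    dense sequence, and the uniform bound on the form extends measurability to all pairs. *)
Lemma form_measurable : exists N : set T, [/\ measurable N, mu N = 0 &
  forall u v, measurable_fun D (fun t : T => \1_(~` N) t * form t u v)].
Proof.
have [e eP] := rVsep.
have /choice[s sP] : forall p : nat * nat, exists s : nat -> R -> (scalars R k)^o,
    (forall n, simple `[0, tau] (s n)) /\
    {ae mu, forall t, `[0, tau]%classic t -> s n t @[n --> \oo] --> (a t (e p.1) (e p.2) : (scalars R k)^o)}.
  by move=> p; have [s sP] := a_meas (e p.1) (e p.2); exists s.
have [N [mN N0 NP]] : {ae mu, forall (t : R) (i l : nat), `[0, tau]%classic t ->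
    s (i, l) n t @[n --> \oo] --> (a t (e i) (e l) : (scalars R k)^o)}.
  by apply: ae_foralln => i; apply: ae_foralln => l; exact: (sP (i, l)).2.
exists N; split => //.
have mI : measurable_fun D (\1_(~` N) : T -> R).
  by apply: measurable_funTS; apply: measurable_indic; exact: measurableC.
have DI t : D t -> 0 <= t <= tau by exact: in_ge0.
have lim_meas (f : T -> R) (h : nat -> T -> R) :
    (forall n, measurable_fun D (fun t : T => \1_(~` N) t * h n t)) ->
    (forall t, D t -> ~ N t -> h n t @[n --> \oo] --> f t) ->
    measurable_fun D (fun t : T => \1_(~` N) t * f t).
  move=> mh hf; apply: (@measurable_fun_cvg _ _ _ D (fun n t => \1_(~` N) t * h n t)) => // t Dt.
  have [Nt|nNt] := pselect (N t); last by apply: cvgM; [exact: cvg_cst|exact: hf].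
  rewrite indicE memNset; last by move=> /(_ Nt).
  by rewrite mul0r; under eq_fun do rewrite mul0r; exact: cvg_cst.
have m0 i l : measurable_fun D (fun t : T => \1_(~` N) t * form t (e i) (e l)).
  apply: (lim_meas _ (fun n t => reK (s (i, l) n t))).
    move=> n; apply: measurable_funM => //.
    apply: (@measurable_funS _ _ _ _ (`[0, tau]%classic : set T)) => //.
    exact: (simple_comp_measurable (fun z : (scalars R k)^o => reK z) ((sP (i, l)).1 n)).
  move=> t Dt nNt; have cv : s (i, l) n t @[n --> \oo] --> (a t (e i) (e l) : (scalars R k)^o).
    apply: contrapT => nc; apply: nNt; apply: NP => /= /(_ i l) H0; apply: nc; apply: H0.
    by rewrite /= in_itv/= DI.
  apply/cvgrPdist_le => r r0; have [m Hm] := (rcvgP _ _).1 cv _ r0.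
  exists m => // n /= /Hm; apply: le_trans; rewrite distrC /form -reKN -reKD.
  exact: normr_reK.
have m1 i v : measurable_fun D (fun t : T => \1_(~` N) t * form t (e i) v).
  have [w wv] := dense_seq (eP v).
  apply: (lim_meas _ (fun n t => form t (e i) (e (w n)))) => [n|t Dt _]; first exact: m0.
  apply: (@lipschitz_cvg rV (form t (e i)) (M * hn (e i))) wv => y.
  by rewrite -formBr form_norm// DI.
move=> u v; have [w wu] := dense_seq (eP u).
apply: (lim_meas _ (fun n t => form t (e (w n)) v)) => [n|t Dt _]; first exact: m1.
apply: (@lipschitz_cvg rV (form t ^~ v) (M * hn v)) wu => y.
by rewrite -formBl mulrAC form_norm// DI.
Qed.

Lemma rj_ext (x y : rH) : (forall v, dot x (rj v) = dot y (rj v)) -> x = y.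
Proof.
move=> xy; apply/eqP; rewrite -subr_eq0; apply/eqP/(dot_j0 rj_dense) => v.
by rewrite dotBl xy subrr.
Qed.

(* The form at time t is sform u v + (B t u, v) with B t : V -> H bounded; on
   the null set where measurability fails B t is 0. *)
Lemma perturbation_exists : exists (B : R -> rV -> rH) (CB : R) (N : set T),
  [/\ measurable N, mu N = 0 & 0 <= CB] /\
  [/\ forall t : T, D t -> real_linear (B t), forall t : T, D t -> bounded_by (B t) CB,
      forall u, wmeas D (B^~ u) &
      forall t u v, D t -> ~ N t -> sform u v + dot (B t u) (rj v) = form t u v].
Proof.
have [N [mN N0 mF]] := form_measurable; have [C C0 jC] := rj_le.
pose CB := M0 + `|nu| * C; have CB0 : 0 <= CB by rewrite addr_ge0 ?(ltW M0_gt0)// mulr_ge0.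
have /choice[B BP] : forall t : R, exists B : rV -> rH, forall u, (N t -> B u = 0) /\
    (D t -> ~ N t -> (forall v, form t u v - sform u v = dot (B u) (rj v)) /\ hn (B u) <= CB * hn u).
  move=> t; suff /choice[B BP] : forall u, exists y : rH, (N t -> y = 0) /\
    (D t -> ~ N t -> (forall v, form t u v - sform u v = dot y (rj v)) /\ hn y <= CB * hn u) by exists B.
  move=> u; have [Nt|nNt] := pselect (N t); first by exists 0.
  have [Dt|nDt] := pselect (D t); last by exists 0.
  (* The hypothesis on differences enters here: as a functional of v, the difference of the forms is
     bounded in the norm of H alone, hence is represented by a vector of H. *)
  have [||||y yP yC] := @riesz_dense R rV rH rj (fun v => form t u v - sform u v) (CB * hn u) rj_lin.
  - by rewrite mulr_ge0 ?hn_ge0.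
  - by move=> v w; rewrite formDr sformDr; ring.
  - by move=> c v; rewrite formZr sformZr; ring.
  - move=> v; rewrite /sform opprD addrA /CB 2!mulrDl; apply: lerD.
      by apply: form_diff => //; exact: in_ge0.
    rewrite (le_trans (ler_norm _))// normrN normrM -!mulrA; apply: ler_wpM2l => //.
    apply: (le_trans (normr_dot_le _ _)); rewrite mulrA; apply: ler_wpM2r; [exact: hn_ge0|exact: jC].
  exists y; split => // _ _; split => // v.
  by rewrite yP dotC.
exists B, CB, N; split => //.
have BN t u : N t -> B t u = 0 := (BP t u).1.
split.
- move=> t Dt; have [Nt|nNt] := pselect (N t).
    by split=> [x y|c x]; rewrite !BN// ?addr0 ?scaler0.
  have E u := ((BP t u).2 Dt nNt).1.
  split=> [x y|c x]; apply: rj_ext => v.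
    by rewrite dotDl -!E formDl sformDl; ring.
  by rewrite dotZl -!E formZl sformZl; ring.
- move=> t Dt u; have [Nt|nNt] := pselect (N t); last exact: ((BP t u).2 Dt nNt).2.
  by rewrite BN// hn0 mulr_ge0 ?hn_ge0.
- move=> u x; have [v vx] := dense_seq (rj_dense x).
  apply: (@measurable_fun_cvg _ _ _ D (fun n t => dot (B t u) (rj (v n)))).
    move=> n; apply: (@eq_measurable_fun _ _ _ _ D
      (fun t : T => \1_(~` N) t * form t u (v n) - \1_(~` N) t * sform u (v n))).
      move=> t; rewrite inE => Dt; rewrite indicE; have [Nt|nNt] := pselect (N t).
        rewrite memNset; last by move=> /(_ Nt).
        by rewrite BN// dot0l !mul0r subrr.
      by rewrite mem_set// !mul1r (((BP t u).2 Dt nNt).1).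
    apply: measurable_funB; first exact: mF.
    apply: measurable_funM; last exact: measurable_cst.
    by apply: measurable_funTS; apply: measurable_indic; exact: measurableC.
  move=> t _; rewrite dotC; under eq_fun do rewrite dotC.
  exact: (hcvg_dot vx).
- move=> t u v Dt nNt; rewrite -(((BP t u).2 Dt nNt).1); ring.
Qed.


Definition form_evolves (u0 : rV) (f y U : R -> rH) : Prop :=
  primitive tau (rj u0) (fun t => f t - y t) U /\
  {ae mu, forall t, 0 < t < tau -> part_in_H ipH j (a t) (U t) (y t)}.

Lemma form_evolution :
  (forall u0 f, sqint tau f -> exists y U : R -> rH, sqint tau y /\ form_evolves u0 f y U) /\
  exists2 K : R, 0 <= K & forall u0 (f y U : R -> rH), sqint tau f -> sqint tau y ->
    form_evolves u0 f y U -> N2 tau y <= K * (hn u0 ^+ 2 + N2 tau f).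
Proof.
have [C C0 jC] := rj_le; have sM := sform_le C0 jC.
have Mk0 : 0 <= M + `|nu| * (C * C) by rewrite addr_ge0 ?(ltW M_gt0)// !mulr_ge0.
have [S [CS [[S_lin CS0 S_le SS S_r] [S_range S_onto]]]] := form_square_root.
have [B [CB [N [[mN N0 CB0] [B_lin B_le B_meas BE]]]]] := perturbation_exists.
(* The two descriptions can differ only on the null set [N] and at the endpoint tau. *)
have E u0 f y U : evolves rj sform tau B u0 f y U <-> form_evolves u0 f y U.
  split=> -[pU eU]; split => //.
    have /ae_oc [A [mA A0 AP]] := eU; exists (A `|` N); split.
    - exact: measurableU.
    - by rewrite measureU0.
    move=> t /= nP; have [Nt|nNt] := pselect (N t); [by right|left].
    apply: AP => /= H0; apply: nP => tt; have [w w1 w2] := H0 tt.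
    have Dt : D t by move: tt => /andP[h1 h2]; rewrite /= in_itv/= h1 ltW.
    apply/part_in_HP; exists w => // v; exact: etrans (esym (BE t w v Dt nNt)) (w2 v).
  have /ae_oc [A [mA A0 AP]] := eU; exists (A `|` N); split.
  - exact: measurableU.
  - by rewrite measureU0.
  move=> t /= nP; have [Nt|nNt] := pselect (N t); [by right|left].
  apply: AP => /= H0; apply: nP => Dt; have /part_in_HP[w w1 w2] := H0 Dt.
  by exists w => // v; exact: etrans (BE t w v Dt nNt) (w2 v).
split.
  move=> u0 f f2; have [y [U [y2 ev]]] := evolution_exists rj_lin C0 jC rj_inj rj_dense
    sformDl sformZl sformDr sformZr Mk0 sM delta_gt0 sform_coercive S_lin CS0 S_le SS S_r
    S_range S_onto tau_gt0 rHsep CB0 B_lin B_le B_meas u0 f2.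
  by exists y, U; split => //; exact/E.
have [K K0 KP] := evolution_estimate rj_lin C0 jC rj_inj rj_dense
    sformDl sformZl sformDr sformZr Mk0 sM delta_gt0 sform_coercive S_lin CS0 S_le SS S_r
    S_range S_onto tau_gt0 rHsep CB0 B_lin B_le B_meas.
exists K => // u0 f y U f2 y2 /E ev; exact: KP f2 y2 ev.
Qed.

(** Cauchy-Schwarz tested against U t - x itself, then division by its squared norm. *)
Lemma primitive_sup x (g U : R -> rH) t : sqint tau g -> primitive tau x g U -> 0 <= t <= tau ->
  hn (U t - x) ^+ 2 <= tau * N2 tau g.
Proof.
move=> g2 gU tt; have := sqint_prim_le tau_gt0 rHsep (U t - x) g2 tt.
have -> : \int[mu]_(s in (`]0, t]%classic : set T)) dot (g s) (U t - x) = hn (U t - x) ^+ 2.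
  by rewrite sqr_hn [in RHS]dotBl gU// addrAC subrr add0r.
set q := hn _ ^+ 2 => qq; have [q0|q0] := eqVneq q 0.
  by rewrite q0 mulr_ge0 ?N2_ge0 ?(ltW tau_gt0).
have qp : 0 < q by rewrite lt_def q0 sqr_ge0.
rewrite -(ler_pM2r qp) -expr2; apply: (le_trans qq).
by have -> : N2 tau g * (q * tau) = tau * N2 tau g * q by ring.
Qed.

(** Uniqueness and the estimate concern every solution, so an arbitrary one is replaced by
    measurable representatives and its derivative by a genuine integral equation. *)
Lemma solution_evolves (u0 : V) (f : R -> H) (f' : R -> rH) (u du Au : R -> H) : sqint tau f' ->
  {ae mu, forall t, 0 < t < tau -> f t = f' t} ->
  L2_solution_with tau (fun t => part_in_H ipH j (a t)) f (j u0) u du Au ->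
  exists y U : R -> rH, [/\ sqint tau y, form_evolves u0 f' y U,
    {ae mu, forall t, 0 < t < tau -> u t = U t},
    {ae mu, forall t, 0 < t < tau -> Au t = y t} &
    {ae mu, forall t, 0 < t < tau -> du t = f' t - y t}].
Proof.
move=> f2 ff' [[u_L2 du_L2 wd] eA ef u_init].
have [u' u2 uu'] := good_version ipHE sepH u_L2.
have [g g2 dug] := good_version ipHE sepH du_L2.
have [U gU] := primitive_exists (rj u0) (sqint_bint rHsep g2).
have uU := H1_primitive sepH tau_gt0 u2 g2 uu' dug wd u_init gU.
have Auy : {ae mu, forall t, 0 < t < tau -> Au t = f' t - g t}.
  move: ef ff' dug => [N1 [m1 z1 P1]] [N2 [m2 z2 P2]] [N3 [m3 z3 P3]].
  exists (N1 `|` N2 `|` N3); split.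
  - by do 2 apply: measurableU => //.
  - by rewrite measureU0 ?measureU0//; exact: measurableU.
  move=> t /= nP; apply: contrapT => nN; apply: nP => tt.
  have e1 : du t + Au t = f t.
    by apply: contrapT => h; apply: nN; left; left; apply: P1 => /= /(_ tt).
  have e2 : f t = f' t by apply: contrapT => h; apply: nN; left; right; apply: P2 => /= /(_ tt).
  have e3 : du t = g t by apply: contrapT => h; apply: nN; right; apply: P3 => /= /(_ tt).
  by rewrite -e2 -e1 -e3 addrAC subrr add0r.
exists (fun t => f' t - g t), U; split => //.
- exact: sqint_sub.
- split.
    have := gU; congr (primitive _ _ _ _); apply/funext => t.
    by rewrite opprB addrC subrK.
  move: eA uU Auy => [N1 [m1 z1 P1]] [N2 [m2 z2 P2]] [N3 [m3 z3 P3]].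
  exists (N1 `|` N2 `|` N3); split.
  - by do 2 apply: measurableU => //.
  - by rewrite measureU0 ?measureU0//; exact: measurableU.
  move=> t /= nP; apply: contrapT => nN; apply: nP => tt.
  have e2 : u t = U t by apply: contrapT => h; apply: nN; left; right; apply: P2 => /= /(_ tt).
  have e3 : Au t = f' t - g t by apply: contrapT => h; apply: nN; right; apply: P3 => /= /(_ tt).
  rewrite -e2 -e3; apply: contrapT => h; apply: nN; left; left; apply: P1 => /= H0.
  by apply: h; apply: H0.
- by apply: ae_imp dug => t H0 tt; rewrite H0// opprB addrC subrK.
Qed.

Lemma evolves_solution (u0 : V) (f : R -> H) (f' y U : R -> rH) : sqint tau f' -> sqint tau y ->
  {ae mu, forall t, 0 < t < tau -> f t = f' t} -> form_evolves u0 f' y U ->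
  L2_solution_with tau (fun t => part_in_H ipH j (a t)) f (j u0) (U : R -> H)
    (fun t => f' t - y t) (y : R -> H).
Proof.
move=> f2 y2 ff' [pU eA]; have g2 := sqint_sub rHsep f2 y2.
split => //; last exact: (primitive_initial sepH tau_gt0 g2 pU).
  split; [|exact: (sqint_in_L2 sepH g2)|exact: (primitive_weak_derivative sepH tau_gt0 g2 pU)].
  exact: (sqint_in_L2 sepH (primitive_sqint sepH tau_gt0 g2 pU)).
by apply: ae_imp ff' => t H0 tt; rewrite subrK H0.
Qed.

Lemma form_evolves_sub u0 f (y1 y2 U1 U2 : R -> rH) : sqint tau f -> sqint tau y1 -> sqint tau y2 ->
  form_evolves u0 f y1 U1 -> form_evolves u0 f y2 U2 ->
  form_evolves 0 (fun=> 0) (fun t => y1 t - y2 t) (fun t => U1 t - U2 t).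
Proof.
move=> f2 y12 y22 [p1 e1] [p2 e2]; split.
  move=> t tt x; have /andP[h1 h2] := tt.
  have i1 := RIJ (lexx 0) h2 (bint_dot x (sqint_bint rHsep (sqint_sub rHsep f2 y12))).
  have i2 := RIJ (lexx 0) h2 (bint_dot x (sqint_bint rHsep (sqint_sub rHsep f2 y22))).
  rewrite dotBl p1// p2// (rl0 rj_lin) dot0l add0r opprD addrACA subrr add0r.
  rewrite -(RintegralB (mitv _) i1 i2); apply: eq_Rintegral => s _.
  by rewrite -dotBl; congr (dot _ _); rewrite opprB addrC addrA subrK sub0r opprB.
move: e1 e2 => [N1 [m1 z1 P1]] [N2 [m2 z2 P2]].
exists (N1 `|` N2); split; [exact: measurableU|by rewrite measureU0|].
move=> t /= nP; apply: contrapT => nN; apply: nP => tt.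
have /part_in_HP[w1 w1U w1P] : part_in_H ipH j (a t) (U1 t) (y1 t).
  by apply: contrapT => h; apply: nN; left; apply: P1 => /= /(_ tt).
have /part_in_HP[w2 w2U w2P] : part_in_H ipH j (a t) (U2 t) (y2 t).
  by apply: contrapT => h; apply: nN; right; apply: P2 => /= /(_ tt).
apply/part_in_HP; exists (w1 - w2); first by rewrite (rlB rj_lin) w1U w2U.
by move=> v; rewrite formBl w1P w2P (@dotBl _ rH).
Qed.

(** For uniqueness, the difference of two solutions has zero data: the estimate kills the difference
    of the A(t) u(t), and the integral equation then kills that of the solutions. *)
Lemma form_maximal_regularity (u0 : V) :
  maximal_L2_regularity tau (fun t => part_in_H ipH j (a t)) (j u0).
Proof.
have [ex [K K0 KP]] := form_evolution.
move=> f f_L2; have [f' f2 ff'] := good_version ipHE sepH f_L2; split.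
  have [y [U [y2 ev]]] := ex u0 f' f2.
  by exists U, (fun t => f' t - y t), y; exact: evolves_solution.
move=> u v [du [Au su]] [dv [Av sv]].
have [y1 [U1 [y12 ev1 u1 _ _]]] := solution_evolves f2 ff' su.
have [y2 [U2 [y22 ev2 u2 _ _]]] := solution_evolves f2 ff' sv.
have ev := form_evolves_sub f2 y12 y22 ev1 ev2.
have z2 : sqint tau (fun=> 0 : rH) := sqint_cst tau rHsep 0.
have y2' := sqint_sub rHsep y12 y22.
have := KP _ _ _ _ z2 y2' ev; rewrite hn0 expr0n N2_0 addr0 mulr0 => yz.
have g2 := sqint_sub rHsep z2 y2'.
have gz : N2 tau (fun t => 0 - (y1 t - y2 t)) <= 0.
  rewrite (_ : N2 _ _ = N2 tau (fun t => y1 t - y2 t))//.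
  by apply: eq_Rintegral => t _; rewrite sub0r hnN.
have UU t : 0 < t < tau -> U1 t = U2 t.
  move=> /andP[h1 h2]; have tt : 0 <= t <= tau by rewrite !ltW.
  have := primitive_sup g2 ev.1 tt; rewrite (rl0 rj_lin) subr0 => h3.
  have h4 : tau * N2 tau (fun t => 0 - (y1 t - y2 t)) <= 0 by rewrite pmulr_rle0.
  apply/eqP; rewrite -subr_eq0; apply/eqP/hn_eq0/eqP; rewrite -sqrf_eq0 eq_le sqr_ge0 andbT.
  exact: le_trans h4.
move: u1 u2 => [N1 [m1 z1 P1]] [N2' [m2 z2' P2]].
exists (N1 `|` N2'); split; [exact: measurableU|by rewrite measureU0|].
move=> t /= nP; apply: contrapT => nN; apply: nP => tt.
have -> : u t = U1 t by apply: contrapT => h; apply: nN; left; apply: P1 => /= /(_ tt).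
have -> : v t = U2 t by apply: contrapT => h; apply: nN; right; apply: P2 => /= /(_ tt).
exact: UU.
Qed.

Lemma form_estimate : exists2 C : R, 0 < C &
  forall (u0 : V) (f u du Au : R -> H), in_L2 `]0, tau[ f ->
    L2_solution_with tau (fun t => part_in_H ipH j (a t)) f (j u0) u du Au ->
    in_L2 `]0, tau[ Au /\
    L2norm `]0, tau[ Au + H1norm tau u du <= C * (rnorm u0 + L2norm `]0, tau[ f).
Proof.
have [_ [K K0 KP]] := form_evolution; have [Cj Cj0 jC] := rj_le.
(* [K2] bounds u' = f - A u, and [K3] bounds u itself through the initial value and
   [primitive_sup]. *)
pose K2 := 2 + 2 * K; pose K3 := tau * (2 * Cj ^+ 2 + 2 * (tau * K2)).
have K20 : 0 <= K2 by rewrite addr_ge0// mulr_ge0.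
have K30 : 0 <= K3.
  by rewrite mulr_ge0 ?(ltW tau_gt0)// addr_ge0 ?mulr_ge0 ?sqr_ge0// ltW.
exists (Num.sqrt K + Num.sqrt (K3 + K2) + 1).
  by rewrite ltr_wpDl// addr_ge0 ?sqrtr_ge0.
move=> u0 f u du Au f_L2 su.
have [f' f2 ff'] := good_version ipHE sepH f_L2.
have [y [U [y2 ev uU Auy dug]]] := solution_evolves f2 ff' su.
have g2 := sqint_sub rHsep f2 y2; have U2 := primitive_sqint sepH tau_gt0 g2 ev.1.
split.
  apply: in_L2_ae (sqint_in_L2 sepH y2).
  by apply: ae_imp Auy => t H0 tt; rewrite H0.
pose P := rnorm u0 + L2norm `]0, tau[ f.
have f0 : 0 <= L2norm `]0, tau[ f by rewrite sqrtr_ge0.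
have P0 : 0 <= P by rewrite addr_ge0// rnorm_ge0.
pose X := hn (u0 : rV) ^+ 2 + N2 tau f'.
have XP : X <= P ^+ 2.
  rewrite /X hn_rnorm -(L2norm_N2 f2 ff') /P sqrrD.
  by rewrite lerD2r lerDl mulrn_wge0// mulr_ge0// rnorm_ge0.
have n2f := N2_ge0 tau f'; have u00 := sqr_ge0 (hn (u0 : rV)).
have X0 : 0 <= X by rewrite addr_ge0.
have yX : N2 tau y <= K * X := KP u0 f' y U f2 y2 ev.
have gX : N2 tau (fun t => f' t - y t) <= K2 * X.
  have := N2_add rHsep f2 (sqint_scale rHsep (-1) y2); rewrite (N2_scale _ y2) sqrrN expr1n mul1r.
  have -> : (fun t => f' t + -1 *: y t) = (fun t => f' t - y t) by apply/funext => t; rewrite scaleN1r.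
  by rewrite /K2 /X mulrDl; move: yX; rewrite /X; lra.
have UX : N2 tau U <= K3 * X.
  have muD : (mu D < +oo)%E by exact: mu_itv_fin.
  pose c := (2 * Cj ^+ 2 + 2 * (tau * K2)) * X.
  have Uc t : D t -> hn (U t) ^+ 2 <= c.
    move=> Dt; have h1 := primitive_sup g2 ev.1 (in_ge0 Dt).
    have h2 := hnD (U t - rj u0) (rj u0); rewrite subrK in h2.
    have h3 : hn (U t) ^+ 2 <= (hn (U t - rj u0) + hn (rj u0)) ^+ 2.
      by rewrite lerXn2r ?nnegrE ?addr_ge0 ?hn_ge0.
    have h4 := sqr_ge0 (hn (U t - rj u0) - hn (rj u0)).
    have h5 : hn (rj u0) ^+ 2 <= Cj ^+ 2 * X.
      apply: (@le_trans _ _ (Cj ^+ 2 * hn (u0 : rV) ^+ 2)).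
        by rewrite -exprMn lerXn2r ?nnegrE ?mulr_ge0 ?hn_ge0//; exact: jC.
      by apply: ler_wpM2l; [exact: sqr_ge0|rewrite /X lerDl].
    have h6 : tau * N2 tau (fun t => f' t - y t) <= tau * (K2 * X).
      by apply: ler_wpM2l => //; exact: ltW.
    have -> : c = 2 * (Cj ^+ 2 * X) + 2 * (tau * (K2 * X)) by rewrite /c; ring.
    by move: h1 h3 h4 h5 h6; lra.
  apply: (le_trans (N2_le U2 (RI_cst (mitv _) c muD) Uc)).
  rewrite Rintegral_cst//.
  have -> : fine (mu D) = tau by rewrite lebesgue_measure_itv/= lte_fin tau_gt0 -EFinB/= subr0.
  by rewrite /c /K3 le_eqVlt; apply/orP; left; apply/eqP; ring.
have n1 : L2norm `]0, tau[ Au <= Num.sqrt K * P.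
  rewrite -[leLHS]ger0_norm ?sqrtr_ge0// -sqrtr_sqr -[X in _ * X](ger0_norm P0) -sqrtr_sqr.
  rewrite -sqrtrM// ler_sqrt ?mulr_ge0 ?sqr_ge0// (L2norm_N2 y2 Auy) (le_trans yX)//.
  exact: ler_wpM2l.
have n2 : H1norm tau u du <= Num.sqrt (K3 + K2) * P.
  have KK : 0 <= K3 + K2 by rewrite addr_ge0.
  rewrite -[X in _ * X](ger0_norm P0) -sqrtr_sqr -sqrtrM// ler_sqrt ?mulr_ge0 ?sqr_ge0//.
  rewrite (L2norm_N2 U2 uU) (L2norm_N2 g2 dug) mulrDl.
  apply: lerD; [apply: (le_trans UX)|apply: (le_trans gX)]; exact: ler_wpM2l.
by rewrite -/P 2!mulrDl mul1r; lra.
Qed.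

End Forms.

Theorem proposition2p5 (R : realType) (k : scalar_kind)
  (H : completeNormedModType (scalars R k)) (ipH : {dot H for @conjK R k})
  (V : completeNormedModType (scalars R k)) (ipV : {dot V for @conjK R k})
  (j : {linear V -> H}) (tau : R)
  (a : R -> {bilinear V -> V -> scalars R k | *%R & (@conjK R k \; *%R)})
  (M delta nu M0 : R)
  (ipHE : inner_product_of_norm ipH) (sepH : separable H)
  (ipVE : inner_product_of_norm ipV) (sepV : separable V)
  (j_inj : injective j) (j_cont : continuous j) (j_dense : dense (range j))
  (tau_gt0 : 0 < tau) (M_gt0 : 0 < M) (delta_gt0 : 0 < delta)
  (a_meas : forall u v : V,
     @strongly_measurable R k (scalars R k)^o `[0, tau] (fun t => a t u v))
  (a_bounded : forall (t : R) (u v : V), 0 <= t <= tau ->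
     rnorm (a t u v) <= M * rnorm u * rnorm v)
  (a_coercive : forall (t : R) (u : V), 0 <= t <= tau ->
     delta * rnorm u ^+ 2 <= reK (a t u u) + nu * rnorm (j u) ^+ 2)
  (M0_gt0 : 0 < M0)
  (a_diff : forall (t s : R) (u v : V), 0 <= t <= tau -> 0 <= s <= tau ->
     rnorm (a t u v - a s u v) <= M0 * rnorm u * rnorm (j v))
  (a_sqrt : exists2 t0 : R, 0 <= t0 <= tau &
     op_dom (op_sqrt (op_shift (part_in_H ipH j (a t0)) nu)) = range j) :
  (forall u0 : V,
     maximal_L2_regularity tau (fun t => part_in_H ipH j (a t)) (j u0)) /\
  (exists2 C : R, 0 < C &
     forall (u0 : V) (f u du Au : R -> H), in_L2 `]0, tau[ f ->
       L2_solution_with tau (fun t => part_in_H ipH j (a t)) f (j u0) u du Au ->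
       in_L2 `]0, tau[ Au /\
       L2norm `]0, tau[ Au + H1norm tau u du <=
         C * (rnorm u0 + L2norm `]0, tau[ f)).
Proof.
have [t0 t0_in sq] := a_sqrt; split.
  exact: (form_maximal_regularity ipHE sepH ipVE sepV j_inj j_cont j_dense tau_gt0
    M_gt0 delta_gt0 a_meas a_bounded a_coercive M0_gt0 a_diff t0_in sq).
exact: (form_estimate ipHE sepH ipVE sepV j_inj j_cont j_dense tau_gt0
  M_gt0 delta_gt0 a_meas a_bounded a_coercive M0_gt0 a_diff t0_in sq).
Qed.
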